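(* Let $X$ be a finite rank operator on $\mathcal H=L^2(\mathbb R)$. If the set $\{w\in\mathbb R^2 \mid \alpha(X)(w)\neq 0\}$ has finite Lebesgue measure, then $X=0$.
   Context: For $x,y\in\mathbb R$ and $z\in\mathbb C$ with $|z|=1$, define the unitary operator $\rho(x,y,z)$ on $\mathcal H=L^2(\mathbb R)$ by $(\rho(x,y,z)\varphi)(t)=z\,e^{\pi i(xy+2yt)}\varphi(t+x)$. For a trace class operator $X$ on $\mathcal H$, its modified Fourier–Wigner transform is the function $\alpha(X):\mathbb R^2\to\mathbb C$, $\alpha(X)(x,y)=\operatorname{tr}\big(X\rho(x,y,1)^*\big)$. (Equivalently: if $f\in L^1(\mathbb R^2)$ vanishes outside a set of finite measure and its Weyl transform $W(f)=\iint f(x,y)\rho(x,y,1)\,dx\,dy$ has finite rank, then $f\equiv 0$.) *)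

(* Defs.v *)
(* MathComp-Analysis (Lebesgue integration on a realType R)
   + mathcomp-real-closed complex numbers R[i]. *)
From mathcomp Require Import all_boot all_algebra.
From mathcomp Require Import all_classical all_reals all_analysis.
From mathcomp Require Import complex.
Import GRing.Theory Num.Theory.

Set Implicit Arguments.
Unset Strict Implicit.
Unset Printing Implicit Defensive.

Local Open Scope classical_set_scope.
Local Open Scope ring_scope.

(* Lebesgue measure on R. *)
Notation leb R := (@lebesgue_measure R).

(* Integral over R of a complex-valued function, via real and imaginary parts
   (Lebesgue integral, real-valued version Rintegral). *)
Definition cint (R : realType) (h : R -> R[i]) : R[i] :=
  Complex (Rintegral (leb R) setT (fun t => complex.Re (h t)))
          (Rintegral (leb R) setT (fun t => complex.Im (h t))).

(* f is a (representative of an) element of L^2(R) with complex values: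
   measurable and square integrable. *)
Definition L2 (R : realType) (f : R -> R[i]) : Prop :=
  measurable_fun setT (fun t => complex.Re (f t)) /\
  measurable_fun setT (fun t => complex.Im (f t)) /\
  (\int[leb R]_(t in setT)
      ((complex.Re (f t)) ^+ 2 + (complex.Im (f t)) ^+ 2)%:E < +oo)%E.

(* Inner product on L^2(R), linear in the first argument. *)
Definition inner (R : realType) (f g : R -> R[i]) : R[i] :=
  cint (fun t => f t * (g t)^*).

(* e^{i theta} *)
Definition expi (R : realType) (theta : R) : R[i] := Complex (cos theta) (sin theta).

(* (rho(x,y,z) phi)(t) = z e^{pi i (x y + 2 y t)} phi(t + x) *)
Definition rho (R : realType) (x y : R) (z : R[i]) (phi : R -> R[i]) : R -> R[i] :=
  fun t => z * expi (pi * (x * y + 2 * y * t)) * phi (t + x).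

(* A finite rank operator X = sum_k < . , g_k > f_k, given by f g : 'I_n -> L^2. *)
Definition finop (R : realType) (n : nat) (f g : 'I_n -> R -> R[i])
  (phi : R -> R[i]) : R -> R[i] :=
  fun t => \sum_(k < n) inner phi (g k) * f k t.

(* Modified Fourier-Wigner transform alpha(X)(x,y) = tr(X rho(x,y,1)^* ).
   For X = sum_k <.,g_k> f_k one has X rho^* = sum_k <., rho g_k> f_k,
   whose trace is sum_k <f_k, rho(x,y,1) g_k>. *)
Definition alpha (R : realType) (n : nat) (f g : 'I_n -> R -> R[i])
  (w : R * R) : R[i] :=
  \sum_(k < n) inner (f k) (rho w.1 w.2 1 (g k)).

(* Main.v *)
(* Up to a unimodular factor, alpha(X)(x, y) is the Fourier transform in t of
   the correlation corr x t = sum_k f_k(t) conj(g_k(t + x)). Summing corr x over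
   t + Z gives the inner product, in l^2(Z; C^n), of the orbit of f at t and the
   orbit of g at t + x. After modulating f by a generic frequency, the finite
   measure hypothesis leaves only finitely many nonzero Fourier coefficients of
   this periodic function of t for almost every x, so it is a trigonometric
   polynomial: it vanishes either almost everywhere (x is inactive) or almost
   nowhere (x is active). The active set has finite measure; if it were not
   null, choosing x0 active, rightmost in x0 + Z and far to the right, and
   generic t_0 < ... < t_n in [0, 1[, the orbits of f at the t_i and of g at
   the t_i + x0 would have block triangular correlations under the shift of
   l^2(Z; C^n) with nonzero diagonal. This yields n + 1 orthogonal wandering
   vectors for a shift of multiplicity n, which Bessel's inequality forbids.
   Hence every coefficient vanishes, and uniqueness of Fourier transforms shows
   that the integral kernel of X is zero almost everywhere. *)
From HB Require Import structures.
Require Import Defs.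
From mathcomp Require Import all_boot all_order all_algebra.
From mathcomp Require Import all_classical all_reals all_analysis.
From mathcomp Require Import measurable_realfun complex.
From mathcomp Require Import ring lra zify.
Import Order.TTheory GRing.Theory Num.Theory.
Import numFieldNormedType.Exports.

Set Implicit Arguments.
Unset Strict Implicit.
Unset Printing Implicit Defensive.

Local Open Scope classical_set_scope.
Local Open Scope ring_scope.

(** * Complex-valued integrals *)

Section complex_measurable.
Context {d : measure_display} {T : measurableType d} {R : realType}.
Implicit Types (h : T -> R[i]) (mu : {measure set T -> \bar R}).

(** The hypothesis bounds a measure and says nothing about boundedness of the set, so arguments by
    compact support and analyticity are out of reach. Restricting to classes modulo 1 is the
    substitute: a set of finite measure meets almost every class in a finite set. This is used in
    the frequency, where it gives trigonometric polynomials, and again in [x], where it gives a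
    rightmost point. The entries that must vanish do so for two different reasons. For [i <> c], the
    correlation of [t_i] with [t_c + x0 + j] has displacement [x0 + (t_c - t_i + j)], which lies to
    the right of [x0] when [j > 0], or when [j = 0] and [i < c]; a generic choice of the points
    keeps it off the small set where the correlation is nonzero. For [i = c] the displacement is
    [x0 + j] whatever the points are, and only the choice of [x0] as rightmost can help. Going far
    to the right makes the active tail so small that [n + 1] points, each excluding a share of [0,
    1[, still fit. Fourier uniqueness rests on square waves: they are bounded limits of
    trigonometric polynomials, and integrals against signs determine an integrable function. *)

Definition cmeas h : Prop :=
  measurable_fun setT (fun t => complex.Re (h t)) /\
  measurable_fun setT (fun t => complex.Im (h t)).

(* The l^1 norm on C = R^2: it is submultiplicative, which is all that the
   domination arguments need. *)
Definition n1 (z : R[i]) : R := `|complex.Re z| + `|complex.Im z|.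

Definition sqn (z : R[i]) : R := complex.Re z ^+ 2 + complex.Im z ^+ 2.

Lemma ReM (z w : R[i]) : complex.Re (z * w) =
  complex.Re z * complex.Re w - complex.Im z * complex.Im w.
Proof. by case: z; case: w. Qed.

Lemma ImM (z w : R[i]) : complex.Im (z * w) =
  complex.Re z * complex.Im w + complex.Im z * complex.Re w.
Proof. by case: z; case: w. Qed.

Lemma ReD (z w : R[i]) : complex.Re (z + w) = complex.Re z + complex.Re w.
Proof. by case: z; case: w. Qed.

Lemma ImD (z w : R[i]) : complex.Im (z + w) = complex.Im z + complex.Im w.
Proof. by case: z; case: w. Qed.

Lemma ReN (z : R[i]) : complex.Re (- z) = - complex.Re z.
Proof. by case: z. Qed.

Lemma ImN (z : R[i]) : complex.Im (- z) = - complex.Im z.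
Proof. by case: z. Qed.

Lemma ReJ (z : R[i]) : complex.Re (z^*) = complex.Re z.
Proof. by case: z. Qed.

Lemma ImJ (z : R[i]) : complex.Im (z^*) = - complex.Im z.
Proof. by case: z. Qed.

Lemma n1_ge0 z : 0 <= n1 z.
Proof. by rewrite addr_ge0. Qed.

Lemma n1M z w : n1 (z * w) <= n1 z * n1 w.
Proof.
rewrite /n1 ReM ImM; set a := complex.Re z; set b := complex.Im z.
set c := complex.Re w; set e := complex.Im w.
have := ler_normB (a * c) (b * e); have := ler_normD (a * e) (b * c).
by rewrite !normrM; nra.
Qed.

(** The inequality of arithmetic and geometric means, on real and imaginary parts separately. It
    makes products of square integrable functions integrable. *)
Lemma n1_mul_conj z w : n1 (z * w^*) <= sqn z + sqn w.
Proof.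
rewrite /n1 /sqn ReM ImM ReJ ImJ.
have Hn (x y : R) : x <= y -> - x <= y -> `|x| <= y.
  by move=> xy xy'; rewrite ler_norml; lra.
set a := complex.Re z; set b := complex.Im z.
set c := complex.Re w; set e := complex.Im w.
apply: (@le_trans _ _ ((a ^+ 2 + b ^+ 2 + (c ^+ 2 + e ^+ 2)) / 2 +
                       (a ^+ 2 + b ^+ 2 + (c ^+ 2 + e ^+ 2)) / 2)); last by lra.
by apply: lerD; apply: Hn; rewrite -subr_ge0;
 [have := sqr_ge0 (a - c); have := sqr_ge0 (b - e)
 |have := sqr_ge0 (a + c); have := sqr_ge0 (b + e)
 |have := sqr_ge0 (a + e); have := sqr_ge0 (b - c)
 |have := sqr_ge0 (a - e); have := sqr_ge0 (b + c)]; nra.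
Qed.

Lemma sqn_ge0 z : 0 <= sqn z.
Proof. by rewrite addr_ge0 ?sqr_ge0. Qed.

Lemma sqnM z w : sqn (z * w) = sqn z * sqn w.
Proof. by rewrite /sqn ReM ImM; ring. Qed.

Lemma sqnD z w : sqn (z + w) <= 2 * (sqn z + sqn w).
Proof.
rewrite /sqn ReD ImD; have := sqr_ge0 (complex.Re z - complex.Re w).
by have := sqr_ge0 (complex.Im z - complex.Im w); nra.
Qed.

Lemma cmeas_cst (c : R[i]) : cmeas (fun=> c).
Proof. by split; exact: measurable_cst. Qed.

Lemma cmeasD h1 h2 : cmeas h1 -> cmeas h2 -> cmeas (fun t => h1 t + h2 t).
Proof.
move=> [a b] [c e]; split.
- by under eq_fun do rewrite ReD; exact: measurable_funD.
- by under eq_fun do rewrite ImD; exact: measurable_funD.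
Qed.

Lemma cmeasM h1 h2 : cmeas h1 -> cmeas h2 -> cmeas (fun t => h1 t * h2 t).
Proof.
move=> [a b] [c e]; split.
- by under eq_fun do rewrite ReM; apply: measurable_funB; exact: measurable_funM.
- by under eq_fun do rewrite ImM; apply: measurable_funD; exact: measurable_funM.
Qed.

Lemma cmeas_conj h : cmeas h -> cmeas (fun t => (h t)^*).
Proof.
move=> [a b]; split.
- by under eq_fun do rewrite ReJ.
- by under eq_fun do rewrite ImJ; exact: measurable_funN.
Qed.

Lemma cmeas_sum (I : Type) (s : seq I) (P : pred I) (h : I -> T -> R[i]) :
  (forall i, cmeas (h i)) -> cmeas (fun t => \sum_(i <- s | P i) h i t).
Proof.
move=> mh; elim: s => [|i s ih].
  by under eq_fun do rewrite big_nil; exact: cmeas_cst.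
under eq_fun do rewrite big_cons /=; case: (P i) => //.
exact: cmeasD.
Qed.

Lemma measurable_n1 h : cmeas h -> measurable_fun setT (fun t => n1 (h t)).
Proof. by move=> [a b]; apply: measurable_funD; exact: measurableT_comp. Qed.

Lemma measurable_sqn h : cmeas h -> measurable_fun setT (fun t => sqn (h t)).
Proof. by move=> [a b]; apply: measurable_funD; exact: measurable_funX. Qed.

Lemma cmeas_neq0 h : cmeas h -> measurable [set t | h t != 0].
Proof.
move=> [a b].
have -> : [set t | h t != 0] =
    (fun t => complex.Re (h t)) @^-1` [set~ 0] `|`
    (fun t => complex.Im (h t)) @^-1` [set~ 0].
  apply/seteqP; split => t /=; rewrite eq_complex /= negb_and.
    by case/orP => /eqP; [left|right].
  by case => /eqP H; apply/orP; [left|right].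
by apply: measurableU; rewrite -[X in measurable X]setTI;
  [apply: (a measurableT)|apply: (b measurableT)]; exact: measurableC.
Qed.

End complex_measurable.

Lemma cmeas_comp {d1 d2 : measure_display} {T1 : measurableType d1}
    {T2 : measurableType d2} {R : realType} (h : T2 -> R[i]) (phi : T1 -> T2) :
  cmeas h -> measurable_fun setT phi -> cmeas (fun t => h (phi t)).
Proof. by move=> [a b] mphi; split;
  [exact: (measurableT_comp a mphi)|exact: (measurableT_comp b mphi)].
Qed.

Section complex_integral.
Context {d : measure_display} {T : measurableType d} {R : realType}.
Variable mu : {measure set T -> \bar R}.
Implicit Types h : T -> R[i].

(** This is [cint] over an arbitrary measure: it serves both the line and the integers with counting
    measure. Likewise [sqint] below extends [L2]. *)
Definition cI h : R[i] :=
  Complex (Rintegral mu setT (fun t => complex.Re (h t)))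
          (Rintegral mu setT (fun t => complex.Im (h t))).

Definition cintegrable h : Prop :=
  mu.-integrable setT (EFin \o (fun t => complex.Re (h t))) /\
  mu.-integrable setT (EFin \o (fun t => complex.Im (h t))).

Definition sqint h : Prop :=
  cmeas h /\ (\int[mu]_t (sqn (h t))%:E < +oo)%E.

Lemma cintegrable_cmeas h : cintegrable h -> cmeas h.
Proof.
by move=> [/measurable_int /measurable_EFinP a /measurable_int /measurable_EFinP b].
Qed.

Lemma cintegrable_dom h (phi : T -> R) : cmeas h ->
  mu.-integrable setT (EFin \o phi) -> (forall t, n1 (h t) <= phi t) ->
  cintegrable h.
Proof.
move=> [a b] iphi hphi; split; apply: le_integrable iphi => //.
- exact/measurable_EFinP.
- move=> t _ /=; rewrite lee_fin (le_trans _ (ler_norm _))//.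
  by rewrite (le_trans _ (hphi t))// lerDl.
- exact/measurable_EFinP.
- move=> t _ /=; rewrite lee_fin (le_trans _ (ler_norm _))//.
  by rewrite (le_trans _ (hphi t))// lerDr.
Qed.

Lemma integrable_n1 h : cintegrable h ->
  mu.-integrable setT (EFin \o (fun t => n1 (h t))).
Proof.
move=> [a b]; have := integrableD measurableT (integrable_norm a) (integrable_norm b).
by apply: eq_integrable.
Qed.

Lemma cintegrableP h : cmeas h ->
  (\int[mu]_t (n1 (h t))%:E < +oo)%E -> cintegrable h.
Proof.
move=> mh fin; apply: (cintegrable_dom (phi := fun t => n1 (h t))) => //.
apply/integrableP; split; first exact/measurable_EFinP/measurable_n1.
by under eq_integral do rewrite /= ger0_norm ?n1_ge0//.
Qed.

Lemma cintegrable_lty h : cintegrable h -> (\int[mu]_t (n1 (h t))%:E < +oo)%E.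
Proof.
move/integrable_n1/integrableP => [_].
by under eq_integral do rewrite /= ger0_norm ?n1_ge0//.
Qed.

Lemma cintegrableM_bdd h p (M : R) : cmeas p -> (forall t, n1 (p t) <= M) ->
  cintegrable h -> cintegrable (fun t => h t * p t).
Proof.
move=> mp pM ih; apply: (cintegrable_dom (phi := fun t => M * n1 (h t))).
- by apply: cmeasM => //; exact: cintegrable_cmeas.
- exact: (integrableZl measurableT M (integrable_n1 ih)).
- move=> t; rewrite (le_trans (n1M _ _))// mulrC.
  by apply: ler_wpM2r; rewrite ?n1_ge0.
Qed.

Lemma cintegrable0 : cintegrable (fun=> 0).
Proof. by split; exact: integrable0. Qed.

Lemma cintegrableD h1 h2 : cintegrable h1 -> cintegrable h2 ->
  cintegrable (fun t => h1 t + h2 t).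
Proof.
move=> [a b] [c e]; split.
- apply: eq_integrable (integrableD measurableT a c) => // t _ /=.
  by rewrite ReD EFinD.
- apply: eq_integrable (integrableD measurableT b e) => // t _ /=.
  by rewrite ImD EFinD.
Qed.

Lemma cintegrableZ c h : cintegrable h -> cintegrable (fun t => c * h t).
Proof.
move=> ih; have := @cintegrableM_bdd h (fun=> c) (n1 c) (cmeas_cst _).
by under [X in _ -> _ -> cintegrable X]eq_fun do rewrite mulrC; exact.
Qed.

Lemma cintegrable_sum (I : Type) (s : seq I) (P : pred I) (h : I -> T -> R[i]) :
  (forall i, cintegrable (h i)) -> cintegrable (fun t => \sum_(i <- s | P i) h i t).
Proof.
move=> mh; elim: s => [|i s ih].
  by under eq_fun do rewrite big_nil; exact: cintegrable0.
under eq_fun do rewrite big_cons /=; case: (P i) => //.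
exact: cintegrableD.
Qed.

Lemma cI_eq h1 h2 : h1 =1 h2 -> cI h1 = cI h2.
Proof. by move=> /funext ->. Qed.

Lemma cI_ae h1 h2 : cmeas h1 -> cmeas h2 -> {ae mu, forall t, h1 t = h2 t} ->
  cI h1 = cI h2.
Proof.
move=> [a b] [c e] E; rewrite /cI /Rintegral; congr (Complex (fine _) (fine _)).
- apply: ae_eq_integral => //; [exact/measurable_EFinP|exact/measurable_EFinP|].
  by apply: filterS E => t /= ->.
- apply: ae_eq_integral => //; [exact/measurable_EFinP|exact/measurable_EFinP|].
  by apply: filterS E => t /= ->.
Qed.

Lemma cI0 : cI (fun=> 0) = 0.
Proof. by rewrite /cI /Rintegral /= integral0. Qed.

Lemma cID h1 h2 : cintegrable h1 -> cintegrable h2 ->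
  cI (fun t => h1 t + h2 t) = cI h1 + cI h2.
Proof.
move=> [a b] [c e]; rewrite /cI.
under eq_Rintegral do rewrite ReD; under [X in Complex _ X]eq_Rintegral do rewrite ImD.
by rewrite !RintegralD.
Qed.

Lemma cIZ c h : cintegrable h -> cI (fun t => c * h t) = c * cI h.
Proof.
move=> [a b]; rewrite /cI.
have iZ (r : R) (k : T -> R) : mu.-integrable setT (EFin \o k) ->
    mu.-integrable setT (EFin \o (fun t => r * k t)).
  by move=> ik; exact: (integrableZl measurableT r ik).
under eq_Rintegral do rewrite ReM.
under [X in Complex _ X]eq_Rintegral do rewrite ImM.
rewrite RintegralB//; [|exact: iZ|exact: iZ].
rewrite RintegralD//; [|exact: iZ|exact: iZ].
by rewrite !RintegralZl//; case: (c).
Qed.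

Lemma cI_conj h : cintegrable h -> cI (fun t => (h t)^*) = (cI h)^*.
Proof.
move=> [a b]; rewrite /cI.
under eq_Rintegral do rewrite ReJ; under [X in Complex _ X]eq_Rintegral do rewrite ImJ.
congr Complex; under eq_Rintegral do rewrite -mulN1r.
by rewrite RintegralZl// mulN1r.
Qed.

Lemma cI_sum (I : Type) (s : seq I) (P : pred I) (h : I -> T -> R[i]) :
  (forall i, cintegrable (h i)) ->
  cI (fun t => \sum_(i <- s | P i) h i t) = \sum_(i <- s | P i) cI (h i).
Proof.
move=> mh; elim: s => [|i s ih].
  by under eq_fun do rewrite big_nil; rewrite cI0 big_nil.
under eq_fun do rewrite big_cons /=; rewrite big_cons -ih; case: (P i) => //.
by rewrite cID//; exact: cintegrable_sum.
Qed.

Lemma sqint_mul_conj h1 h2 : sqint h1 -> sqint h2 ->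
  cintegrable (fun t => h1 t * (h2 t)^*).
Proof.
move=> [a b] [c e].
apply: (cintegrable_dom (phi := fun t => sqn (h1 t) + sqn (h2 t))).
- by apply: cmeasM => //; exact: cmeas_conj.
- have iq h : cmeas h -> (\int[mu]_t (sqn (h t))%:E < +oo)%E ->
      mu.-integrable setT (EFin \o (fun t => sqn (h t))).
    move=> mh fin; apply/integrableP; split.
      exact/measurable_EFinP/measurable_sqn.
    by under eq_integral do rewrite /= ger0_norm ?sqn_ge0//.
  exact: (integrableD measurableT (iq _ a b) (iq _ c e)).
- by move=> t; exact: n1_mul_conj.
Qed.

Lemma sqintZ c h : sqint h -> sqint (fun t => c * h t).
Proof.
move=> [a b]; split; first by apply: cmeasM => //; exact: cmeas_cst.
under eq_integral do rewrite sqnM EFinM.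
rewrite ge0_integralZl//; [|exact/measurable_EFinP/measurable_sqn| |].
- by rewrite lte_mul_pinfty// lee_fin sqn_ge0.
- by move=> t _; rewrite lee_fin sqn_ge0.
- by rewrite lee_fin sqn_ge0.
Qed.

Lemma sqintD h1 h2 : sqint h1 -> sqint h2 -> sqint (fun t => h1 t + h2 t).
Proof.
move=> [a b] [c e]; split; first exact: cmeasD.
apply: (@le_lt_trans _ _ (\int[mu]_t (2%:E * ((sqn (h1 t))%:E + (sqn (h2 t))%:E)))%E).
  apply: ge0_le_integral => //.
  - by move=> t _; rewrite lee_fin sqn_ge0.
  - exact/measurable_EFinP/measurable_sqn/cmeasD.
  - apply/measurable_EFinP/measurable_funM => //.
    by apply: measurable_funD; exact: measurable_sqn.
  - by move=> t _; rewrite -EFinD -EFinM lee_fin sqnD.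
rewrite ge0_integralZl//; last 2 first.
- apply/measurable_EFinP.
  by apply: measurable_funD; exact: measurable_sqn.
- by move=> t _; rewrite -EFinD lee_fin addr_ge0 ?sqn_ge0.
rewrite lte_mul_pinfty// ge0_integralD//.
- exact: lte_add_pinfty.
- by move=> t _; rewrite lee_fin sqn_ge0.
- exact/measurable_EFinP/measurable_sqn.
- by move=> t _; rewrite lee_fin sqn_ge0.
- exact/measurable_EFinP/measurable_sqn.
Qed.

(** Dominated convergence, in the form in which the uniqueness theorems use it: vanishing integrals
    pass to the limit. *)
Lemma cI_dom_cvg0 (h_ : nat -> T -> R[i]) h (phi : T -> R) :
  (forall n, cmeas (h_ n)) -> cmeas h ->
  mu.-integrable setT (EFin \o phi) -> (forall n t, n1 (h_ n t) <= phi t) ->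
  (forall t, complex.Re (h_ n t) @[n --> \oo] --> complex.Re (h t)) ->
  (forall t, complex.Im (h_ n t) @[n --> \oo] --> complex.Im (h t)) ->
  (forall n, cI (h_ n) = 0) -> cI h = 0.
Proof.
move=> mh_ [mh mh'] iphi dom cRe cIm h0.
have H (k_ : nat -> T -> R) (k : T -> R) :
    (forall n, measurable_fun setT (k_ n)) -> measurable_fun setT k ->
    (forall n t, `|k_ n t| <= phi t) ->
    (forall t, k_ n t @[n --> \oo] --> k t) ->
    (forall n, Rintegral mu setT (k_ n) = 0) -> Rintegral mu setT k = 0.
  move=> mk_ mk kphi ck k0; rewrite /Rintegral.
  have ik n : mu.-integrable setT (EFin \o k_ n).
    apply: le_integrable iphi => //; first exact/measurable_EFinP.
    by move=> t _ /=; rewrite lee_fin (le_trans _ (ler_norm _)).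
  have [] := @dominated_convergence _ _ _ mu setT measurableT
    (fun n => EFin \o k_ n) (EFin \o k) (EFin \o phi).
  - by move=> n; exact/measurable_EFinP.
  - exact/measurable_EFinP.
  - by apply: aeW => t _; apply: cvg_EFin; [exact: nearW|exact: ck].
  - exact: iphi.
  - by apply: aeW => t n _ /=; rewrite lee_fin.
  move=> _ _ /=.
  have -> : (fun n : nat => (\int[mu]_x (k_ n x)%:E)%E) = fun=> 0%E.
    apply/funext => n; rewrite -[LHS]fineK; last first.
      by apply: integrable_fin_num => //; exact: ik.
    by rewrite -[fine _]/(Rintegral _ _ _) k0.
  by move=> /(cvg_unique _ (@cvg_cst _ _ _ _ _)) <-.
rewrite /cI; apply/eqP; rewrite eq_complex /=; apply/andP; split; apply/eqP.
- apply: (H (fun n t => complex.Re (h_ n t))) => //.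
  + by move=> n; exact: (mh_ n).1.
  + by move=> n t; rewrite (le_trans _ (dom n t))// lerDl.
  + by move=> n; have := h0 n; rewrite /cI => -[-> _].
- apply: (H (fun n t => complex.Im (h_ n t))) => //.
  + by move=> n; exact: (mh_ n).2.
  + by move=> n t; rewrite (le_trans _ (dom n t))// lerDr.
  + by move=> n; have := h0 n; rewrite /cI => -[_ ->].
Qed.

End complex_integral.

Section ae_lemmas.
Context {d : measure_display} {T : measurableType d} {R : realType}.
Variable mu : {measure set T -> \bar R}.

Lemma ae_mono (P Q : T -> Prop) : {ae mu, forall t, P t} ->
  (forall t, P t -> Q t) -> {ae mu, forall t, Q t}.
Proof. by move=> aP PQ; exact: filterS PQ aP. Qed.

Lemma ae_mono2 (P Q S : T -> Prop) : {ae mu, forall t, P t} ->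
  {ae mu, forall t, Q t} -> (forall t, P t -> Q t -> S t) ->
  {ae mu, forall t, S t}.
Proof. by move=> aP aQ PQS; exact: filterS2 PQS aP aQ. Qed.

Lemma ge0_integral0_ae (h : T -> \bar R) : measurable_fun setT h ->
  (forall t, 0 <= h t)%E -> (\int[mu]_t h t = 0)%E ->
  {ae mu, forall t, h t = 0%E}.
Proof.
move=> mh h0 ih.
have : (\int[mu]_t `|h t| = 0)%E by under eq_integral do rewrite gee0_abs//.
by move/(ae_eq_integral_abs mu measurableT mh); apply: filterS => t /= /(_ I).
Qed.

Lemma ae_integral0 (h : T -> \bar R) : measurable_fun setT h ->
  {ae mu, forall t, h t = 0%E} -> (\int[mu]_t h t = 0)%E.
Proof.
move=> mh h0; rewrite (ae_eq_integral (cst 0%E))//; first by rewrite integral0.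
by apply: filterS h0 => t /= ->.
Qed.

Lemma ge0_integral_lty_ae (h : T -> \bar R) : measurable_fun setT h ->
  (forall t, 0 <= h t)%E -> (\int[mu]_t h t < +oo)%E ->
  {ae mu, forall t, (h t < +oo)%E}.
Proof.
move=> mh h0 ih.
have /(integrable_ae measurableT) : mu.-integrable setT h.
  by apply/integrableP; split=> //; under eq_integral do rewrite gee0_abs//.
by apply: filterS => t /(_ I) /fin_numPlt /andP[].
Qed.

Lemma ae_notP (N : set T) : measurable N ->
  {ae mu, forall t, ~ N t} <-> mu N = 0%E.
Proof.
move=> mN; split => [H|/(negligibleP mu mN) H].
  apply/(negligibleP mu mN).
  by apply: negligibleS H => t /= Nt; exact.
by apply: negligibleS H => t /= /contrapT.
Qed.

End ae_lemmas.

(** * Integrals depending on a parameter: Tonelli and Fubini *)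

Section parametric.
Context {d1 d2 : measure_display} {T1 : measurableType d1}
  {T2 : measurableType d2} {R : realType}.
Variables (m1 : {sigma_finite_measure set T1 -> \bar R})
  (m2 : {sigma_finite_measure set T2 -> \bar R}).

(** Tonelli applies to the positive and negative parts; where their difference is not finite, [fine]
    returns 0, which is still measurable. *)
Lemma measurable_Rintegral_snd (h : T1 * T2 -> R) : measurable_fun setT h ->
  measurable_fun setT (fun x => Rintegral m2 setT (fun y => h (x, y))).
Proof.
move=> mh; rewrite /Rintegral.
apply: (measurableT_comp (f := fine)); first exact: fine_measurable.
under eq_fun do rewrite integralE.
apply: emeasurable_funB.
- rewrite [X in measurable_fun _ X](_ : _ = fubini_F m2 (EFin \o h)^\+%E).
    apply: measurable_fun_fubini_tonelli_F => //.
    exact/measurable_funepos/measurable_EFinP.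
  apply/funext => x; apply: eq_integral => y _.
  by rewrite !funeposE.
- rewrite [X in measurable_fun _ X](_ : _ = fubini_F m2 (EFin \o h)^\-%E).
    apply: measurable_fun_fubini_tonelli_F => //.
    exact/measurable_funeneg/measurable_EFinP.
  apply/funext => x; apply: eq_integral => y _.
  by rewrite !funenegE.
Qed.

Lemma cmeas_cI (h : T1 * T2 -> R[i]) : cmeas h ->
  cmeas (fun x => cI m2 (fun y => h (x, y))).
Proof. by move=> [a b]; split; [exact: (measurable_Rintegral_snd a)|exact: (measurable_Rintegral_snd b)]. Qed.

(** Tonelli for the indicator of [N]: null slices in one direction force almost all slices in the
    other direction to be null. *)
Lemma ae_swap (N : set (T1 * T2)) : measurable N ->
  {ae m2, forall y, {ae m1, forall x, ~ N (x, y)}} ->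
  {ae m1, forall x, {ae m2, forall y, ~ N (x, y)}}.
Proof.
move=> mN H.
pose h z : \bar R := (\1_N z)%:E.
have mh : measurable_fun setT h by exact/measurable_EFinP/measurable_indic.
have h0 z : (0 <= h z)%E by rewrite lee_fin.
have E : (\int[m1]_x \int[m2]_y h (x, y) = 0)%E.
  rewrite (fubini_tonelli h mh h0); apply: ae_integral0.
    exact: (measurable_fun_fubini_tonelli_G h).
  apply: filterS H => y Hy; apply: ae_integral0.
    exact: (measurableT_comp mh (measurable_pair2 _)).
  by apply: filterS Hy => x Nx; rewrite /h indicE memNset.
have := ge0_integral0_ae (measurable_fun_fubini_tonelli_F h mh h0) _ E.
move=> /(_ (fun x => integral_ge0 _ (fun y _ => h0 (x, y)))).
apply: filterS => x /(ge0_integral0_ae (mu := m2)) Hx.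
have := Hx (measurableT_comp mh (measurable_pair1 _)) (fun y => h0 (x, y)).
apply: filterS => y; rewrite /h indicE; case: (boolP (_ \in _)).
  by move=> _ [] /eqP; rewrite oner_eq0.
by rewrite notin_setE.
Qed.

Lemma cI_Fubini (h : T1 * T2 -> R[i]) : cmeas h ->
  (\int[m1]_x \int[m2]_y (n1 (h (x, y)))%:E < +oo)%E ->
  cintegrable m1 (fun x => cI m2 (fun y => h (x, y))) /\
  cI m1 (fun x => cI m2 (fun y => h (x, y))) =
  cI m2 (fun y => cI m1 (fun x => h (x, y))).
Proof.
move=> mh fin.
have : cintegrable (m1 \x m2)%E h.
  apply: cintegrableP => //.
  rewrite (fubini_tonelli1 (fun z => (n1 (h z))%:E))//.
  - exact/measurable_EFinP/measurable_n1.
  - by move=> z; rewrite lee_fin n1_ge0.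
have H (k : T1 * T2 -> R) : (m1 \x m2)%E.-integrable setT (EFin \o k) ->
    m1.-integrable setT (EFin \o (fun x => Rintegral m2 setT (fun y => k (x, y)))) /\
    Rintegral m1 setT (fun x => Rintegral m2 setT (fun y => k (x, y))) =
    Rintegral m2 setT (fun y => Rintegral m1 setT (fun x => k (x, y))).
  move=> ik.
  have mk : measurable_fun setT k by move/measurable_int : ik => /measurable_EFinP.
  (* Only almost every slice is integrable; on the others [Rintegral] may be a default value. *)
  have E1 : {ae m1, forall x, (Rintegral m2 setT (fun y => k (x, y)))%:E =
      (\int[m2]_y (k (x, y))%:E)%E}.
    apply: filterS (ae_integrable1 ik) => x ikx.
    by rewrite fineK//; apply: integrable_fin_num.
  have E2 : {ae m2, forall y, (Rintegral m1 setT (fun x => k (x, y)))%:E =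
      (\int[m1]_x (k (x, y))%:E)%E}.
    apply: filterS (ae_integrable2 ik) => x ikx.
    by rewrite fineK//; apply: integrable_fin_num.
  have mF := measurable_fubini_F ik; have mG := measurable_fubini_G ik.
  have mRF := measurable_Rintegral_snd mk.
  have iF := integrable_fubini_F ik.
  have mRG : measurable_fun setT (fun y => Rintegral m1 setT (fun x => k (x, y))).
    by apply: (measurableT_comp (f := fine)); [exact: fine_measurable|exact: mG].
  split.
    apply/integrableP; split; first exact/measurable_EFinP.
    move/integrableP : iF => [_]; rewrite (ae_eq_integral
      (fun x => `|(Rintegral m2 setT (fun y => k (x, y)))%:E|)%E)//.
    - exact: measurableT_comp.
    - by apply: measurableT_comp => //; exact/measurable_EFinP.
    - by apply: filterS E1 => x E _; rewrite /fubini_F -E.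
  rewrite /Rintegral; congr fine.
  transitivity (\int[m1]_x \int[m2]_y (k (x, y))%:E)%E.
    apply: ae_eq_integral => //; first exact/measurable_EFinP.
    by apply: filterS E1 => x E _.
  rewrite (Fubini ik); apply: ae_eq_integral => //; first exact/measurable_EFinP.
  by apply: filterS E2 => x E _; exact: esym.
move=> [/H[a b] /H[c e]]; split; first by split.
by rewrite /cI b e.
Qed.

End parametric.

(** * Measure-preserving maps and periodization *)

Definition preserves {d : measure_display} {T : measurableType d} {R : realType}
  (mu : {measure set T -> \bar R}) (phi : T -> T) : Prop :=
  measurable_fun setT phi /\
  forall A, measurable A -> mu (phi @^-1` A) = mu A.

Section measure_preserving.
Context {d : measure_display} {T : measurableType d} {R : realType}.
Variables (mu : {measure set T -> \bar R}) (phi : T -> T).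
Hypothesis pphi : preserves mu phi.

Lemma ge0_integral_preserves (h : T -> \bar R) : measurable_fun setT h ->
  (forall t, 0 <= h t)%E -> (\int[mu]_t h (phi t) = \int[mu]_t h t)%E.
Proof.
move=> mh h0; have [mphi Ephi] := pphi.
have := @ge0_integral_pushforward _ _ _ _ R phi mphi mu setT h measurableT mh
  (fun t _ => h0 t).
rewrite preimage_setT => <-.
by apply: eq_measure_integral => A mA _; exact: Ephi.
Qed.

Lemma integral_preserves (h : T -> \bar R) : measurable_fun setT h ->
  (\int[mu]_t h (phi t) = \int[mu]_t h t)%E.
Proof.
move=> mh; rewrite integralE [RHS]integralE; congr (_ - _)%E.
- rewrite -(ge0_integral_preserves (h := h^\+%E))//; last exact: measurable_funepos.
  by apply: eq_integral => t _; rewrite !funeposE.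
- rewrite -(ge0_integral_preserves (h := h^\-%E))//; last exact: measurable_funeneg.
  by apply: eq_integral => t _; rewrite !funenegE.
Qed.

Lemma cI_preserves (h : T -> R[i]) : cmeas h ->
  cI mu (fun t => h (phi t)) = cI mu h.
Proof.
move=> [a b]; rewrite /cI /Rintegral.
rewrite (integral_preserves (h := fun t => (complex.Re (h t))%:E)); last first.
  exact/measurable_EFinP.
rewrite (integral_preserves (h := fun t => (complex.Im (h t))%:E))//.
exact/measurable_EFinP.
Qed.

Lemma cintegrable_preserves (h : T -> R[i]) : cintegrable mu h ->
  cintegrable mu (fun t => h (phi t)).
Proof.
move=> ih; have mh := cintegrable_cmeas ih; apply: cintegrableP.
  exact: (cmeas_comp mh pphi.1).
rewrite (ge0_integral_preserves (h := fun t => (n1 (h t))%:E)).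
- exact: cintegrable_lty.
- exact/measurable_EFinP/measurable_n1.
- by move=> t; rewrite lee_fin n1_ge0.
Qed.

Lemma sqint_preserves (h : T -> R[i]) : sqint mu h ->
  sqint mu (fun t => h (phi t)).
Proof.
move=> [mh ih]; split; first exact: (cmeas_comp mh pphi.1).
rewrite (ge0_integral_preserves (h := fun t => (sqn (h t))%:E))//.
- exact/measurable_EFinP/measurable_sqn.
- by move=> t; rewrite lee_fin sqn_ge0.
Qed.

Lemma ae_preserves (P : T -> Prop) : {ae mu, forall t, P t} ->
  {ae mu, forall t, P (phi t)}.
Proof.
move=> [N [mN N0 PN]]; have [mphi Ephi] := pphi.
exists (phi @^-1` N); split; last by move=> t /= nP; exact: PN.
  by rewrite -[X in measurable X]setTI; exact: mphi.
by rewrite Ephi.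
Qed.

End measure_preserving.

Section lebesgue_invariance.
Context {R : realType}.
Local Notation lebR := (@lebesgue_measure R).

Lemma measurable_shift (a : R) :
  measurable_fun setT (fun t : measurableTypeR R => t + a : measurableTypeR R).
Proof. exact: measurable_funD. Qed.

(** Lebesgue measure is determined by its values on half-open intervals, whose length is unchanged
    by translation. *)
Lemma preserves_shift (a : R) : preserves lebR (fun t => t + a).
Proof.
split; first exact: measurable_shift.
move=> A mA; apply/esym.
apply: (@lebesgue_measure_unique R (pushforward lebR
   (fun t : measurableTypeR R => t + a : measurableTypeR R))) mA => //=.
- exact: measurable_shift.
- move=> m _ [[x y]] _ <-.
  rewrite /pushforward.
  have -> : (fun t : R => t + a) @^-1` `]x, y]%classic = `]x - a, y - a]%classic.
    by apply/seteqP; split => t /=; rewrite !in_itv/= ltrBlDr lerBrDr.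
  rewrite !lebesgue_measure_itv/= !lte_fin ltrD2r -!EFinB.
  by have -> : y - a - (x - a) = y - x by ring.
Qed.

Lemma preserves_opp : preserves lebR (fun t => - t).
Proof.
split; first exact: (measurable_funN (f := id)).
by move=> A mA; have := @lebesgue_measureN R A mA.
Qed.

Lemma preserves_reflect (a : R) : preserves lebR (fun t => a - t).
Proof.
have [m1 E1] := preserves_shift a; have [m2 E2] := preserves_opp.
have E : (fun t : R => a - t) = (fun t => t + a) \o (fun t => - t).
  by apply/funext => t /=; rewrite addrC.
split; first by rewrite E; exact: (measurableT_comp m1 m2).
move=> A mA; rewrite E comp_preimage E2 ?E1//.
by rewrite -[X in measurable X]setTI; exact: m1.
Qed.

End lebesgue_invariance.

(** * The integers with their discrete sigma-algebra and counting measure *)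

HB.instance Definition _ := isPointed.Build int 0.
HB.instance Definition _ := @isMeasurable.Build default_measure_display
  int discrete_measurable discrete_measurable0
  discrete_measurableC discrete_measurableU.

Lemma measurable_fun_int {d : measure_display} {T : measurableType d}
  (D : set int) (f : int -> T) : measurable_fun D f.
Proof. by []. Qed.

Lemma counting_preserves (R : realType) (a : int) :
  preserves (@counting int R) (fun m => m + a).
Proof.
split => // A _.
have E : (fun m : int => m + a) @` ((fun m : int => m + a) @^-1` A) = A.
  apply/seteqP; split => [_ [x Ax <-]//|x Ax].
  by exists (x - a) => /=; rewrite subrK.
have EE : (A #= (fun m : int => m + a) @^-1` A)%card.
  by rewrite -{1}E; apply: inj_card_eq => x y _ _; exact: addIr.
have Ef := eq_finite_set EE.
rewrite /= /counting.
have [fA|fA] := pselect (finite_set A); last by rewrite !asboolF// -Ef.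
have fB : finite_set ((fun m : int => m + a) @^-1` A) by rewrite -Ef.
rewrite !asboolT//; congr (_%:R%:E); apply/card_eq_fsetP; rewrite fset_setK//.
rewrite -(card_eql EE) -{1}(fset_setK fA).
exact/card_eq_fsetP.
Qed.

Lemma sigma_finite_counting_int (R : realType) :
  sigma_finite [set: int] (@counting int R).
Proof.
pose F (k : nat) := (Posz @` `I_k.+1) `|` ((fun j : nat => - j%:Z) @` `I_k.+1).
exists F.
  apply/seteqP; split => // m _; exists `|m|%N => //.
  by case: (ger0P m) => m0; [left|right]; exists `|m|%N => //=; lia.
move=> k; split => //; rewrite /= /counting asboolT ?ltry//.
by rewrite finite_setU; split; exact: finite_image.
Qed.

(* The library makes [counting] sigma-finite only on [nat]; a fresh name is
   needed to attach the instance for [int]. *)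
Definition cntZ (R : realType) : set int -> \bar R := @counting int R.

HB.instance Definition _ (R : realType) :=
  Measure.copy (cntZ R) (@counting int R).

HB.instance Definition _ (R : realType) :=
  @Measure_isSigmaFinite.Build _ _ _ (cntZ R) (sigma_finite_counting_int R).

Lemma cntZ_preserves (R : realType) (a : int) :
  preserves (cntZ R) (fun m => m + a).
Proof. exact: counting_preserves. Qed.

Lemma cntZ_set1 (R : realType) (m : int) : cntZ R [set m] = 1%E.
Proof. by rewrite /cntZ /counting asboolT// fset_set1 finmap.cardfs1. Qed.

Lemma cntZ_lty_finite (R : realType) (A : set int) :
  (cntZ R A < +oo)%E -> finite_set A.
Proof.
rewrite /cntZ /counting; have [//|nA] := pselect (finite_set A).
by rewrite asboolF.
Qed.

Section ae_int.
Context {d : measure_display} {T : measurableType d} {R : realType}.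
Variable mu : {measure set T -> \bar R}.

Lemma ae_forall_int (P : int -> T -> Prop) :
  (forall m, {ae mu, forall t, P m t}) -> {ae mu, forall t, forall m, P m t}.
Proof.
move=> H.
have H1 : {ae mu, forall t, forall n : nat, P (Posz n) t}.
  by apply: ae_foralln => n; exact: H.
have H2 : {ae mu, forall t, forall n : nat, P (Negz n) t}.
  by apply: ae_foralln => n; exact: H.
by apply: filterS2 H1 H2 => t h1 h2 [] n.
Qed.

End ae_int.

(** * Unfolding integrals over the line into sums over classes modulo 1 *)

Section periodization.
Context {R : realType}.
Local Notation lebR := (@lebesgue_measure R).
Local Notation cnt := (cntZ R).

(** Half-open, so that its integer translates partition the line. *)
Definition unit_itv : set R := `[0, 1[%classic.

Lemma measurable_unit_itv : measurable unit_itv.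
Proof. exact: measurable_itv. Qed.

Lemma unit_itv_floor (t : R) (m : int) :
  unit_itv (t - m%:~R) <-> m = Num.floor t.
Proof.
rewrite /unit_itv /= in_itv /= subr_ge0 ltrBlDl.
have -> : (m%:~R + 1 : R) = (m + 1)%:~R by rewrite intrD.
by rewrite -floor_eq; split => [/eqP ->|->].
Qed.

Lemma measurable_fun_int2 {d : measure_display} {T : measurableType d}
  (h : R -> T) : measurable_fun setT h ->
  measurable_fun setT (fun z : R * int => h (z.1 + z.2%:~R)).
Proof.
move=> mh; apply: (measurableT_comp mh); apply: measurable_funD.
  exact: measurable_fst.
by apply: (measurableT_comp (f := fun m : int => m%:~R : R));
  [exact: measurable_fun_int|exact: measurable_snd].
Qed.

Lemma integral_unit_itv_shift (t : R) :
  (\int[cnt]_m (\1_unit_itv (t - m%:~R)%R)%:E = 1)%E.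
Proof.
transitivity (\int[cnt]_m (\1_[set Num.floor t] m : R)%:E)%E.
  apply: eq_integral => m _; congr (_%:E); rewrite !indicE; congr ((nat_of_bool _)%:R).
  by apply/idP/idP; rewrite !inE => /unit_itv_floor.
by rewrite integral_indic// setIT; exact: cntZ_set1.
Qed.

(** Insert the partition of unity by integer translates of [0, 1[, exchange sum and integral,
    translate each term by its integer, and exchange back. *)
Lemma ge0_integral_periodize (h : R -> \bar R) : measurable_fun setT h ->
  (forall t, 0 <= h t)%E ->
  (\int[lebR]_t h t =
   \int[lebR]_(t in unit_itv) \int[cnt]_m h (t + m%:~R)%R)%E.
Proof.
move=> mh h0.
have mi : measurable_fun setT (fun t : R => (\1_unit_itv t : R)).
  by apply: measurable_indic; exact: measurable_unit_itv.
have i0 (t : R) : (0 <= (\1_unit_itv t : R)%:E)%E by rewrite lee_fin.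
transitivity (\int[lebR]_t \int[cnt]_m (h t * (\1_unit_itv (t - m%:~R)%R)%:E))%E.
  apply: eq_integral => t _; rewrite ge0_integralZl//.
  by rewrite integral_unit_itv_shift mule1.
have mh1 : measurable_fun setT (fun z : R * int => h z.1).
  exact: (measurableT_comp mh measurable_fst).
have mi1 : measurable_fun setT
    (fun z : R * int => (\1_unit_itv (z.1 - z.2%:~R) : R)%:E).
  apply/measurable_EFinP; apply: (measurableT_comp mi); apply: measurable_funB.
    exact: measurable_fst.
  by apply: (measurableT_comp (f := fun m : int => m%:~R : R));
    [exact: measurable_fun_int|exact: measurable_snd].
rewrite [LHS](fubini_tonelli (m1 := lebR) (m2 := cnt) (fun z : R * int => h z.1 * (\1_unit_itv (z.1 - z.2%:~R)%R)%:E)%E).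
- have E m : (\int[lebR]_t (h t * (\1_unit_itv (t - m%:~R)%R)%:E) =
      \int[lebR]_t (h (t + m%:~R)%R * (\1_unit_itv t)%:E))%E.
    rewrite -(ge0_integral_preserves (preserves_shift m%:~R)
      (h := fun t => (h t * (\1_unit_itv (t - m%:~R)%R)%:E)%E)).
    - by apply: eq_integral => t _; rewrite addrK.
    - apply: emeasurable_funM => //; apply/measurable_EFinP.
      by apply: (measurableT_comp mi); exact: measurable_funB.
    - by move=> t; exact: mule_ge0.
  under eq_integral do rewrite E.
  rewrite -[LHS](fubini_tonelli (m1 := lebR) (m2 := cnt) (fun z : R * int =>
    h (z.1 + z.2%:~R)%R * (\1_unit_itv z.1)%:E)%E).
  + rewrite [RHS]integral_mkcond; apply: eq_integral => t _ /=.
    rewrite patchE indicE; case: ifPn => tI.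
      by apply: eq_integral => m _; rewrite mule1.
    by under eq_integral do rewrite mule0; rewrite integral0.
  + apply: emeasurable_funM; first exact: measurable_fun_int2.
    by apply/measurable_EFinP; exact: (measurableT_comp mi measurable_fst).
  + by move=> z; exact: mule_ge0.
- exact: emeasurable_funM.
- by move=> z; exact: mule_ge0.
Qed.

Lemma ae_periodic (P : R -> Prop) :
  (forall t (m : int), P (t + m%:~R) -> P t) ->
  {ae lebR, forall t, unit_itv t -> P t} -> {ae lebR, forall t, P t}.
Proof.
move=> PP H.
have H2 : {ae lebR, forall t, forall m : int, unit_itv (t + m%:~R) -> P (t + m%:~R)}.
  by apply: ae_forall_int => m; exact: (ae_preserves (preserves_shift m%:~R) H).
apply: (ae_mono H2) => t /(_ (- Num.floor t)) K; apply: (PP t (- Num.floor t)).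
by apply: K; rewrite intrN; exact/unit_itv_floor.
Qed.

(** The orbit sum has finite integral over [0, 1[, so it is finite almost everywhere there, and it
    is periodic. *)
Lemma ae_periodize_lty (h : R -> \bar R) : measurable_fun setT h ->
  (forall t, 0 <= h t)%E -> (\int[lebR]_t h t < +oo)%E ->
  {ae lebR, forall t, (\int[cnt]_m h (t + m%:~R)%R < +oo)%E}.
Proof.
move=> mh h0; rewrite ge0_integral_periodize// => fin.
apply: ae_periodic => [t m|].
  rewrite -[X in _ -> (X < _)%E](ge0_integral_preserves (cntZ_preserves R m)
    (h := fun j : int => h (t + j%:~R)%R) (measurable_fun_int _) (fun=> h0 _)).
  by congr (_ < _)%E; apply: eq_integral => j _; rewrite intrD (addrC j%:~R) addrA.
have mI : measurable_fun setT (fun t : R => \int[cnt]_m h (t + m%:~R)%R)%E.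
  apply: (measurable_fun_fubini_tonelli_F (fun z : R * int => h (z.1 + z.2%:~R)%R)) => //.
  exact: measurable_fun_int2.
move: fin; rewrite integral_mkcond => fin.
suff mI' : measurable_fun setT ((fun t : R => \int[cnt]_m h (t + m%:~R)%R) \_ unit_itv)%E.
  have J0 t : (0 <= ((fun t : R => \int[cnt]_m h (t + m%:~R)%R) \_ unit_itv) t)%E.
    by rewrite patchE; case: ifP => // _; exact: integral_ge0.
  apply: (ae_mono (ge0_integral_lty_ae (mu := lebR) mI' J0 fin)) => t; rewrite patchE => + tI.
  by rewrite mem_set.
by apply: (measurable_restrictT _ measurable_unit_itv).1; exact: measurable_funTS.
Qed.

(** For an indicator, the orbit sum counts the visits of the class of [t] to [E]. *)
Lemma ae_finite_orbit (E : set R) : measurable E -> (lebR E < +oo)%E ->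
  {ae lebR, forall t, finite_set [set m : int | E (t + m%:~R)]}.
Proof.
move=> mE fE.
have mE1 : measurable_fun setT (fun t : R => (\1_E t : R)%:E).
  exact/measurable_EFinP/measurable_indic.
have := ae_periodize_lty mE1; rewrite integral_indic// setIT.
move=> H; apply: (ae_mono (H _ fE)) => [t|t]; first by rewrite lee_fin.
have -> : (\int[cnt]_m (\1_E (t + m%:~R)%R)%:E =
    \int[cnt]_m (\1_[set m : int | E (t + m%:~R)] m)%:E)%E.
  by apply: eq_integral.
by rewrite integral_indic// setIT => /cntZ_lty_finite.
Qed.

(** Points of [W] make at least one visit to [B], while the number of visits, integrated over [0,
    1[, gives the measure of [B]. This bounds what is excluded when sample points are chosen. *)
Lemma measure_orbit_le (B : set R) : measurable B ->
  let W := [set t | unit_itv t /\ exists m : int, B (t + m%:~R)] in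
  measurable W /\ (lebR W <= lebR B)%E.
Proof.
move=> mB W.
have mBm (m : int) : measurable [set t | B (t + m%:~R)].
  have := measurable_shift (m%:~R : R) measurableT mB.
  by rewrite setTI.
have WE : W = unit_itv `&` ((\bigcup_n [set t | B (t + (Posz n)%:~R)]) `|`
                           (\bigcup_n [set t | B (t + (Negz n)%:~R)])).
  apply/seteqP; split => t.
    by move=> [tI [[] n Bt]]; split => //; [left|right]; exists n.
  by move=> [tI [[n _ Bt]|[n _ Bt]]]; split => //; [exists (Posz n)|exists (Negz n)].
have mW : measurable W.
  rewrite WE; apply: measurableI; first exact: measurable_unit_itv.
  by apply: measurableU; apply: bigcup_measurable => n _; exact: mBm.
split => //.
have -> : lebR B = (\int[lebR]_t (\1_B t)%:E)%E by rewrite integral_indic// setIT.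
rewrite ge0_integral_periodize//; last first.
  exact/measurable_EFinP/measurable_indic.
rewrite [leRHS]integral_mkcond.
have -> : lebR W = (\int[lebR]_t (\1_W t)%:E)%E by rewrite integral_indic// setIT.
apply: ge0_le_integral => //.
- exact/measurable_EFinP/measurable_indic.
- apply: (measurable_restrictT _ measurable_unit_itv).1.
  apply: measurable_funTS.
  apply: (measurable_fun_fubini_tonelli_F
    (fun z : R * int => (\1_B (z.1 + z.2%:~R)%R)%:E)) => //.
  apply: (measurable_fun_int2 (h := fun t => (\1_B t)%:E)).
  exact/measurable_EFinP/measurable_indic.
- move=> t _; rewrite indicE patchE.
  case: (boolP (t \in W)) => [/set_mem [tI [m Bm]]|_] /=; last first.
    by case: ifP => // _; exact: integral_ge0.
  rewrite mem_set//.
  have -> : (\int[cnt]_m (\1_B (t + m%:~R)%R)%:E =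
      \int[cnt]_m (\1_[set m : int | B (t + m%:~R)] m)%:E)%E.
    by apply: eq_integral.
  rewrite integral_indic// setIT.
  apply: (@le_trans _ _ (cnt [set m])).
    by rewrite (cntZ_set1 R m).
  by apply: le_measure; rewrite ?inE// => x /= ->.
Qed.

End periodization.

Section complex_periodization.
Context {R : realType}.
Local Notation lebR := (@lebesgue_measure R).
Local Notation cnt := (cntZ R).

(** A factor [ind t] takes the place of integration over [0, 1[, since [cI] integrates over the
    whole space. *)
Definition ind (t : R) : R[i] := (\1_(@unit_itv R) t : R)%:C%C.

Lemma ind_cases t : (ind t = 1 /\ unit_itv t) \/ (ind t = 0 /\ ~ unit_itv t).
Proof.
rewrite /ind indicE; case: (boolP (t \in unit_itv)) => [/set_mem|].
  by left.
by rewrite notin_setE; right.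
Qed.

Lemma cmeas_ind : cmeas ind.
Proof.
split => /=; last exact: measurable_cst.
by apply: measurable_indic; exact: measurable_unit_itv.
Qed.

Lemma n1_ind t : n1 (ind t) = \1_(@unit_itv R) t.
Proof. by rewrite /n1 /ind /= normr0 addr0 ger0_norm. Qed.

Lemma cmeas_int (h : int -> R[i]) : cmeas h.
Proof. by []. Qed.

Lemma cmeas_int2 (F : R -> R[i]) : cmeas F ->
  cmeas (fun z : R * int => F (z.1 + z.2%:~R)).
Proof. by move=> [a b]; split; [exact: (measurable_fun_int2 a)|exact: (measurable_fun_int2 b)]. Qed.

Lemma ae_periodize_cintegrable (F : R -> R[i]) : cintegrable lebR F ->
  {ae lebR, forall t, cintegrable cnt (fun m => F (t + m%:~R))}.
Proof.
move=> iF; have mF := cintegrable_cmeas iF.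
have := ae_periodize_lty (h := fun t => (n1 (F t))%:E).
move=> /(_ _ _ (cintegrable_lty iF)) H.
apply: (ae_mono (H _ _)) => //.
- exact/measurable_EFinP/measurable_n1.
- by move=> t; rewrite lee_fin n1_ge0.
- by move=> t ft; exact: cintegrableP.
Qed.

Lemma ae_periodize_sqint (f : R -> R[i]) : sqint lebR f ->
  {ae lebR, forall t, sqint cnt (fun m => f (t + m%:~R))}.
Proof.
move=> [mf iF].
have H := ae_periodize_lty (h := fun t => (sqn (f t))%:E).
apply: (ae_mono (H _ _ iF)) => //.
- exact/measurable_EFinP/measurable_sqn.
- by move=> t; rewrite lee_fin sqn_ge0.
Qed.

Lemma n1M_ind (z : R[i]) t : n1 (z * ind t) = n1 z * \1_(@unit_itv R) t.
Proof.
case: (ind_cases t) => -[E tI]; rewrite E indicE.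
  by rewrite mulr1 mem_set// mulr1.
by rewrite mulr0 memNset// mulr0 /n1 /= normr0 addr0.
Qed.

(** The same unfolding as for nonnegative functions. [H1] and [H2] differ by the translation by [m],
    and both exchanges are instances of Fubini. *)
Lemma cI_periodize (F : R -> R[i]) : cintegrable lebR F ->
  cintegrable lebR (fun t => ind t * cI cnt (fun m => F (t + m%:~R))) /\
  cI lebR F = cI lebR (fun t => ind t * cI cnt (fun m => F (t + m%:~R))).
Proof.
move=> iF; have mF := cintegrable_cmeas iF.
have mi1 : cmeas (fun z : R * int => ind (z.1 - z.2%:~R)).
  have m1 : measurable_fun setT (fun z : R * int => z.1 - z.2%:~R).
    apply: measurable_funB; first exact: measurable_fst.
    by apply: (measurableT_comp (f := fun m : int => m%:~R : R));
      [exact: measurable_fun_int|exact: measurable_snd].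
  exact: (cmeas_comp cmeas_ind m1).
have ii t : cintegrable cnt (fun m => ind (t - m%:~R)).
  apply: cintegrableP => //; under eq_integral do rewrite n1_ind.
  by rewrite integral_unit_itv_shift ltry.
have ci t : cI cnt (fun m => ind (t - m%:~R)) = 1.
  by rewrite /cI /Rintegral integral_unit_itv_shift integral0.
pose H1 (z : R * int) := F z.1 * ind (z.1 - z.2%:~R).
pose H2 (z : R * int) := F (z.1 + z.2%:~R) * ind z.1.
have mH1 : cmeas H1 by apply: cmeasM => //; exact: (cmeas_comp mF measurable_fst).
have mH2 : cmeas H2.
  by apply: cmeasM; [exact: cmeas_int2|exact: (cmeas_comp cmeas_ind measurable_fst)].
have fin1 : (\int[lebR]_t \int[cnt]_m (n1 (H1 (t, m)))%:E < +oo)%E.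
  have E t : (\int[cnt]_m (n1 (H1 (t, m)))%:E = (n1 (F t))%:E)%E.
    under eq_integral do rewrite n1M_ind EFinM /=.
    rewrite ge0_integralZl// ?integral_unit_itv_shift ?mule1//.
    by rewrite lee_fin n1_ge0.
  by under eq_integral do rewrite E; exact: cintegrable_lty.
have fin2 : (\int[lebR]_t \int[cnt]_m (n1 (H2 (t, m)))%:E < +oo)%E.
  have mn : measurable_fun setT (fun t => (n1 (F t))%:E).
    exact/measurable_EFinP/measurable_n1.
  have n0 t : (0 <= (n1 (F t))%:E)%E by rewrite lee_fin n1_ge0.
  have := cintegrable_lty iF; rewrite (ge0_integral_periodize mn n0).
  rewrite integral_mkcond; congr (_ < _)%E; apply: eq_integral => t _.
  rewrite patchE; have [tI|tI] := pselect (unit_itv t).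
    rewrite mem_set//; apply: eq_integral => m _.
    by rewrite /H2 n1M_ind indicE mem_set//= mulr1.
  rewrite memNset//; apply/esym; rewrite -[RHS](integral0 cnt setT).
  by apply: eq_integral => m _; rewrite /H2 n1M_ind indicE memNset//= mulr0.
have [_ E1] := cI_Fubini (m1 := lebR) (m2 := cnt) mH1 fin1.
have [I2 E2] := cI_Fubini (m1 := lebR) (m2 := cnt) mH2 fin2.
have E3 : (fun t => cI cnt (fun m => H2 (t, m))) =
    (fun t => ind t * cI cnt (fun m => F (t + m%:~R))).
  apply/funext => t; rewrite /H2 /=; case: (ind_cases t) => -[-> _].
    by rewrite mul1r; apply: cI_eq => m; rewrite mulr1.
  by rewrite mul0r -[RHS](cI0 cnt); apply: cI_eq => m; rewrite mulr0.
rewrite E3 in I2 E2; split => //; rewrite E2.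
transitivity (cI lebR (fun t => cI cnt (fun m => H1 (t, m)))).
  by apply: cI_eq => t; rewrite /H1 /= cIZ// ci mulr1.
rewrite E1; apply: cI_eq => m.
rewrite -(cI_preserves (preserves_shift (m%:~R : R)) (h := fun t => H1 (t, m))).
  by apply: cI_eq => t; rewrite /H1 /H2 /= addrK.
exact: (cmeas_comp mH1 (measurable_pair2 m)).
Qed.

End complex_periodization.

(** * Shift-invariant subspaces *)

Lemma sqn_le0 (R : realType) (z : R[i]) : sqn z <= 0 -> z = 0.
Proof.
move=> z0; have : sqn z = 0 by apply/eqP; rewrite eq_le z0 sqn_ge0.
case: z {z0} => x y; rewrite /sqn /= => /eqP.
by rewrite paddr_eq0 ?sqr_ge0// !sqrf_eq0 => /andP[/eqP-> /eqP->].
Qed.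

Section hilbert.
Variables (R : realType) (E : lmodType R[i]) (L : E -> Prop).
Variable dot : E -> E -> R[i].

(** The squared norm; no root is taken until the vectors of [wandering_dimension] are normalized. *)
Definition nrm u : R := complex.Re (dot u u).

Definition norm_cvg (u : nat -> E) (l : E) : Prop :=
  forall eps : R, 0 < eps ->
  exists N : nat, forall p, (N <= p)%N -> nrm (u p - l) < eps.

(** The Hilbert space is the subset [L] of a larger module [E]. In the application [E] consists of
    all families of sequences and [L] of the square summable ones. *)
Hypothesis LP : forall a u v, L u -> L v -> L (a *: u + v).
Hypothesis L0 : L 0.
Hypothesis dotP : forall a u v w, L u -> L v -> L w ->
  dot (a *: u + v) w = a * dot u w + dot v w.
Hypothesis dotC : forall u v, L u -> L v -> dot v u = (dot u v)^*.
Hypothesis dot_ge0 : forall u, L u -> 0 <= nrm u.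
Hypothesis complete : forall u : nat -> E, (forall i, L (u i)) ->
  (forall eps : R, 0 < eps -> exists N : nat, forall p q,
     (N <= p)%N -> (N <= q)%N -> nrm (u p - u q) < eps) ->
  exists2 l, L l & norm_cvg u l.

Let LZ a u : L u -> L (a *: u).
Proof. by move=> Lu; rewrite -[_ *: _]addr0; exact: LP. Qed.

Let LD u v : L u -> L v -> L (u + v).
Proof. by move=> Lu Lv; rewrite -[u]scale1r; exact: LP. Qed.

Let LB u v : L u -> L v -> L (u - v).
Proof. by move=> Lu Lv; rewrite addrC -scaleN1r; exact: LP. Qed.

Let dotD u v w : L u -> L v -> L w -> dot (u + v) w = dot u w + dot v w.
Proof. by move=> Lu Lv Lw; rewrite -[u in LHS]scale1r dotP// mul1r. Qed.

Let dot0 w : L w -> dot 0 w = 0.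
Proof.
move=> Lw; have := dotD L0 L0 Lw; rewrite addr0 => /eqP.
by rewrite -subr_eq0 opprD addrA subrr sub0r oppr_eq0 => /eqP.
Qed.

Let dotZ a u w : L u -> L w -> dot (a *: u) w = a * dot u w.
Proof. by move=> Lu Lw; rewrite -[_ *: _]addr0 dotP// dot0// addr0. Qed.

Let dotB u v w : L u -> L v -> L w -> dot (u - v) w = dot u w - dot v w.
Proof.
by move=> Lu Lv Lw; rewrite addrC -scaleN1r dotP// mulN1r addrC.
Qed.

Let dotDr u v w : L u -> L v -> L w -> dot w (u + v) = dot w u + dot w v.
Proof.
move=> Lu Lv Lw; rewrite dotC; [|exact: LD|by []].
by rewrite dotD// rmorphD /= -!dotC.
Qed.

Let dotZr a u w : L u -> L w -> dot w (a *: u) = a^* * dot w u.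
Proof.
move=> Lu Lw; rewrite dotC; [|exact: LZ|by []].
by rewrite dotZ// rmorphM /= -dotC.
Qed.

Let dotr0 w : L w -> dot w 0 = 0.
Proof. by move=> Lw; rewrite dotC// dot0// rmorph0. Qed.

Let dotuu u : L u -> dot u u = (nrm u)%:C%C.
Proof.
move=> Lu; rewrite /nrm; have := dotC Lu Lu; case: (dot u u) => a b /=.
move=> /eqP; rewrite eq_complex /= => /andP[_ /eqP H].
by congr Complex; lra.
Qed.

Let nrm_addZ u a v : L u -> L v ->
  nrm (u + a *: v) = nrm u + 2 * complex.Re (a * dot v u) + sqn a * nrm v.
Proof.
move=> Lu Lv; rewrite /nrm dotD//; [|exact: LZ|by apply: LD => //; exact: LZ].
rewrite !dotDr//; try exact: LZ.
rewrite dotZ// ?dotZr// ?dotZ//; try exact: LZ.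
rewrite (dotuu Lv) (dotuu Lu) [dot u v]dotC//.
case: (dot v u) => x y; case: (a) => p q.
rewrite !(ReD, ReM, ReJ, ImM, ImJ) /sqn /nrm /=.
ring.
Qed.

Lemma cauchy_schwarz u v : L u -> L v -> sqn (dot u v) <= nrm u * nrm v.
Proof.
move=> Lu Lv; have v0 := dot_ge0 Lv.
pose z := dot u v.
have H (s : R) : 0 <= nrm u - 2 * s * sqn z + s ^+ 2 * sqn z * nrm v.
  have := dot_ge0 (LD Lu (LZ (- (s%:C%C) * z) Lv)).
  rewrite nrm_addZ// [dot v u]dotC//.
  rewrite -/z !sqnM !ReM !ImM ReJ ImJ /sqn /=.
  by move: (nrm u) (nrm v) => x y; case: (z) => p q /=; lra.
have [v1|] := eqVneq (nrm v) 0.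
  rewrite v1 mulr0; case: (leP (sqn z) 0) => // z0.
  (* With [nrm v = 0] the quadratic in [s] is affine, and here it takes the value -1. *)
  have := H ((nrm u + 1) / (2 * sqn z)).
  rewrite v1 mulr0 addr0.
  have -> : 2 * ((nrm u + 1) / (2 * sqn z)) * sqn z = nrm u + 1.
    by field; rewrite gt_eqF.
  by lra.
move=> v1; have vp : 0 < nrm v by rewrite lt_neqAle eq_sym v1.
(* The minimizer of the quadratic in [s]. *)
have := H ((nrm v)^-1).
have -> : nrm u - 2 * (nrm v)^-1 * sqn z + (nrm v)^-1 ^+ 2 * sqn z * nrm v =
   nrm u - sqn z / nrm v by field.
by rewrite subr_ge0 ler_pdivrMr.
Qed.

Let parallelogram u v : L u -> L v -> nrm (u + v) + nrm (u - v) = 2 * nrm u + 2 * nrm v.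
Proof.
move=> Lu Lv; have := nrm_addZ 1 Lu Lv; have := nrm_addZ (- 1) Lu Lv.
rewrite scale1r scaleN1r => -> ->.
rewrite mul1r mulN1r ReN /sqn /=; ring.
Qed.

Let nrmZ a u : L u -> nrm (a *: u) = sqn a * nrm u.
Proof.
move=> Lu; have := nrm_addZ a L0 Lu; rewrite add0r => ->.
by rewrite dotr0// mulr0 /nrm dot0//= mulr0 addr0 add0r.
Qed.

(** A sequence in [K] minimizing the distance to [A] is Cauchy, because midpoints stay in [K] and
    the parallelogram law applies. Its terms are approximately orthogonal in the sense of [near],
    and Cauchy-Schwarz passes this to the limit. *)
Lemma projection_exists (K : E -> Prop) A :
  (forall u, K u -> L u) -> K 0 ->
  (forall a u v, K u -> K v -> K (a *: u + v)) ->
  (forall u l, (forall i, K (u i)) -> L l -> norm_cvg u l -> K l) ->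
  L A ->
  exists2 h, K h & forall v, K v -> dot (A - h) v = 0.
Proof.
move=> KL K0 KP Kcl LA.
pose D : set R := [set nrm (A - u) | u in [set u | K u]].
have D0 : D !=set0 by exists (nrm (A - 0)); exists 0.
have Dlb : has_lbound D.
  by exists 0 => _ [u Ku <-]; apply: dot_ge0; exact: LB (KL _ Ku).
pose dd := inf D.
have ddle u : K u -> dd <= nrm (A - u).
  by move=> Ku; apply: ge_inf => //; exists u.
have /choice[u Hu] : forall i : nat, exists u, K u /\ nrm (A - u) < dd + i.+1%:R^-1.
  move=> i; have := @inf_adherent _ D i.+1%:R^-1; rewrite invr_gt0 ltr0Sn.
  by move=> /(_ isT (conj D0 Dlb)) [_ [u Ku <-] ltd]; exists u.
have LAu i : L (A - u i) by apply: LB => //; exact: KL (Hu i).1.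
have KZ a x : K x -> K (a *: x) by move=> Kx; rewrite -[_ *: _]addr0; exact: KP.
have KD x y : K x -> K y -> K (x + y).
  by move=> Kx Ky; rewrite -[x]scale1r; exact: KP.
have small (eps : R) : 0 < eps ->
    exists N : nat, forall p, (N <= p)%N -> (p.+1%:R^-1 : R) < eps.
  move=> e0; exists (Num.truncn eps^-1) => p Np.
  rewrite invf_plt ?posrE ?ltr0Sn//.
  have := truncnS_gt eps^-1; move/lt_le_trans; apply.
  by rewrite ler_nat ltnS.
have cau (eps : R) : 0 < eps -> exists N : nat, forall p q,
    (N <= p)%N -> (N <= q)%N -> nrm (u p - u q) < eps.
  (* The parallelogram law bounds [nrm (u p - u q)] by twice the sum of the two excesses over the
     infimum. *)
  move=> e0; have [|N HN] := small (eps / 4); first by rewrite divr_gt0.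
  exists N => p q Np Nq.
  have pp := parallelogram (LAu p) (LAu q).
  have E1 : A - u p - (A - u q) = -1 *: (u p - u q).
    by rewrite scaleN1r opprB opprB addrC addrA subrK.
  have E2 : A - u p + (A - u q) = 2%:R *: (A - 2%:R^-1 *: (u p + u q)).
    rewrite scalerBr scalerA mulfV ?pnatr_eq0// scale1r scaler_nat.
    by rewrite opprD addrACA mulr2n.
  rewrite E1 E2 !nrmZ in pp; last 2 first.
  - by apply: LB; exact: KL (Hu _).1.
  - by apply: LB => //; apply/LZ/LD; exact: KL (Hu _).1.
  have := ddle _ (KZ 2%:R^-1 _ (KD _ _ (Hu p).1 (Hu q).1)).
  have := (Hu p).2; have := (Hu q).2; have := HN p Np; have := HN q Nq.
  move: pp; set X := nrm (u p - u q); set Y := nrm (A - _ *: _).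
  have -> : sqn (-1 : R[i]) = 1 by rewrite /sqn /= oppr0 sqrrN expr1n expr0n addr0.
  have -> : sqn (2%:R : R[i]) = 4.
    rewrite /sqn; have -> : (2%:R : R[i]) = Complex 2 0.
      by rewrite mulr2n; apply/eqP; rewrite eq_complex /= addr0 !eqxx.
    by rewrite /= expr0n addr0 expr2 -natrM.
  move: X Y (nrm (A - u p)) (nrm (A - u q)) (p.+1%:R^-1) (q.+1%:R^-1).
  by move=> X Y xp xq ip iq; lra.
have [h Lh uh] := complete (fun i => KL _ (Hu i).1) cau.
have Kh : K h by apply: Kcl uh => // i; exact: (Hu i).1.
exists h => // v Kv; have Lv := KL _ Kv.
have near i : sqn (dot (A - u i) v) <= i.+1%:R^-1 * nrm v.
  have [v0|v0] := eqVneq (nrm v) 0.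
    by rewrite v0 mulr0; have := cauchy_schwarz (LAu i) Lv; rewrite v0 mulr0.
  have vp : 0 < nrm v by rewrite lt_neqAle eq_sym v0 dot_ge0.
  set z := dot (A - u i) v.
  (* The best correction of [u i] along [v]: its gain [sqn z / nrm v] cannot exceed the excess of
     [u i] over the infimum. *)
  pose a := - ((nrm v)^-1)%:C%C * z.
  have := ddle _ (KP (- a) _ _ Kv (Hu i).1); have := (Hu i).2.
  have -> : A - (- a *: v + u i) = A - u i + a *: v.
    by rewrite scaleNr opprD opprK (addrC (a *: v)) addrA.
  rewrite nrm_addZ// [dot v _]dotC// -/z.
  have -> : complex.Re (a * z^*) = - (sqn z / nrm v).
    by rewrite !ReM !ImM ReJ ImJ /sqn /=; ring.
  have -> : sqn a * nrm v = sqn z / nrm v.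
    by rewrite /a sqnM {1}/sqn /= oppr0 expr0n addr0; field.
  rewrite -ler_pdivrMr//; move: (nrm (A - u i)) (sqn z / nrm v) (i.+1%:R^-1).
  by move=> x y ip; lra.
have Luh i : L (u i - h) by apply: LB => //; exact: KL (Hu i).1.
have bound i : sqn (dot (A - h) v) <= 2 * nrm v * (i.+1%:R^-1 + nrm (u i - h)).
  have -> : A - h = (A - u i) + (u i - h) by rewrite addrA subrK.
  rewrite dotD//; apply: (le_trans (sqnD _ _)).
  have := near i; have := cauchy_schwarz (Luh i) Lv.
  move: (sqn (dot (u i - h) v)) (sqn (dot (A - u i) v)) (i.+1%:R^-1).
  by move: (nrm (u i - h)) (nrm v) => x y a b ip; lra.
apply: sqn_le0.
apply/ler_addgt0Pr => eps e0; rewrite add0r.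
have vp : 0 < 2 * nrm v + 1 by have := dot_ge0 Lv; lra.
have ep : 0 < eps / (2 * (2 * nrm v + 1)) by rewrite divr_gt0// mulr_gt0.
have [N1 H1] := small _ ep; have [N2 H2] := uh _ ep.
have := H1 _ (leq_maxl N1 N2); have := H2 _ (leq_maxr N1 N2).
move: (bound (maxn N1 N2)); set s := sqn _; set x := _^-1; set y := nrm (_ - h).
move=> b0 y1 x1; apply: (le_trans b0).
apply: (@le_trans _ _ (2 * nrm v * (eps / (2 * nrm v + 1)))).
  apply: ler_wpM2l; first by have := dot_ge0 Lv; lra.
  have -> : eps / (2 * nrm v + 1) = eps / (2 * (2 * nrm v + 1)) +
       eps / (2 * (2 * nrm v + 1)) by field; rewrite gt_eqF.
  by lra.
rewrite mulrA ler_pdivrMr//; nra.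
Qed.

Let Lsum (I : Type) (s : seq I) (c : I -> R[i]) (w : I -> E) :
  (forall i, L (w i)) -> L (\sum_(i <- s) c i *: w i).
Proof.
by move=> Lw; elim/big_rec: _ => // i x _ Lx; exact: LP.
Qed.

(** The projection [p] satisfies [dot p e = dot p p = S], so [e - p] has squared norm [nrm e - S],
    which is nonnegative. *)
Lemma bessel (I : finType) (w : I -> E) e : L e -> (forall i, L (w i)) ->
  (forall i j, dot (w i) (w j) = (i == j)%:R) ->
  \sum_i sqn (dot e (w i)) <= nrm e.
Proof.
move=> Le Lw ow; set S := \sum_i _.
pose p := \sum_i dot e (w i) *: w i.
have Lp : L p by exact: Lsum.
have dsum v : L v -> dot p v = \sum_i dot e (w i) * dot (w i) v.
  move=> Lv; rewrite /p.
  have H (s : seq I) : dot (\sum_(i <- s) dot e (w i) *: w i) v =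
      \sum_(i <- s) dot e (w i) * dot (w i) v.
    elim: s => [|i s ih]; first by rewrite !big_nil dot0.
    by rewrite !big_cons dotP// ?ih//; exact: Lsum.
  exact: H.
have dpw i : dot p (w i) = dot e (w i).
  rewrite dsum// (bigD1 i)//= ow eqxx mulr1 big1 ?addr0// => j ji.
  by rewrite ow (negbTE ji) mulr0.
have SE : \sum_i dot e (w i) * (dot e (w i))^* = S%:C%C.
  rewrite /S (@raddf_sum _ _ (real_complex R)) /=; apply: eq_bigr => i _.
  case: (dot e (w i)) => x y; apply/eqP; rewrite eq_complex /sqn /=.
  by apply/andP; split; apply/eqP; ring.
have dpe : dot p e = S%:C%C.
  by rewrite dsum// -SE; apply: eq_bigr => i _; rewrite [dot (w i) e]dotC.
have dpp : dot p p = S%:C%C.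
  rewrite dsum// -SE; apply: eq_bigr => i _; rewrite [dot (w i) p]dotC//.
  by rewrite dpw.
have := dot_ge0 (LD Le (LZ (- 1) Lp)).
by rewrite nrm_addZ// {2}/nrm dpp dpe /sqn /= mulN1r /=; lra.
Qed.

Variables (S : int -> E -> E).
Hypothesis LS : forall j u, L u -> L (S j u).
Hypothesis SS : forall j l u, S j (S l u) = S (j + l) u.
Hypothesis S0 : forall u, S 0 u = u.
Hypothesis Sdot : forall j u v, L u -> L v -> dot (S j u) (S j v) = dot u v.

Lemma dot_shift j u v : L u -> L v -> dot (S j u) v = dot u (S (- j) v).
Proof.
by move=> Lu Lv; rewrite -(Sdot (- j))// ?SS ?addNr ?S0//; exact: LS.
Qed.

(* Each [w i] below spans the wandering subspace between two consecutive
   members of a shift-invariant chain; Bessel's inequality against the [n]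
   generators [e k] bounds the number [N] of such subspaces by the multiplicity
   [n] of the shift. *)
Lemma wandering_dimension (N n : nat) (A B : 'I_N -> E) (e : 'I_n -> E) :
  (forall i, L (A i)) -> (forall i, L (B i)) -> (forall k, L (e k)) ->
  (forall k, nrm (e k) = 1) ->
  (forall w, L w -> forall eps : R, 0 < eps -> exists J0 : nat,
    forall J, (J0 <= J)%N -> nrm w - eps <=
      \sum_k \sum_(j < J.*2.+1) sqn (dot (e k) (S (j%:Z - J%:Z) w))) ->
  (forall (i c : 'I_N) (j : int), 0 < j \/ (j = 0 /\ (i < c)%N) ->
    dot (A i) (S j (B c)) = 0) ->
  (forall i, dot (A i) (B i) != 0) ->
  (N <= n)%N.
Proof.
move=> LA LBB Le e1 tot H Hd.
(* Order the vectors [S j (B c)] lexicographically by [(j, c)]. [K i] is the annihilator of the tail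
   starting at [(0, i)], whereas [A i] annihilates only what comes strictly after. The part of [A i]
   orthogonal to [K i] is therefore one step of the chain of annihilators. *)
pose K (i : 'I_N) u := L u /\ forall (c : 'I_N) (j : int),
  0 < j \/ (j = 0 /\ (i <= c)%N) -> dot u (S j (B c)) = 0.
have Lsb j c : L (S j (B c)) by exact: LS.
have /choice[w Hw] : forall i : 'I_N, exists w, [/\ L w, dot w w = 1,
    (forall (c : 'I_N) (j : int), 0 < j \/ (j = 0 /\ (i < c)%N) -> dot w (S j (B c)) = 0) &
    forall v, K i v -> dot w v = 0].
  move=> i; have [||||h Kh hK] := @projection_exists (K i) (A i) _ _ _ _ (LA i).
  - by move=> u [].
  - by split => // c j _; exact: dot0.
  - move=> a u v [Lu Hu] [Lv Hv]; split; first exact: LP.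
    by move=> c j cj; rewrite dotP// Hu// Hv// mulr0 addr0.
  - move=> u l Ku Ll ul; split => // c j cj.
    have b p : sqn (dot l (S j (B c))) <= nrm (u p - l) * nrm (B c).
      have Lul : L (u p - l) by apply: LB => //; exact: (Ku p).1.
      have := cauchy_schwarz Lul (Lsb j c).
      rewrite dotB//; last exact: (Ku p).1.
      rewrite ((Ku p).2 c j cj) sub0r /nrm Sdot//.
      by rewrite {1}/sqn ReN ImN !sqrrN.
    apply: sqn_le0.
    apply/ler_addgt0Pr => eps e0; rewrite add0r.
    have Bp : 0 < nrm (B c) + 1 by have := dot_ge0 (LBB c); lra.
    have [M HM] := ul (eps / (nrm (B c) + 1)) (divr_gt0 e0 Bp).
    apply: (le_trans (b M)).
    have := HM M (leqnn M); rewrite ltr_pdivlMr// => hh.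
    have := dot_ge0 (LBB c).
    have : 0 <= nrm (u M - l) by apply/dot_ge0/LB => //; exact: (Ku M).1.
    by nra.
  have Lw : L (A i - h) by apply: LB => //; exact: Kh.1.
  (* [h] is orthogonal to [B i] and [A i] is not, so the difference cannot vanish. *)
  have wB : dot (A i - h) (B i) != 0.
    have /(_ i 0) := Kh.2; rewrite S0 => hB.
    by rewrite dotB//; [rewrite hB ?subr0//; right|exact: Kh.1].
  have wp : 0 < nrm (A i - h).
    rewrite lt_neqAle dot_ge0// andbT eq_sym; apply: contraNneq wB => w0.
    have := cauchy_schwarz Lw (LBB i); rewrite w0 mul0r => z0.
    by rewrite (sqn_le0 z0).
  pose r : R[i] := ((Num.sqrt (nrm (A i - h)))^-1)%:C%C.
  exists (r *: (A i - h)); split.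
  - exact: LZ.
  - rewrite dotuu; last exact: LZ.
    rewrite nrmZ// /sqn /r /= expr0n addr0 exprVn sqr_sqrtr ?ltW// mulVf//.
    by rewrite gt_eqF.
  - move=> c j cj; rewrite dotZ// dotB//; last exact: Kh.1.
    rewrite H// Kh.2 ?subr0 ?mulr0//; case: cj => [|[-> ic]]; [by left|right].
    by split => //; exact: ltnW.
  - by move=> v Kv; rewrite dotZ ?hK ?mulr0//; exact: Kv.1.
have Lw i : L (w i) by have [] := Hw i.
have orth1 (i i' : 'I_N) (dl : int) : 0 < dl \/ (dl = 0 /\ (i < i')%N) ->
    dot (w i) (S dl (w i')) = 0.
  move=> lt; have [_ _ wB _] := Hw i; have [_ _ _ wK] := Hw i'.
  (* Shifted back by [dl], the vector [w i] annihilates the whole tail from [(0, i')] on, so it lies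
     in [K i'], to which [w i'] is orthogonal. *)
  have -> : dot (w i) (S dl (w i')) = dot (S (- dl) (w i)) (w i').
    by rewrite dot_shift// opprK.
  rewrite dotC//; last exact: LS.
  rewrite wK ?rmorph0//; split; first exact: LS.
  move=> c j cj; rewrite dot_shift// opprK SS wB//.
  case: lt => [dl0|[-> ii']].
    by left; case: cj => [j0|[-> _]]; lia.
  case: cj => [j0|[-> ic]]; [left|right]; first by rewrite add0r.
  by split => //; exact: leq_trans ii' ic.
have orth (i i' : 'I_N) (j j' : int) :
    dot (S j (w i)) (S j' (w i')) = ((i == i') && (j == j'))%:R.
  rewrite dot_shift//; last exact: LS.
  rewrite SS addrC.
  have [jj|jj|jj] := ltgtP j j'.
  - by rewrite andbF orth1//; left; rewrite subr_gt0.
  - rewrite andbF dotC//; last exact: LS.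
    rewrite dot_shift// orth1 ?rmorph0//.
    by left; rewrite opprB subr_gt0.
  - rewrite jj subrr S0 andbT.
    have [ii|ii|ii] := ltngtP i i'.
    + rewrite -(S0 (w i')) orth1//; last by right.
      by have [Ei|//] := eqVneq i i'; move: ii; rewrite Ei ltnn.
    + rewrite dotC// -(S0 (w i)) orth1//; last by right.
      rewrite rmorph0; have [Ei|//] := eqVneq i i'; move: ii.
      by rewrite Ei ltnn.
    + have -> : i = i' by exact: val_inj.
      by rewrite eqxx; have [] := Hw i'.
have n1w i : nrm (w i) = 1 by rewrite /nrm; have [_ ->] := Hw i.
(* The truncation errors of the [N] vectors must add up to less than 1: then [N - N * eps <= n]
   forces [N <= n] between integers. *)
pose eps : R := (2 * N.+1%:R)^-1.
have e0 : 0 < eps by rewrite invr_gt0 mulr_gt0// ltr0Sn.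
have /choice[J0 HJ0] : forall i, exists J0 : nat, forall J, (J0 <= J)%N ->
    1 - eps <= \sum_k \sum_(j < J.*2.+1) sqn (dot (e k) (S (j%:Z - J%:Z) (w i))).
  by move=> i; have [J0 HJ] := tot (w i) (Lw i) eps e0; exists J0 => J /HJ; rewrite n1w.
pose J := \max_i J0 i.
(* The shifts of all the [w i] within the common window form an orthonormal system, and [e k] is a
   unit vector. *)
have ub k : \sum_i \sum_(j < J.*2.+1) sqn (dot (e k) (S (j%:Z - J%:Z) (w i))) <= 1.
  rewrite pair_bigA /= -(e1 k).
  apply: (@bessel _ (fun p : 'I_N * 'I_(J.*2.+1) => S (p.2%:Z - J%:Z) (w p.1))) => //.
    by move=> p; exact: LS.
  move=> [i j] [i' j'] /=; rewrite orth; congr (_%:R); rewrite xpair_eqE.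
  by rewrite (inj_eq (addIr _)) eqz_nat.
have : \sum_(i < N) (1 - eps) <= \sum_(k < n) 1.
  apply: (@le_trans _ _ (\sum_i \sum_k \sum_(j < J.*2.+1)
     sqn (dot (e k) (S (j%:Z - J%:Z) (w i))))).
    by apply: ler_sum => i _; apply: HJ0; exact: leq_bigmax.
  by rewrite exchange_big /=; apply: ler_sum => k _; exact: ub.
rewrite !sumr_const !card_ord -(mulr_natr (1 - eps)) leqNgt => lt.
apply/negP => nN.
have : n.+1%:R <= N%:R :> R by rewrite ler_nat.
have : N%:R * eps < 1.
  rewrite /eps ltr_pdivrMr ?mulr_gt0 ?ltr0Sn// mul1r -addn1 natrD.
  by have := ler0n R N; lra.
rewrite -(addn1 n) natrD; move: lt; move: eps {e0 HJ0} (N%:R) (n%:R).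
by move=> ep x y; lra.
Qed.

End hilbert.

(** * Fourier uniqueness *)

Section exponential.
Context {R : realType}.
Local Notation lebR := (@lebesgue_measure R).

Definition ex (s : R) : R[i] := expi (2 * pi * s).

Lemma ex0 : ex 0 = 1.
Proof. by rewrite /ex /expi mulr0 cos0 sin0. Qed.

Lemma exD s t : ex (s + t) = ex s * ex t.
Proof.
rewrite /ex /expi mulrDr cosD sinD; apply/eqP; rewrite eq_complex /=.
by apply/andP; split => //; apply/eqP; ring.
Qed.

Lemma exN s : ex (- s) = (ex s)^*.
Proof. by rewrite /ex /expi mulrN cosN sinN. Qed.

Lemma ex1 : ex 1 = 1.
Proof.
by rewrite /ex /expi mulr1 mulr_natl cos2pi sin2pi.
Qed.

Lemma ex_int (m : int) : ex m%:~R = 1.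
Proof.
have H (n : nat) : ex n%:R = 1.
  by elim: n => [|n ih]; rewrite ?ex0// -natr1 exD ih ex1 mulr1.
case: m => n; first exact: H.
by rewrite NegzE intrN exN (H n.+1) rmorph1.
Qed.

Lemma n1_ex s : n1 (ex s) <= 2.
Proof.
rewrite /n1 /ex /expi /=; have := cos_max (2 * pi * s).
have := sin_max (2 * pi * s); lra.
Qed.

Lemma sqn_ex s : sqn (ex s) = 1.
Proof. by rewrite /sqn /ex /expi /= cos2Dsin2. Qed.

Lemma cmeas_ex {d : measure_display} {T : measurableType d} (phi : T -> R) :
  measurable_fun setT phi -> cmeas (fun t => ex (phi t)).
Proof.
move=> mphi; apply: (cmeas_comp (h := ex)) => //; split => /=.
- apply: (measurableT_comp (f := cos)).
    by apply: continuous_measurable_fun; exact: continuous_cos.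
  exact: measurable_funM.
- apply: (measurableT_comp (f := sin)).
    by apply: continuous_measurable_fun; exact: continuous_sin.
  exact: measurable_funM.
Qed.

Lemma exE (s : R) : (sin (2 * pi * s))%:C%C =
  Complex 0 (- 2^-1) * ex s + Complex 0 (2^-1) * ex (- s).
Proof.
rewrite exN /ex /expi; apply/eqP; rewrite eq_complex /=.
by apply/andP; split; apply/eqP; field.
Qed.

Lemma sg_sin (x : R) : `|x| < pi -> Num.sg (sin x) = Num.sg x.
Proof.
move=> xpi; have [x0|x0|->] := ltgtP x 0; last by rewrite sin0.
- rewrite (ltr0_sg x0) ltr0_sg//.
  rewrite -oppr_gt0 -sinN; apply: sin_gt0_pi.
  by rewrite oppr_gt0 x0 /= -(ltr0_norm x0).
- by rewrite (gtr0_sg x0) gtr0_sg// sin_gt0_pi// x0 /= -(gtr0_norm x0).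
Qed.

Lemma measurable_sg : measurable_fun setT (Num.sg : R -> R).
Proof.
have -> : (Num.sg : R -> R) =
    (fun x : R => (\1_(`]0, +oo[%classic : set R) x : R) - \1_(`]-oo, 0[%classic : set R) x).
  apply/funext => x; rewrite !indicE; have [x0|x0|->] := ltgtP x 0.
  - rewrite ltr0_sg// memNset ?mem_set /= ?in_itv//= ?x0 ?sub0r//.
    by rewrite andbT; apply/negP; rewrite -leNgt ltW.
  - rewrite gtr0_sg// mem_set /= ?in_itv//= ?x0 ?andbT// memNset ?subr0//= in_itv /=.
    by apply/negP; rewrite -leNgt ltW.
  - by rewrite sgr0 !memNset ?subr0//= in_itv /= ltxx.
by apply: measurable_funB; apply: measurable_indic; exact: measurable_itv.
Qed.

Lemma sg_norm (x : R) : `|Num.sg x| <= 1.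
Proof. by rewrite normr_sg; case: (x != 0). Qed.

(* Iterating this cubic on [-1, 1] converges to the sign function; applied to
   [sin] it yields trigonometric polynomials bounded by 1. *)
Definition smooth (s : R) : R := (3 * s - s * (s * s)) / 2.

Lemma iter_smooth_bound N s : `|s| <= 1 -> `|iter N smooth s| <= 1.
Proof.
move=> s1; elim: N => //= N; set y := iter N smooth s.
rewrite !ler_norml /smooth => /andP[a b].
apply/andP; split.
  have : 0 <= (y + 1) * (y + 1) * (2 - y) by rewrite !mulr_ge0//; lra.
  by lra.
have : 0 <= (1 - y) * (1 - y) * (2 + y) by rewrite !mulr_ge0//; lra.
by lra.
Qed.

Lemma iter_smoothN N s : iter N smooth (- s) = - iter N smooth s.
Proof. by elim: N => //= N ->; rewrite /smooth; lra. Qed.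

Lemma iter_smooth0 N : iter N smooth 0 = 0.
Proof. by elim: N => //= N ->; rewrite /smooth; lra. Qed.

(** The distance to 1 contracts: [1 - smooth y] equals [(1 - y) * (1 - (y + y ^ 2) / 2)], and the
    iterates stay above [s], so the second factor is at most [1 - s / 2]. *)
Lemma iter_smooth_pos N s : 0 < s <= 1 ->
  s <= iter N smooth s <= 1 /\ 1 - iter N smooth s <= (1 - s / 2) ^+ N.
Proof.
move=> /andP[s0 s1]; elim: N => [|N] /=.
  by rewrite lexx s1 expr0; split => //; lra.
rewrite exprS; set y := iter N smooth s; set z := _ ^+ N.
move=> [/andP[sy y1] yz]; rewrite /smooth; split.
  apply/andP; split.
    have : 0 <= y * (1 - y) * (1 + y) by rewrite !mulr_ge0//; lra.
    by lra.
  have : 0 <= (1 - y) * (1 - y) * (2 + y) by rewrite !mulr_ge0//; lra.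
  by lra.
apply: (@le_trans _ _ ((1 - s / 2) * (1 - y))); last first.
  by apply: ler_wpM2l => //; lra.
have : 0 <= (1 - y) * y * y by rewrite !mulr_ge0//; lra.
have : 0 <= (1 - y) * (y - s) by rewrite mulr_ge0//; lra.
by lra.
Qed.

Lemma iter_smooth_cvg s : `|s| <= 1 ->
  iter N smooth s @[N --> \oo] --> Num.sg s.
Proof.
have pos x : 0 < x <= 1 -> iter N smooth x @[N --> \oo] --> (1 : R).
  move=> x01; have /andP[x0 x1] := x01.
  apply/cvgrPdist_le => eps e0.
  have : (1 - x / 2) ^+ N @[N --> \oo] --> (0 : R).
    by apply: cvg_expr; rewrite ger0_norm; lra.
  move=> /cvgrPdist_le /(_ _ e0); apply: filterS => N.
  rewrite sub0r normrN ger0_norm; last by rewrite exprn_ge0//; lra.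
  move=> le; have [/andP[a b] c] := iter_smooth_pos N x01.
  by rewrite ger0_norm ?subr_ge0//; exact: le_trans le.
move=> s1; have [s0|s0|->] := ltgtP s 0.
- rewrite (ltr0_sg s0).
  have -> : (fun N => iter N smooth s) = (fun N => - iter N smooth (- s)).
    by apply/funext => N; rewrite iter_smoothN opprK.
  apply: cvgN; apply: pos; rewrite oppr_gt0 s0 /=.
  by rewrite -(ltr0_norm s0).
- by rewrite (gtr0_sg s0); apply: pos; rewrite s0 /= -(gtr0_norm s0).
- rewrite sgr0; under eq_fun do rewrite iter_smooth0; exact: cvg_cst.
Qed.

(** Up to sign and scale, these integrals are the Fourier coefficients of the periodization of [F]
    with period [P]. *)
Definition annihilated (P : R) (F : R -> R[i]) : Prop :=
  cintegrable lebR F /\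
  forall l : int, cI lebR (fun t => F t * ex (l%:~R * t / P)) = 0.

(** Functions that preserve annihilation are stable under composition with [smooth] and under
    bounded pointwise limits, which leads from the sine to the square wave without any density
    theorem. *)
Definition multiplier (P : R) (s : R -> R) : Prop :=
  forall F, annihilated P F -> annihilated P (fun t => F t * (s t)%:C%C).

Lemma cintegrableM_ex F (phi : R -> R) : measurable_fun setT phi ->
  cintegrable lebR F -> cintegrable lebR (fun t => F t * ex (phi t)).
Proof.
move=> mphi iF; apply: (cintegrableM_bdd (M := 2)) => //; first exact: cmeas_ex.
by move=> t; exact: n1_ex.
Qed.

Let mfreq (l : int) (P : R) : measurable_fun setT (fun t : R => l%:~R * t / P).
Proof. by apply: measurable_funM => //; exact: measurable_funM. Qed.

Lemma annihilatedD P F G : annihilated P F -> annihilated P G ->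
  annihilated P (fun t => F t + G t).
Proof.
move=> [iF aF] [iG aG]; split; first exact: cintegrableD.
move=> l; under cI_eq do rewrite mulrDl.
by rewrite cID ?aF ?aG ?addr0//; exact: cintegrableM_ex.
Qed.

Lemma annihilatedZ P c F : annihilated P F -> annihilated P (fun t => c * F t).
Proof.
move=> [iF aF]; split; first exact: cintegrableZ.
move=> l; under cI_eq do rewrite -mulrA.
by rewrite cIZ ?aF ?mulr0//; exact: cintegrableM_ex.
Qed.

Lemma annihilated_ex P (j : int) F : annihilated P F ->
  annihilated P (fun t => F t * ex (j%:~R * t / P)).
Proof.
move=> [iF aF]; split; first exact: cintegrableM_ex.
move=> l; rewrite -(aF (j + l)); apply: cI_eq => t.
by rewrite -mulrA -exD intrD !mulrDl.
Qed.

Lemma annihilated_eq P F G : F =1 G -> annihilated P F -> annihilated P G.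
Proof. by move=> /funext ->. Qed.

(** The sine combines two characters, and multiplying by a character only renumbers the vanishing
    integrals. *)
Lemma multiplier_sin P a : multiplier P (fun t => sin (2 * pi * ((t - a) / P))).
Proof.
move=> F aF.
pose c1 := Complex 0 (- 2^-1) * ex (- a / P).
pose c2 := Complex 0 (2^-1) * ex (a / P).
apply: (annihilated_eq (F := fun t => c1 * (F t * ex (1%:~R * t / P)) +
                                 c2 * (F t * ex ((-1)%:~R * t / P)))).
  move=> t; rewrite exE.
  have -> : (t - a) / P = - a / P + 1%:~R * t / P by rewrite mul1r -mulrDl addrC.
  have -> : - (- a / P + 1%:~R * t / P) = a / P + (-1)%:~R * t / P.
    by rewrite intrN mulN1r mul1r opprD !mulNr opprK.
  rewrite !exD /c1 /c2; ring.
apply: annihilatedD; apply: annihilatedZ; exact: annihilated_ex.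
Qed.

Lemma multiplier_smooth P s : multiplier P s -> multiplier P (fun t => smooth (s t)).
Proof.
move=> Ms F aF.
apply: (annihilated_eq (F := fun t => (3 / 2)%:C%C * (F t * (s t)%:C%C) +
  (- 2^-1)%:C%C * (F t * (s t)%:C%C * (s t)%:C%C * (s t)%:C%C))).
  move=> t; rewrite /smooth; case: (F t) => x y.
  apply/eqP; rewrite eq_complex /=.
  by apply/andP; split; apply/eqP; field.
apply: annihilatedD; apply: annihilatedZ; first exact: Ms.
by apply: (Ms); apply: (Ms); apply: (Ms).
Qed.

Lemma multiplier_cvg P (s_ : nat -> R -> R) (s : R -> R) :
  (forall N, multiplier P (s_ N)) ->
  (forall N, measurable_fun setT (s_ N)) -> measurable_fun setT s ->
  (forall N t, `|s_ N t| <= 1) -> (forall t, `|s t| <= 1) ->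
  (forall t, s_ N t @[N --> \oo] --> s t) -> multiplier P s.
Proof.
move=> Ms ms_ ms b_ b cs F [iF aF].
have mF := cintegrable_cmeas iF.
have mC (k : R -> R) : measurable_fun setT k -> cmeas (fun t : R => (k t)%:C%C).
  by move=> mk; split => //=; exact: measurable_cst.
have n1C (x : R) : n1 (x%:C%C) = `|x| by rewrite /n1 /= normr0 addr0.
split.
  apply: (cintegrableM_bdd (mu := lebR) (h := F) (p := fun t => (s t)%:C%C)
    (M := 1) (mC _ ms) _ iF) => t.
  by rewrite n1C.
move=> l.
apply: (cI_dom_cvg0 (mu := lebR)
  (h_ := fun N t => F t * (s_ N t)%:C%C * ex (l%:~R * t / P))
  (h := fun t => F t * (s t)%:C%C * ex (l%:~R * t / P)) (phi := fun t => 2 * n1 (F t))).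
- move=> N; apply: cmeasM; last exact: (cmeas_ex (mfreq l P)).
  by apply: cmeasM => //; exact: mC.
- apply: cmeasM; last exact: (cmeas_ex (mfreq l P)).
  by apply: cmeasM => //; exact: mC.
- exact: (integrableZl measurableT 2 (integrable_n1 iF)).
- move=> N t; rewrite (le_trans (n1M _ _))// mulrC.
  apply: ler_pM; rewrite ?n1_ge0 ?n1_ex//.
  rewrite (le_trans (n1M _ _))// n1C -[leRHS]mulr1.
  by apply: ler_wpM2l; rewrite ?n1_ge0.
- move=> t; under eq_fun do rewrite !(ReM, ImM) /= !mulr0 subr0 add0r.
  rewrite !(ReM, ImM) /= !mulr0 subr0 add0r.
  apply: cvgB; (apply: cvgM; last exact: cvg_cst); apply: cvgM => //; exact: cvg_cst.
- move=> t; under eq_fun do rewrite !(ReM, ImM) /= !mulr0 subr0 add0r.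
  rewrite !(ReM, ImM) /= !mulr0 subr0 add0r.
  apply: cvgD; (apply: cvgM; last exact: cvg_cst); apply: cvgM => //; exact: cvg_cst.
- by move=> N; have [_ ->] := Ms N F (conj iF aF).
Qed.

(** The square wave of period [P] centred at [a]: it agrees with the sign of [t - a] at distance
    less than [P / 2] from [a]. *)
Definition sgsin (P a t : R) : R := Num.sg (sin (2 * pi * ((t - a) / P))).

Let msin (P a : R) : measurable_fun setT (fun t : R => sin (2 * pi * ((t - a) / P))).
Proof.
apply: (measurableT_comp (f := sin)).
  by apply: continuous_measurable_fun; exact: continuous_sin.
apply: measurable_funM => //; apply: measurable_funM => //.
exact: measurable_funB.
Qed.

Lemma measurable_sgsin P a : measurable_fun setT (sgsin P a).
Proof. exact: (measurableT_comp measurable_sg). Qed.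

Lemma multiplier_sgsin P a : multiplier P (sgsin P a).
Proof.
pose s t := sin (2 * pi * ((t - a) / P)).
apply: (multiplier_cvg (s_ := fun N t => iter N smooth (s t))).
- by elim=> [|N ih]; [exact: multiplier_sin|exact: multiplier_smooth].
- elim=> [|N ih]; first exact: msin.
  rewrite /= /smooth; apply: measurable_funM => //.
  apply: measurable_funB; first exact: measurable_funM.
  by apply: measurable_funM => //; exact: measurable_funM.
- exact: measurable_sgsin.
- by move=> N t; apply: iter_smooth_bound; exact: sin_max.
- by move=> t; exact: sg_norm.
- by move=> t; apply: iter_smooth_cvg; exact: sin_max.
Qed.

Lemma sgsinE P a t : 0 < P -> `|t - a| < P / 2 -> sgsin P a t = Num.sg (t - a).
Proof.
move=> P0 ta; rewrite /sgsin sg_sin.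
  by rewrite !sgrM (gtr0_sg (@pi_gt0 R)) sgrV (gtr0_sg P0) gtr0_sg// !mul1r mulr1.
rewrite !normrM (gtr0_norm (@pi_gt0 R)) normfV (gtr0_norm P0) gtr0_norm//.
have -> : 2 * pi * (`|t - a| / P) = pi * (`|t - a| / (P / 2)) by field; rewrite gt_eqF.
by rewrite gtr_pMr ?pi_gt0// ltr_pdivrMr ?divr_gt0// mul1r.
Qed.

(** Since [(1 - sg (t - x)) / 2] is the indicator of []-oo, x]] away from [x], the primitive of [k]
    is constant, and Lebesgue differentiation recovers [k] almost everywhere. *)
Lemma Rintegrable_sg_ae0 (k : R -> R) : lebR.-integrable setT (EFin \o k) ->
  (forall a, Rintegral lebR setT (fun t => k t * Num.sg (t - a)) = 0) ->
  {ae lebR, forall t, k t = 0}.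
Proof.
move=> ik k0.
have mk : measurable_fun setT k.
  by move/measurable_int : ik => /measurable_EFinP.
have isg a : lebR.-integrable setT (EFin \o (fun t => k t * Num.sg (t - a))).
  apply: le_integrable ik => //.
    apply/measurable_EFinP; apply: measurable_funM => //.
    by apply: (measurableT_comp measurable_sg); exact: measurable_funB.
  move=> t _ /=; rewrite lee_fin normrM -[leRHS]mulr1.
  by apply: ler_wpM2l => //; exact: sg_norm.
have H x : Rintegral lebR `]-oo, x]%classic k = 2^-1 * Rintegral lebR setT k.
  rewrite Rintegral_mkcond.
  transitivity (Rintegral lebR setT (fun t => 2^-1 * (k t - k t * Num.sg (t - x)))).
    rewrite /Rintegral; congr fine; apply: ae_eq_integral => //.
    - apply/measurable_EFinP; apply: (measurable_restrictT _ _).1.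
        exact: measurable_itv.
      exact: measurable_funTS.
    - apply/measurable_EFinP/measurable_funM => //; apply: measurable_funB => //.
      by move/measurable_int : (isg x) => /measurable_EFinP.
    - exists [set x]; split => //; first exact: lebesgue_measure_set1.
      move=> t /= /not_implyP[_]; apply: contra_notP => tx.
      congr (_%:E); rewrite patchE; case: ifPn => [/set_mem|/negP].
        rewrite /= in_itv /= => tlex; rewrite ltr0_sg; first by move: (k t : R) => y; lra.
        by rewrite subr_lt0 lt_neqAle tlex andbT; apply/eqP.
      move=> nt; rewrite gtr0_sg; first by rewrite mulr1 subrr mulr0.
      rewrite subr_gt0 ltNge; apply/negP => tlex.
      by apply: nt; rewrite inE /= in_itv.
  rewrite RintegralZl//; last first.
    exact: (integrableB measurableT ik (isg x)).
  by rewrite RintegralB// k0 subr0.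
have := @FTC1Ny R k _ _.
have i1 y : lebR.-integrable `]-oo, y]%classic (EFin \o k).
  by apply: integrableS ik => //; exact: measurable_itv.
have i2 : locally_integrable setT k.
  by apply: open_integrable_locally => //; exact: openT.
move=> /(_ i1 i2) K; apply: (ae_mono K) => t [_ <-].
have -> : (fun x => Rintegral lebR [set` `]-oo, x]] k) = cst (2^-1 * Rintegral lebR setT k).
  by apply/funext => x; exact: H.
by rewrite derive1_cst.
Qed.

Lemma cintegrable_sg_ae0 (F : R -> R[i]) : cintegrable lebR F ->
  (forall a, cI lebR (fun t => F t * (Num.sg (t - a))%:C%C) = 0) ->
  {ae lebR, forall t, F t = 0}.
Proof.
move=> [a b] F0.
have H1 : {ae lebR, forall t, complex.Re (F t) = 0}.
  apply: Rintegrable_sg_ae0 => // x; have := F0 x; rewrite /cI => -[+ _].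
  move=> H; rewrite -[RHS]H; apply: eq_Rintegral => t _.
  by rewrite ReM /= mulr0 subr0.
have H2 : {ae lebR, forall t, complex.Im (F t) = 0}.
  apply: Rintegrable_sg_ae0 => // x; have := F0 x; rewrite /cI => -[_ +].
  move=> H; rewrite -[RHS]H; apply: eq_Rintegral => t _.
  by rewrite ImM /= mulr0 add0r.
apply: (ae_mono2 H1 H2) => t; case: (F t) => x y /= -> ->.
by [].
Qed.

(** The square waves of period [N + 1] centred at [a] converge pointwise to the sign of [t - a];
    this is why arbitrarily large periods are required. *)
Lemma fourier_uniqueness_line F : (forall i : nat, annihilated i.+1%:R F) ->
  {ae lebR, forall t, F t = 0}.
Proof.
move=> aF; have iF := (aF 0%N).1; have mF := cintegrable_cmeas iF.
have mC (k : R -> R) : measurable_fun setT k -> cmeas (fun t : R => (k t)%:C%C).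
  by move=> mk; split => //=; exact: measurable_cst.
have n1C (x : R) : n1 (x%:C%C) = `|x| by rewrite /n1 /= normr0 addr0.
apply: cintegrable_sg_ae0 => // a.
apply: (cI_dom_cvg0 (mu := lebR)
  (h_ := fun N t => F t * (sgsin N.+1%:R a t)%:C%C)
  (h := fun t => F t * (Num.sg (t - a))%:C%C) (phi := fun t => n1 (F t))).
- by move=> N; apply: cmeasM => //; apply: mC; exact: measurable_sgsin.
- apply: cmeasM => //; apply: mC.
  by apply: (measurableT_comp measurable_sg); exact: measurable_funB.
- exact: integrable_n1.
- move=> N t; rewrite (le_trans (n1M _ _))// n1C -[leRHS]mulr1.
  by apply: ler_wpM2l; [rewrite ?n1_ge0|exact: sg_norm].
- move=> t; apply: cvg_near_cst; near=> N; rewrite sgsinE//.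
  rewrite ltr_pdivlMr// (@lt_trans _ _ N%:R) ?ltr_nat//.
  near: N; exact: nbhs_infty_gtr.
- move=> t; apply: cvg_near_cst; near=> N; rewrite sgsinE//.
  rewrite ltr_pdivlMr// (@lt_trans _ _ N%:R) ?ltr_nat//.
  near: N; exact: nbhs_infty_gtr.
- move=> N; have [_ /(_ 0)] := multiplier_sgsin a (aF N).
  by move=> <-; apply: cI_eq => t; rewrite mul0r mul0r ex0 mulr1.
Unshelve. all: by end_near. Qed.

Lemma ae_neq (x : R) : {ae lebR, forall t, t <> x}.
Proof.
exists [set x]; split => //; first exact: lebesgue_measure_set1.
by move=> t /= /contrapT.
Qed.

(** On a window of length 1/2 containing [a], the square wave of period 1 is the sign of [t - a];
    for [a] outside the window the sign is constant on it. A longer window would meet further jumps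
    of the wave. *)
Lemma annihilated_half F c : annihilated 1 F ->
  (forall t, ~ (c < t < c + 2^-1) -> F t = 0) -> {ae lebR, forall t, F t = 0}.
Proof.
move=> aF F0; apply: cintegrable_sg_ae0; first exact: aF.1.
have cI0 : cI lebR F = 0.
  rewrite -(aF.2 0); apply: cI_eq => t; by rewrite mul0r mul0r ex0 mulr1.
move=> a; have [ac|ca] := leP a c.
  rewrite -[RHS]cI0; apply: cI_eq => t.
  have [/andP[ct _]|/negP /F0->] := boolP (c < t < c + 2^-1); last by rewrite mul0r.
  by rewrite gtr0_sg ?mulr1// subr_gt0 (le_lt_trans ac).
have [ac|ca'] := leP (c + 2^-1) a.
  transitivity (-1 * cI lebR F); last by rewrite cI0 mulr0.
  rewrite -cIZ; last exact: aF.1.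
  apply: cI_eq => t.
  have [/andP[_ ct]|/negP /F0->] := boolP (c < t < c + 2^-1); last by rewrite mul0r mulr0.
  rewrite ltr0_sg ?subr_lt0 ?(lt_le_trans ct)//.
  by rewrite mulrC rmorphN1.
have [_ /(_ 0)] := multiplier_sgsin a aF; move=> <-; apply: cI_eq => t.
rewrite mul0r mul0r ex0 mulr1.
have [/andP[ct ct']|/negP /F0->] := boolP (c < t < c + 2^-1); last by rewrite !mul0r.
rewrite sgsinE// ltr_norml; lra.
Qed.

(** The square wave [s] is itself a multiplier, so it can cut [0, 1[ into two halves on which
    [annihilated_half] applies. *)
Lemma fourier_uniqueness_circle F : annihilated 1 F ->
  (forall t, ~ unit_itv t -> F t = 0) -> {ae lebR, forall t, F t = 0}.
Proof.
move=> aF F0.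
pose s := sgsin 1 0.
have Ms : multiplier 1 s by exact: multiplier_sgsin.
have sE1 t : 0 < t < 2^-1 -> s t = 1.
  move=> /andP[t0 t1]; rewrite /s sgsinE//; first by rewrite subr0 gtr0_sg.
  by rewrite ltr_norml; lra.
have sE2 t : 2^-1 < t < 1 -> s t = -1.
  move=> /andP[t0 t1]; rewrite /s /sgsin.
  have -> : 2 * pi * ((t - 0) / 1) = 2 * pi * (t - 1) + pi *+ 2.
    by rewrite -mulr_natl; field.
  rewrite sinD2pi sg_sin.
    by rewrite ltr0_sg// pmulr_rlt0 ?mulr_gt0 ?pi_gt0// subr_lt0.
  rewrite !normrM (gtr0_norm (@pi_gt0 R)) gtr0_norm// ltr0_norm ?subr_lt0//.
  by have := @pi_gt0 R; nra.
have s0 : s 0 = 0 by rewrite /s /sgsin subr0 mul0r mulr0 sin0 sgr0.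
have sh : s 2^-1 = 0.
  rewrite /s /sgsin; have -> : 2 * pi * ((2^-1 - 0) / 1) = pi :> R by field.
  by rewrite sinpi sgr0.
(* For [b = 1] the factor [s * (s + b)] vanishes on the second half and is 2 on the first; for
   [b = -1] the roles are exchanged. *)
have half (b : R) (c : R) : `|b| = 1 ->
    (forall t, unit_itv t -> ~ (c < t < c + 2^-1) -> s t * (s t + b) = 0) ->
    {ae lebR, forall t, F t * (s t * (s t + b))%:C%C = 0}.
  move=> b1 H; apply: (annihilated_half (c := c)).
    apply: (annihilated_eq (F := fun t => F t * (s t)%:C%C * (s t)%:C%C +
        b%:C%C * (F t * (s t)%:C%C))).
      by move=> t; rewrite !rmorphM rmorphD /=; ring.
    apply: annihilatedD; last by apply: annihilatedZ; exact: Ms.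
    by apply: (Ms); apply: (Ms).
  move=> t nt; have [tI|tI] := pselect (unit_itv t).
    by rewrite H// mulr0.
  by rewrite F0// mul0r.
have A1 : {ae lebR, forall t, F t * (s t * (s t + 1))%:C%C = 0}.
  apply: (half 1 0); first by rewrite normr1.
  move=> t; rewrite /unit_itv /= in_itv /= add0r => /andP[t0 t1] nt.
  have [->|t0'] := eqVneq t 0; first by rewrite s0 mul0r.
  have [->|th] := eqVneq t 2^-1; first by rewrite sh mul0r.
  rewrite sE2 ?addNr ?mulr0// t1 andbT ltNge; apply/negP => tle.
  by apply: nt; rewrite !lt_neqAle eq_sym t0' t0 th tle.
have A2 : {ae lebR, forall t, F t * (s t * (s t + -1))%:C%C = 0}.
  apply: (half (-1) 2^-1); first by rewrite normrN normr1.
  move=> t; rewrite /unit_itv /= in_itv /= => /andP[t0 t1] nt.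
  have [->|t0'] := eqVneq t 0; first by rewrite s0 mul0r.
  have [->|th] := eqVneq t 2^-1; first by rewrite sh mul0r.
  rewrite sE1 ?subrr ?mulr0// lt_neqAle eq_sym t0' t0 /= ltNge; apply/negP => tle.
  by apply: nt; rewrite lt_neqAle eq_sym th tle /=; lra.
apply: (ae_mono2 (ae_mono2 A1 A2 (fun t a b => conj a b))
  (ae_mono2 (ae_neq 0) (ae_neq 2^-1) (fun t a b => conj a b))).
move=> t [B1 B2] [t0 th]; have [tI|/F0//] := pselect (unit_itv t).
have : s t = 1 \/ s t = -1.
  move: tI; rewrite /unit_itv /= in_itv /= => /andP[u0 u1].
  have [tle|tle] := ltP t 2^-1.
    by left; apply: sE1; rewrite tle andbT lt_neqAle u0 eq_sym; case: eqP t0.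
  by right; apply: sE2; rewrite u1 andbT lt_neqAle tle eq_sym; case: eqP th.
have two : ((1 + 1 : R)%:C%C == 0) = false.
  by rewrite eq_complex /= (_ : (1 + 1 : R) == 0 = false)// gt_eqF// addr_gt0.
case=> E; [move: B1|move: B2]; rewrite E.
- by rewrite mul1r => /eqP; rewrite mulf_eq0 two orbF => /eqP.
- rewrite mulN1r opprD opprK => /eqP.
  by rewrite mulf_eq0 two orbF => /eqP.
Qed.

End exponential.

(** * The shift on l^2(Z; C^n) *)

Section sequences_on_int.
Context {R : realType}.
Local Notation cnt := (cntZ R).

Section windows.
Variable phi : int -> R.
Hypothesis phi0 : forall m, 0 <= phi m.

Definition window (J : nat) : set int := [set m | - J%:Z <= m <= J%:Z].

Definition window_sum (J : nat) : R := \sum_(j < J.*2.+1) phi (j%:Z - J%:Z).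

Lemma integral_set1_int (m : int) :
  (\int[cnt]_(j in [set m]) (phi j)%:E = (phi m)%:E)%E.
Proof.
rewrite (eq_integral (cst (phi m)%:E)); last by move=> j /set_mem ->.
by rewrite integral_cst// [X in (_ * X)%E](cntZ_set1 R m) mule1.
Qed.

Lemma integral_window J : (\int[cnt]_(m in window J) (phi m)%:E = (window_sum J)%:E)%E.
Proof.
have E : window J = \big[setU/set0]_(j <- index_enum 'I_(J.*2.+1)) [set (j%:Z - J%:Z)].
  apply/seteqP; split => m.
    rewrite /window /= => mJ.
    have lt : (absz (m + J%:Z)%R < J.*2.+1)%N by lia.
    rewrite -bigcup_seq /=; exists (Ordinal lt) => /=; first by rewrite mem_index_enum.
    by lia.
  rewrite -bigcup_seq /= => -[j _ ->]; rewrite /window /=.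
  by have := ltn_ord j; lia.
rewrite E ge0_integral_bigsetU//.
- rewrite /window_sum -sumEFin; apply: eq_bigr => j _.
  exact: integral_set1_int.
- exact: index_enum_uniq.
- move=> i j _ _ [m [/= -> /eqP]]; rewrite (inj_eq (addIr _)) eqz_nat => /eqP ij.
  exact: val_inj.
- by move=> m _; rewrite lee_fin.
Qed.

Lemma window_sum_le J : ((window_sum J)%:E <= \int[cnt]_m (phi m)%:E)%E.
Proof.
rewrite -integral_window; apply: ge0_subset_integral => //.
by move=> m _; rewrite lee_fin.
Qed.

Lemma window_sum_cvg : (window_sum J)%:E @[J --> \oo] --> (\int[cnt]_m (phi m)%:E)%E.
Proof.
have -> : (fun J => (window_sum J)%:E) =
    (fun J => \int[cnt]_(m in window J) (phi m)%:E)%E.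
  by apply/funext => J; rewrite integral_window.
have <- : \bigcup_i window i = setT.
  by apply/seteqP; split => // m _; exists `|m|%N => //; rewrite /window /=; lia.
apply: ge0_nondecreasing_set_cvg_integral => //.
- by move=> i j ij; rewrite subsetEset /window => m /=; lia.
- by move=> i m _; rewrite lee_fin.
Qed.

Lemma window_sum_bound M : (forall J, window_sum J <= M) ->
  (\int[cnt]_m (phi m)%:E <= M%:E)%E.
Proof.
move=> bM; apply: (cvge_to_le window_sum_cvg).
by apply: nearW => J; rewrite lee_fin.
Qed.

Lemma window_sum_approx (eps : R) : (\int[cnt]_m (phi m)%:E < +oo)%E -> 0 < eps ->
  exists J0 : nat, forall J, (J0 <= J)%N ->
    fine (\int[cnt]_m (phi m)%:E) - eps <= window_sum J.
Proof.
move=> fin e0.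
have F : (\int[cnt]_m (phi m)%:E)%E \is a fin_num.
  by rewrite ge0_fin_numE//; apply: integral_ge0 => m _; rewrite lee_fin.
have := window_sum_cvg; rewrite -(fineK F) => /fine_cvgP[_].
move=> /cvgrPdist_le /(_ _ e0) [J0 _ H]; exists J0 => J /H /=.
by rewrite ler_distl => /andP[_]; rewrite lerBlDr.
Qed.

Lemma le_integral_int (m : int) : ((phi m)%:E <= \int[cnt]_m (phi m)%:E)%E.
Proof.
rewrite -integral_set1_int; apply: ge0_subset_integral => //.
by move=> j _; rewrite lee_fin.
Qed.

End windows.

Variable n : nat.

(** All families, square summable or not; [in_l2] singles out the Hilbert space. *)
Definition l2 : Type := 'I_n -> int -> R[i]^o.
HB.instance Definition _ := GRing.Lmodule.on l2.

Implicit Types u v w : l2.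

Definition in_l2 u : Prop := forall k, sqint cnt (u k).

Definition l2dot u v : R[i] := \sum_k cI cnt (fun m => u k m * (v k m)^*).

Definition l2shift (j : int) u : l2 := fun k m => u k (m + j).

Definition l2delta (k : 'I_n) : l2 := fun k' m => ((k' == k) && (m == 0))%:R.

Lemma sqn_conj (z : R[i]) : z * z^* = (sqn z)%:C%C.
Proof.
case: z => x y; apply/eqP; rewrite eq_complex /sqn /=.
by apply/andP; split; apply/eqP; ring.
Qed.

Lemma Re_sum (I : Type) (s : seq I) (z : I -> R[i]) :
  complex.Re (\sum_(i <- s) z i) = \sum_(i <- s) complex.Re (z i).
Proof. by elim: s => [|i s ih]; rewrite ?big_nil// !big_cons ReD ih. Qed.

Lemma l2nrmE u : nrm l2dot u =
  \sum_k fine (\int[cnt]_m (sqn (u k m))%:E)%E.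
Proof.
rewrite /nrm /l2dot Re_sum; apply: eq_bigr => k _.
rewrite /cI /= /Rintegral; congr fine; apply: eq_integral => m _.
by rewrite sqn_conj.
Qed.

Lemma l2_fin u k : in_l2 u -> (\int[cnt]_m (sqn (u k m))%:E)%E \is a fin_num.
Proof.
move=> Lu; rewrite ge0_fin_numE; first exact: (Lu k).2.
by apply: integral_ge0 => m _; rewrite lee_fin sqn_ge0.
Qed.

Lemma l2nrm_ge0 u : 0 <= nrm l2dot u.
Proof.
rewrite l2nrmE sumr_ge0// => k _; apply: fine_ge0.
by apply: integral_ge0 => m _; rewrite lee_fin sqn_ge0.
Qed.

Lemma fine_le_l2nrm u k : fine (\int[cnt]_m (sqn (u k m))%:E)%E <= nrm l2dot u.
Proof.
rewrite l2nrmE (bigD1 k)//= lerDl sumr_ge0// => j _; apply: fine_ge0.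
by apply: integral_ge0 => m _; rewrite lee_fin sqn_ge0.
Qed.

Lemma sqn_le_l2nrm u k m : in_l2 u -> sqn (u k m) <= nrm l2dot u.
Proof.
move=> Lu; apply: le_trans (fine_le_l2nrm u k).
rewrite -lee_fin fineK; last exact: l2_fin.
by apply: (@le_integral_int (fun m => sqn (u k m))) => j; exact: sqn_ge0.
Qed.

Lemma in_l2P (a : R[i]) u v : in_l2 u -> in_l2 v -> in_l2 (a *: u + v).
Proof.
by move=> Lu Lv k; apply: sqintD; [exact: (sqintZ a (Lu k))|exact: Lv].
Qed.

Lemma in_l20 : in_l2 0.
Proof.
move=> k; split => //.
under eq_integral do rewrite /sqn /= expr0n addr0.
by rewrite integral0.
Qed.

Lemma l2dotP (a : R[i]) u v w : in_l2 u -> in_l2 v -> in_l2 w ->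
  l2dot (a *: u + v) w = a * l2dot u w + l2dot v w.
Proof.
move=> Lu Lv Lw; rewrite /l2dot mulr_sumr -big_split /=; apply: eq_bigr => k _.
rewrite -cIZ; last exact: sqint_mul_conj.
rewrite -cID; [|by apply: cintegrableZ; exact: sqint_mul_conj|exact: sqint_mul_conj].
by apply: cI_eq => m; rewrite mulrA -mulrDl.
Qed.

Lemma l2dotC u v : in_l2 u -> in_l2 v -> l2dot v u = (l2dot u v)^*.
Proof.
move=> Lu Lv; rewrite /l2dot rmorph_sum /=; apply: eq_bigr => k _.
rewrite -cI_conj; last exact: sqint_mul_conj.
by apply: cI_eq => m; rewrite rmorphM /= conjCK mulrC.
Qed.

Lemma in_l2B u v : in_l2 u -> in_l2 v -> in_l2 (u - v).
Proof. by move=> Lu Lv; rewrite addrC -scaleN1r; exact: in_l2P. Qed.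

Lemma cvg_finite_sum (I : Type) (s : seq I) (f : I -> nat -> R) (l : I -> R) :
  (forall i, f i q @[q --> \oo] --> l i) ->
  \sum_(i <- s) f i q @[q --> \oo] --> \sum_(i <- s) l i.
Proof.
move=> fl; elim: s => [|i s ih].
  by under eq_fun do rewrite big_nil; rewrite big_nil; exact: cvg_cst.
by under eq_fun do rewrite big_cons; rewrite big_cons; exact: cvgD.
Qed.

(** Coordinates converge, and the tail estimate follows as in Fatou's lemma: on a finite window [q]
    tends to infinity in a finite sum, and the resulting bound does not depend on the window. *)
Lemma l2_complete (u : nat -> l2) : (forall i, in_l2 (u i)) ->
  (forall eps : R, 0 < eps -> exists N : nat, forall p q,
     (N <= p)%N -> (N <= q)%N -> nrm l2dot (u p - u q) < eps) ->
  exists2 l, in_l2 l & norm_cvg l2dot u l.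
Proof.
move=> Lu cau.
have cvgc (f : nat -> R) : (forall eps : R, 0 < eps -> exists N : nat,
    forall p q, (N <= p)%N -> (N <= q)%N -> (f p - f q) ^+ 2 < eps) ->
    exists l : R, f p @[p --> \oo] --> l.
  move=> H; apply/cvg_ex; apply: cauchy_cvg; apply: cauchy_exP => eps e0.
  have [N HN] := H (eps ^+ 2) (exprn_gt0 2 e0).
  exists (f N); exists N => // p Np.
  rewrite -ball_normE /=; have := HN N p (leqnn N) Np.
  by rewrite -[(f N - f p) ^+ 2]real_normK ?num_real// ltr_sqr ?nnegrE ?(ltW e0).
have [l Hl] : exists l : l2, forall k m,
    complex.Re (u p k m) @[p --> \oo] --> complex.Re (l k m) /\
    complex.Im (u p k m) @[p --> \oo] --> complex.Im (l k m).
  have Hz (k : 'I_n) (m : int) : exists z : R[i], complex.Re (u p k m) @[p --> \oo] --> complex.Re z /\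
      complex.Im (u p k m) @[p --> \oo] --> complex.Im z.
    have b p q : sqn (u p k m - u q k m) <= nrm l2dot (u p - u q).
      by apply: (@sqn_le_l2nrm (u p - u q)); exact: in_l2B.
    have [x Hx] : exists x : R, complex.Re (u p k m) @[p --> \oo] --> x.
      apply: cvgc => eps /cau [N HN]; exists N => p q Np Nq.
      apply: le_lt_trans (HN p q Np Nq); apply: le_trans (b p q).
      by rewrite /sqn ReD ReN lerDl sqr_ge0.
    have [y Hy] : exists y : R, complex.Im (u p k m) @[p --> \oo] --> y.
      apply: cvgc => eps /cau [N HN]; exists N => p q Np Nq.
      apply: le_lt_trans (HN p q Np Nq); apply: le_trans (b p q).
      by rewrite /sqn ImD ImN lerDr sqr_ge0.
    by exists (Complex x y).
  have /choice[l Hl] := fun km : 'I_n * int => Hz km.1 km.2.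
  by exists (fun k m => l (k, m)) => k m; exact: (Hl (k, m)).
have bound (eps : R) : 0 < eps -> exists N : nat, forall p, (N <= p)%N -> forall k,
    (\int[cnt]_m (sqn (u p k m - l k m))%:E <= eps%:E)%E.
  move=> /cau [N HN]; exists N => p Np k.
  apply: window_sum_bound => [m|J]; first exact: sqn_ge0.
  have cv : window_sum (fun m => sqn (u p k m - u q k m)) J @[q --> \oo] -->
      window_sum (fun m => sqn (u p k m - l k m)) J.
    apply: cvg_finite_sum => j; have [cRe cIm] := Hl k (j%:Z - J%:Z).
    rewrite /sqn !ReD !ImD !ReN !ImN.
    under eq_fun do rewrite !ReD !ImD !ReN !ImN.
    by apply: cvgD; rewrite expr2; under eq_fun do rewrite expr2;
      apply: cvgM; apply: cvgB => //; exact: cvg_cst.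
  apply: (cvgr_to_le cv); exists N => // q Nq /=.
  apply: ltW; apply: le_lt_trans (HN p q Np Nq).
  apply: le_trans (fine_le_l2nrm (u p - u q) k).
  rewrite -lee_fin fineK; last by apply: l2_fin; exact: in_l2B.
  by apply: window_sum_le => m; exact: sqn_ge0.
have Ldiff p : (forall k, (\int[cnt]_m (sqn (u p k m - l k m))%:E < +oo)%E) ->
    in_l2 (u p - l) by move=> H k; split => //; exact: H.
exists l.
  have [N HN] := bound 1 ltr01.
  have -> : l = u N - (u N - l) by rewrite opprB addrCA subrr addr0.
  apply: in_l2B => //; apply: Ldiff => k.
  by apply: le_lt_trans (HN N (leqnn N) k) _; rewrite ltry.
move=> eps e0.
have e1 : 0 < eps / n.+1%:R by rewrite divr_gt0// ltr0Sn.
have [N HN] := bound _ e1; exists N => p Np.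
have Lp : in_l2 (u p - l).
  by apply: Ldiff => k; apply: le_lt_trans (HN p Np k) _; rewrite ltry.
rewrite l2nrmE; apply: (@le_lt_trans _ _ (\sum_(k < n) eps / n.+1%:R)).
  apply: ler_sum => k _; rewrite -lee_fin fineK; last exact: l2_fin.
  exact: HN.
rewrite sumr_const card_ord -(mulr_natr (eps / n.+1%:R)) -mulrA gtr_pMr// mulrC.
by rewrite ltr_pdivrMr ?ltr0Sn// mul1r ltr_nat.
Qed.

Lemma in_l2_shift j u : in_l2 u -> in_l2 (l2shift j u).
Proof.
by move=> Lu k; exact: (sqint_preserves (cntZ_preserves R j) (Lu k)).
Qed.

Lemma l2dot_shift j u v : l2dot (l2shift j u) (l2shift j v) = l2dot u v.
Proof.
rewrite /l2dot; apply: eq_bigr => k _.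
exact: (cI_preserves (cntZ_preserves R j) (h := fun m => u k m * (v k m)^*)).
Qed.

Lemma l2dot_deltal k w : l2dot (l2delta k) w = (w k 0)^*.
Proof.
rewrite /l2dot (bigD1 k)//= big1 ?addr0; last first.
  move=> k' k'k; rewrite -[RHS](cI0 cnt); apply: cI_eq => m.
  by rewrite /l2delta (negbTE k'k) mul0r.
have H (f : int -> R) : Rintegral cnt setT (fun m => f m * (m == 0)%:R) = f 0.
  rewrite /Rintegral; transitivity (fine (\int[cnt]_(m in [set 0%R]) (f m)%:E)%E).
    congr fine; rewrite [RHS]integral_mkcond; apply: eq_integral => m _.
    rewrite patchE; have [->|m0] := eqVneq m 0; first by rewrite mem_set// mulr1.
    by rewrite mulr0 memNset//; exact/eqP.
  rewrite (eq_integral (cst (f 0)%:E)); last by move=> j /set_mem ->.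
  by rewrite integral_cst// [X in (_ * X)%E](cntZ_set1 R 0) mule1.
rewrite /cI /l2delta eqxx /=.
transitivity (Complex (complex.Re ((w k 0)^*)) (complex.Im ((w k 0)^*))); last by case: (_^*).
congr Complex.
- rewrite -(H (fun m => complex.Re ((w k m)^*))); apply: eq_Rintegral => m _.
  by case: (m == 0); rewrite ?mul1r ?mulr1// mul0r mulr0.
- rewrite -(H (fun m => complex.Im ((w k m)^*))); apply: eq_Rintegral => m _.
  by case: (m == 0); rewrite ?mul1r ?mulr1// mul0r mulr0.
Qed.

Lemma in_l2_delta k : in_l2 (l2delta k).
Proof.
move=> k'; split => //.
apply: (@le_lt_trans _ _ 1%E); last by rewrite ltry.
apply: window_sum_bound => [m|J]; first exact: sqn_ge0.
have J2 : (J < J.*2.+1)%N by lia.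
rewrite /window_sum (bigD1 (Ordinal J2))//= big1 ?addr0.
  by rewrite /l2delta subrr eqxx andbT; case: (k' == k);
    rewrite /sqn /= ?expr1n ?expr0n ?addr0 ?ler01.
move=> j jJ; rewrite /l2delta subr_eq0 eqz_nat.
have -> : ((j : nat) == J) = false.
  by apply/negbTE; apply: contra jJ => /eqP E; apply/eqP/val_inj.
by rewrite andbF /sqn /= expr0n addr0.
Qed.

Lemma triangular_correlations (N : nat) (A B : 'I_N -> l2) :
  (forall i, in_l2 (A i)) -> (forall i, in_l2 (B i)) ->
  (forall (i c : 'I_N) (j : int), 0 < j \/ (j = 0 /\ (i < c)%N) ->
    l2dot (A i) (l2shift j (B c)) = 0) ->
  (forall i, l2dot (A i) (B i) != 0) ->
  (N <= n)%N.
Proof.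
move=> LA LB H Hd.
apply: (@wandering_dimension R l2 in_l2 l2dot in_l2P in_l20 l2dotP l2dotC
  (fun u _ => l2nrm_ge0 u) l2_complete l2shift _ _ _ _ N n A B l2delta) => //.
- exact: in_l2_shift.
- move=> j l u; apply/funext => k; apply/funext => m.
  by rewrite /l2shift addrA.
- by move=> u; apply/funext => k; apply/funext => m; rewrite /l2shift addr0.
- by move=> j u v _ _; exact: l2dot_shift.
- exact: in_l2_delta.
- by move=> k; rewrite /nrm l2dot_deltal /l2delta !eqxx.
- move=> w Lw eps e0.
  have e1 : 0 < eps / n.+1%:R by rewrite divr_gt0// ltr0Sn.
  have /choice[J0 HJ0] : forall k, exists J0 : nat, forall J, (J0 <= J)%N ->
      fine (\int[cnt]_m (sqn (w k m))%:E)%E - eps / n.+1%:R <=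
      window_sum (fun m => sqn (w k m)) J.
    move=> k; apply: window_sum_approx => // [m|]; first exact: sqn_ge0.
    exact: (Lw k).2.
  exists (\max_k J0 k) => J mJ; rewrite l2nrmE.
  apply: (@le_trans _ _ (\sum_(k < n) (fine (\int[cnt]_m (sqn (w k m))%:E)%E -
      eps / n.+1%:R))).
    rewrite big_split /= lerD2l sumr_const card_ord mulNrn.
    rewrite lerNl opprK -(mulr_natr (eps / n.+1%:R)) -mulrA ger_pMr// mulrC.
    by rewrite ler_pdivrMr ?ltr0Sn// mul1r ler_nat.
  apply: ler_sum => k _; apply: le_trans (HJ0 k J _) _.
    by apply: leq_trans mJ; exact: leq_bigmax.
  apply: ler_sum => j _; rewrite l2dot_deltal /l2shift add0r.
  by rewrite /sqn ReJ ImJ sqrrN.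
Qed.

End sequences_on_int.

(** * Correlations along orbits of the integers *)

Section trigonometric_polynomials.
Context {R : realType}.
Local Notation lebR := (@lebesgue_measure R).
Local Notation cnt := (cntZ R).

Lemma measure_unit_itv : lebR (@unit_itv R) = 1%E.
Proof.
rewrite /unit_itv; have := @lebesgue_measure_itv R `[0, 1[ => /= ->.
by rewrite lte_fin ltr01 sube0.
Qed.

Lemma cintegrable_ind_ex (phi : R -> R) : measurable_fun setT phi ->
  cintegrable lebR (fun t => ind t * ex (phi t)).
Proof.
move=> mphi; apply: cintegrableM_ex => //.
apply: cintegrableP; first exact: cmeas_ind.
under eq_integral do rewrite n1_ind.
rewrite integral_indic ?setIT//; last exact: measurable_unit_itv.
by rewrite [X in (X < _)%E]measure_unit_itv ltry.
Qed.

Lemma integral_ind_orbit (t : R) :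
  (\int[cnt]_m (\1_(@unit_itv R) (t + m%:~R)%R)%:E = 1)%E.
Proof.
transitivity (\int[cnt]_m (\1_[set - Num.floor t] m : R)%:E)%E.
  apply: eq_integral => m _; congr (_%:E); rewrite !indicE; congr ((nat_of_bool _)%:R).
  apply/idP/idP; rewrite !inE.
    have -> : t + m%:~R = t - (- m)%:~R by rewrite intrN opprK.
    by move/unit_itv_floor => <-; rewrite opprK.
  move=> /= ->; rewrite intrN; exact/unit_itv_floor.
by rewrite integral_indic// setIT; exact: cntZ_set1.
Qed.

Lemma cintegrable_ind_orbit (t : R) : cintegrable cnt (fun m => ind (t + m%:~R)).
Proof.
apply: cintegrableP; first exact: cmeas_int.
by under eq_integral do rewrite n1_ind; rewrite integral_ind_orbit ltry.
Qed.

Lemma cI_ind_orbit (t : R) : cI cnt (fun m => ind (t + m%:~R)) = 1.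
Proof. by rewrite /cI /Rintegral /= integral_ind_orbit integral0. Qed.

Lemma cI_ind : cI lebR ind = 1.
Proof.
rewrite /cI /Rintegral /= integral0 integral_indic//; last exact: measurable_unit_itv.
by rewrite setIT [X in fine X]measure_unit_itv.
Qed.

Lemma ex_half : ex (2^-1 : R) = -1.
Proof.
rewrite /ex /expi; have -> : 2 * pi * 2^-1 = pi :> R by field.
by rewrite cospi sinpi; apply/eqP; rewrite eq_complex /= oppr0 !eqxx.
Qed.

Lemma mfreq1 (l : int) : measurable_fun setT (fun t : R => l%:~R * t).
Proof. exact: measurable_funM. Qed.

(* Translating by half a period of [ex (l t)] changes the sign of the integral,
   while the integral over a period is translation invariant. *)
Lemma ex_orthogonal (l : int) :
  cI lebR (fun t => ind t * ex (l%:~R * t)) = (l == 0)%:R.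
Proof.
have [->|l0] := eqVneq l 0.
  rewrite -[RHS]cI_ind; apply: cI_eq => t; by rewrite mul0r ex0 mulr1.
have l1 : (l%:~R : R) != 0 by rewrite intr_eq0.
pose a : R := (2 * l%:~R)^-1.
set I := cI _ _.
have mh : cmeas (fun t : R => ind t * ex (l%:~R * t)).
  exact: cintegrable_cmeas (cintegrable_ind_ex (mfreq1 l)).
have E1 : I = ex (l%:~R * a) * cI lebR (fun t => ind (t + a) * ex (l%:~R * t)).
  rewrite /I -(cI_preserves (preserves_shift a) mh).
  have ii := cintegrable_preserves (preserves_shift a)
    (cintegrable_ind_ex (measurable_cst (0 : R))).
  rewrite -cIZ.
    by apply: cI_eq => t; rewrite mulrDr exD; ring.
  apply: (cintegrableM_ex (mfreq1 l)).
  have -> : (fun t : R => ind (t + a)) = (fun t => ind (t + a) * ex 0).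
    by apply/funext => t; rewrite ex0 mulr1.
  exact: ii.
have E2 : cI lebR (fun t => ind (t + a) * ex (l%:~R * t)) = I.
  have ii : cintegrable lebR (fun t => ind (t + a) * ex (l%:~R * t)).
    apply: (cintegrableM_ex (mfreq1 l)).
    have -> : (fun t : R => ind (t + a)) = (fun t => ind (t + a) * ex 0).
      by apply/funext => t; rewrite ex0 mulr1.
    exact: (cintegrable_preserves (preserves_shift a)
      (cintegrable_ind_ex (measurable_cst (0 : R)))).
  rewrite (cI_periodize ii).2; apply: cI_eq => t; congr (_ * _).
  transitivity (cI cnt (fun m => ex (l%:~R * t) * ind (t + a + m%:~R))).
    apply: cI_eq => m; rewrite mulrDr exD -intrM ex_int mulr1 mulrC.
    by congr (_ * ind _); rewrite addrAC.
  rewrite cIZ ?cI_ind_orbit ?mulr1//.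
  exact: cintegrable_ind_orbit.
move: E1; rewrite E2.
have -> : l%:~R * a = 2^-1 by rewrite /a; field.
rewrite ex_half mulN1r => /eqP; rewrite -addr_eq0 -mulr2n.
by rewrite mulrn_eq0 /= => /eqP.
Qed.

Lemma ex_inj (t t' : R) : unit_itv t -> unit_itv t' -> ex t = ex t' -> t = t'.
Proof.
have H (u v : R) : unit_itv u -> unit_itv v -> u < v -> ex u <> ex v.
  rewrite /unit_itv /= !in_itv /= => /andP[u0 u1] /andP[v0 v1] uv E.
  have : ex (v - u) = 1.
    by rewrite exD exN -E -exN -exD subrr ex0.
  rewrite /ex /expi => /eqP; rewrite eq_complex /= => /andP[/eqP c1 _].
  have : cos (pi * (v - u) *+ 2) = 1.
    by rewrite -[RHS]c1; congr cos; rewrite -mulr_natl mulrA.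
  rewrite cos_mulr2n => c2.
  have s0 : sin (pi * (v - u)) ^+ 2 = 0 by rewrite sin2cos2; lra.
  have : 0 < sin (pi * (v - u)).
    apply: sin_gt0_pi; rewrite mulr_gt0 ?pi_gt0 ?subr_gt0//=.
    by rewrite gtr_pMr ?pi_gt0//; lra.
  by move/eqP: s0; rewrite sqrf_eq0 => /eqP ->; rewrite ltxx.
move=> ut ut' E; have [lt|lt|//] := ltgtP t t'.
  by have := H _ _ ut ut' lt.
by have := H _ _ ut' ut lt; rewrite E.
Qed.

(** Up to the unimodular factor [ex (M%:R * t)], the sum is a nonzero polynomial in [ex t]. It has
    finitely many roots, and each is a value of [ex] at most once on [0, 1[. *)
Lemma trig_poly_ae_neq0 (s : seq int) (c : int -> R[i]) : uniq s ->
  (exists2 j, j \in s & c j != 0) ->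
  {ae lebR, forall t, \sum_(j <- s) c j * ex (j%:~R * t) != 0}.
Proof.
move=> us [j0 j0s cj0].
(* The sum dominates every [|j|], so all exponents [j + M] are nonnegative. *)
pose M : nat := (\sum_(j <- s) `|j|)%N.
have jM j : j \in s -> 0 <= j + M%:Z.
  move=> js; have : (`|j| <= M)%N.
    by rewrite /M (big_rem j)//= leq_addr.
  by lia.
pose p : {poly R[i]} := \sum_(j <- s) c j *: 'X^(absz (j + M%:Z)).
have exX (t : R) (k : nat) : ex t ^+ k = ex (k%:R * t).
  elim: k => [|k ih]; first by rewrite expr0 mul0r ex0.
  by rewrite exprS ih -exD -natr1 mulrDl mul1r addrC.
have pE t : p.[ex t] = ex (M%:R * t) * \sum_(j <- s) c j * ex (j%:~R * t).
  rewrite /p horner_sum mulr_sumr; apply: eq_big_seq => j js.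
  rewrite hornerZ hornerXn exX [RHS]mulrCA; congr (_ * _).
  rewrite -exD -mulrDl; congr (ex (_ * t)).
  have -> : (absz (j + M%:Z))%:R = (j + M%:Z)%:~R :> R.
    by rewrite -{2}[j + M%:Z]gez0_abs ?jM.
  by rewrite intrD addrC.
have p0 : p != 0.
  apply/negP => /eqP pz; have : p`_(absz (j0 + M%:Z)) = 0 by rewrite pz coef0.
  rewrite /p coef_sum (big_rem j0)//= coefZ coefXn eqxx mulr1 big_seq big1.
    by rewrite addr0 => cz; rewrite cz eqxx in cj0.
  move=> j; rewrite mem_rem_uniq// inE => /andP[jj0 js].
  rewrite coefZ coefXn; have -> : (absz (j0 + M%:Z) == absz (j + M%:Z)) = false.
    have := jM _ js; have := jM _ j0s; move/eqP: jj0; lia.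
  by rewrite mulr0.
have [rs Hrs] := closed_field_poly_normal p.
have aers (z : R[i]) : {ae lebR, forall t, unit_itv t -> ex t <> z}.
  have [[t0 [It0 Et0]]|nz] := pselect (exists t0, unit_itv t0 /\ ex t0 = z).
    apply: (ae_mono (ae_neq t0)) => t tt0 It Et; apply: tt0.
    by apply: ex_inj => //; rewrite Et0.
  by apply: aeW => t It Et; apply: nz; exists t.
have aeall : {ae lebR, forall t, unit_itv t -> forall z, z \in rs -> ex t <> z}.
  elim: (rs) => [|z l ih]; first by apply: aeW.
  apply: (ae_mono2 (aers z) ih) => t H1 H2 It w; rewrite inE => /orP[/eqP ->|].
    exact: H1.
  exact: H2.
apply: ae_periodic => [t m|].
  congr (is_true (_ != 0)); apply: eq_bigr => j _; congr (_ * _).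
  by rewrite mulrDr exD -intrM ex_int mulr1.
apply: (ae_mono aeall) => t H It; apply/negP => /eqP Q0.
have : root p (ex t) by rewrite /root pE Q0 mulr0.
rewrite Hrs rootZ ?lead_coef_eq0// root_prod_XsubC => /H; exact.
Qed.

End trigonometric_polynomials.

(** * Orbit correlations and their Fourier coefficients *)

Section correlations.
Context {R : realType}.
Local Notation lebR := (@lebesgue_measure R).
Local Notation cnt := (cntZ R).
Variables (n : nat) (f g : 'I_n -> R -> R[i]).
Hypothesis Lf : forall k, sqint lebR (f k).
Hypothesis Lg : forall k, sqint lebR (g k).

Definition corr (x t : R) : R[i] := \sum_k f k t * (g k (t + x))^*.

Definition orbit_vec (h : 'I_n -> R -> R[i]) (t : R) : l2 n :=
  fun k m => h k (t + m%:~R).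

Definition orbit_dot (t s : R) : R[i] := l2dot (orbit_vec f t) (orbit_vec g s).

Definition corr_ft (x y : R) : R[i] :=
  cI lebR (fun t => corr x t * ex (- (y * t))).

(** After unfolding, the Fourier coefficients of the periodic function [orbit_dot t (t + x)] of
    [t]. *)
Definition corr_coef (x : R) (l : int) : R[i] := corr_ft x l%:~R.

Lemma orbit_vec_shift h t (j : int) :
  orbit_vec h (t + j%:~R) = l2shift j (orbit_vec h t).
Proof.
apply/funext => k; apply/funext => m; rewrite /orbit_vec /l2shift.
by rewrite intrD (addrC m%:~R) addrA.
Qed.

Lemma orbit_dot_shift t s (j : int) : orbit_dot (t + j%:~R) (s + j%:~R) = orbit_dot t s.
Proof. by rewrite /orbit_dot !orbit_vec_shift l2dot_shift. Qed.

Lemma cintegrable_corr x : cintegrable lebR (corr x).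
Proof.
rewrite /corr; apply: cintegrable_sum => k; apply: sqint_mul_conj => //.
exact: (sqint_preserves (preserves_shift x) (Lg k)).
Qed.

Lemma ae_orbit_in_l2 (h : 'I_n -> R -> R[i]) : (forall k, sqint lebR (h k)) ->
  {ae lebR, forall t, in_l2 (orbit_vec h t)}.
Proof.
move=> Lh; rewrite /in_l2 /orbit_vec.
have : forall s : seq 'I_n, {ae lebR, forall t, forall k, k \in s ->
    sqint cnt (fun m => h k (t + m%:~R))}.
  elim=> [|k s ih]; first by apply: aeW.
  apply: (ae_mono2 (ae_periodize_sqint (Lh k)) ih) => t H1 H2 k'.
  by rewrite inE => /orP[/eqP ->|/H2].
move=> /(_ (enum 'I_n)) H; apply: (ae_mono H) => t Ht k.
by apply: Ht; rewrite mem_enum.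
Qed.

Lemma cI_corr_orbit x t : in_l2 (orbit_vec f t) -> in_l2 (orbit_vec g (t + x)) ->
  cI cnt (fun m => corr x (t + m%:~R)) = orbit_dot t (t + x).
Proof.
move=> Lft Lgt; rewrite /orbit_dot /l2dot -cI_sum; last first.
  by move=> k; exact: sqint_mul_conj.
apply: cI_eq => m; rewrite /corr /orbit_vec; apply: eq_bigr => k _.
by rewrite addrAC.
Qed.

Lemma ae_cI_corr_orbit x :
  {ae lebR, forall t, cI cnt (fun m => corr x (t + m%:~R)) = orbit_dot t (t + x)}.
Proof.
apply: (ae_mono2 (ae_orbit_in_l2 Lf)
  (ae_preserves (preserves_shift x) (ae_orbit_in_l2 Lg))) => t H1 H2.
exact: cI_corr_orbit.
Qed.

Lemma cmeas_orbit_dot : cmeas (fun z : R * R => orbit_dot z.1 z.2).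
Proof.
rewrite /orbit_dot /l2dot; apply: cmeas_sum => k.
apply: (cmeas_cI cnt (h := fun w : (R * R) * int =>
  f k (w.1.1 + w.2%:~R) * (g k (w.1.2 + w.2%:~R))^*)).
have [mf _] := Lf k; have [mg _] := Lg k.
have H (p : (R * R) * int -> R) : measurable_fun setT p ->
    measurable_fun setT (fun w : (R * R) * int => p w + w.2%:~R).
  move=> mp; apply: measurable_funD => //.
  by apply: (measurableT_comp (f := fun m : int => m%:~R : R));
    [exact: measurable_fun_int|exact: measurable_snd].
apply: cmeasM.
  apply: (cmeas_comp mf); apply: H.
  exact: (measurableT_comp measurable_fst measurable_fst).
apply: cmeas_conj; apply: (cmeas_comp mg); apply: H.
exact: (measurableT_comp measurable_snd measurable_fst).
Qed.

Lemma cmeas_corr : cmeas (fun z : R * R => corr z.1 z.2).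
Proof.
rewrite /corr; apply: cmeas_sum => k.
have [mf _] := Lf k; have [mg _] := Lg k.
apply: cmeasM; first exact: (cmeas_comp mf measurable_snd).
apply: cmeas_conj; apply: (cmeas_comp mg); apply: measurable_funD.
  exact: measurable_snd.
exact: measurable_fst.
Qed.

Lemma cmeas_corr_ft : cmeas (fun z : R * R => corr_ft z.1 z.2).
Proof.
rewrite /corr_ft.
apply: (cmeas_cI lebR (h := fun w : (R * R) * R =>
  corr w.1.1 w.2 * ex (- (w.1.2 * w.2)))).
apply: cmeasM.
  apply: (cmeas_comp cmeas_corr (phi := fun w : (R * R) * R => (w.1.1, w.2))).
  apply: measurable_fun_pair; last exact: measurable_snd.
  exact: (measurableT_comp measurable_fst measurable_fst).
apply: cmeas_ex; apply: measurable_funN; apply: measurable_funM.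
  exact: (measurableT_comp measurable_snd measurable_fst).
exact: measurable_snd.
Qed.

Lemma cmeas_corr_coef : cmeas (fun z : R * int => corr_coef z.1 z.2).
Proof.
apply: (cmeas_comp (h := fun z : R * R => corr_ft z.1 z.2)
  (phi := fun z : R * int => (z.1, z.2%:~R)) cmeas_corr_ft).
apply: measurable_fun_pair; first exact: measurable_fst.
apply: (measurableT_comp (f := fun m : int => m%:~R : R)).
  exact: measurable_fun_int.
exact: measurable_snd.
Qed.

(** The periodization of [corr x] minus the candidate polynomial has all Fourier coefficients zero
    on the circle, so it vanishes almost everywhere. *)
Lemma orbit_dot_trig_poly x : finite_set [set l | corr_coef x l != 0] ->
  exists s : seq int, [/\ uniq s, (forall l, l \in s <-> corr_coef x l != 0) &
  {ae lebR, forall t, orbit_dot t (t + x) = \sum_(j <- s) corr_coef x j * ex (j%:~R * t)}].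
Proof.
move=> /finite_fsetP[S SE]; pose s : seq int := finmap.enum_fset S.
have us : uniq s by exact: finmap.fset_uniq.
have ms l : l \in s <-> corr_coef x l != 0.
  have -> : (corr_coef x l != 0) = ([set l | corr_coef x l != 0] l) :> Prop by [].
  by rewrite SE.
exists s; split => //.
pose Q t := \sum_(j <- s) corr_coef x j * ex (j%:~R * t).
pose P t := cI cnt (fun m => corr x (t + m%:~R)).
have ic := cintegrable_corr x.
have [iP _] := cI_periodize ic.
have iQ j : cintegrable lebR (fun t => ind t * ex (j%:~R * t)).
  exact: cintegrable_ind_ex (mfreq1 j).
have iQs : cintegrable lebR (fun t => \sum_(j <- s) corr_coef x j * (ind t * ex (j%:~R * t))).
  by apply: cintegrable_sum => j; exact: cintegrableZ.
have aP : annihilated 1 (fun t => ind t * P t +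
    -1 * \sum_(j <- s) corr_coef x j * (ind t * ex (j%:~R * t))).
  split; first by apply: cintegrableD => //; exact: cintegrableZ.
  move=> l; have m1 : measurable_fun setT (fun t : R => l%:~R * t / 1).
    by apply: measurable_funM => //; exact: mfreq1.
  under cI_eq do rewrite mulrDl.
  rewrite cID; [|exact: cintegrableM_ex|by apply: cintegrableM_ex => //; exact: cintegrableZ].
  (* [annihilated] and [corr_ft] use opposite signs in the exponent, whence the index [- l]. *)
  have E1 : cI lebR (fun t => ind t * P t * ex (l%:~R * t / 1)) = corr_coef x (- l).
    have icl : cintegrable lebR (fun t => corr x t * ex (- ((- l)%:~R * t))).
      by apply: cintegrableM_ex => //; apply: measurable_funN; exact: mfreq1.
    rewrite /corr_coef /corr_ft (cI_periodize icl).2; apply: cI_ae.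
    - by apply: cmeasM; [exact: cintegrable_cmeas iP|exact: cmeas_ex].
    - exact: cintegrable_cmeas (cI_periodize icl).1.
    apply: (ae_mono (ae_periodize_cintegrable ic)) => t it.
    rewrite -mulrA; congr (_ * _); rewrite /P mulrC -cIZ//.
    apply: cI_eq => m; rewrite mulrC; congr (_ * _).
    rewrite divr1 intrN mulNr opprK mulrDr exD -intrM ex_int mulr1.
    by [].
  have E2 : cI lebR (fun t => -1 * (\sum_(j <- s) corr_coef x j * (ind t * ex (j%:~R * t))) *
      ex (l%:~R * t / 1)) = - corr_coef x (- l).
    transitivity (-1 * \sum_(j <- s) corr_coef x j * (j == - l)%:R).
      transitivity (cI lebR (fun t => -1 * \sum_(j <- s) corr_coef x j *
          (ind t * ex ((j + l)%:~R * t)))).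
        apply: cI_eq => t; rewrite -mulrA mulr_suml; congr (_ * _).
        apply: eq_bigr => j _; rewrite -!mulrA -exD; congr (_ * (_ * ex _)).
        by rewrite divr1 intrD mulrDl.
      have iQl j : cintegrable lebR (fun t => ind t * ex ((j + l)%:~R * t)) by [].
      rewrite cIZ; last by apply: cintegrable_sum => j; exact: cintegrableZ.
      rewrite cI_sum; last by move=> j; exact: cintegrableZ.
      congr (_ * _); apply: eq_bigr => j _; rewrite cIZ// ex_orthogonal.
      by rewrite addr_eq0.
    rewrite mulN1r; congr (- _).
    have [ls|ls] := boolP (- l \in s).
      rewrite (big_rem _ ls)/= eqxx mulr1 big_seq big1 ?addr0// => j.
      by rewrite mem_rem_uniq// inE => /andP[/negbTE -> _]; rewrite mulr0.
    have -> : corr_coef x (- l) = 0.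
      by apply/eqP; apply: contraNT ls => /ms.
    rewrite big_seq big1// => j js; have [E|] := eqVneq j (- l); last by rewrite mulr0.
    by rewrite E (negbTE ls) in js.
  by rewrite E1 E2 subrr.
have vanish t : ~ unit_itv t -> ind t * P t +
    -1 * \sum_(j <- s) corr_coef x j * (ind t * ex (j%:~R * t)) = 0.
  move=> nt; have i0 : ind t = 0 by rewrite /ind indicE memNset.
  by rewrite i0 mul0r add0r big1 ?mulr0// => j _; rewrite mul0r mulr0.
have ae0 := fourier_uniqueness_circle aP vanish.
have PQ : {ae lebR, forall t, P t = Q t}.
  apply: ae_periodic => [t m|].
    have -> : Q (t + m%:~R) = Q t.
      apply: eq_bigr => j _; congr (_ * _).
      by rewrite mulrDr exD -intrM ex_int mulr1.
    suff -> : P (t + m%:~R) = P t by [].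
    rewrite /P -[RHS](cI_preserves (cntZ_preserves R m)
      (h := fun j => corr x (t + j%:~R))); last exact: cmeas_int.
    by apply: cI_eq => j; rewrite intrD (addrC j%:~R) addrA.
  apply: (ae_mono ae0) => t + It.
  have i1 : ind t = 1 by rewrite /ind indicE mem_set.
  rewrite i1 mul1r mulN1r => /eqP; rewrite subr_eq0 => /eqP ->.
  by apply: eq_bigr => j _; rewrite mul1r.
by apply: (ae_mono2 PQ (ae_cI_corr_orbit x)) => t E1 E2; rewrite -E2; exact: E1.
Qed.

Lemma orbit_dot_ae_neq0 x : finite_set [set l | corr_coef x l != 0] ->
  (exists l, corr_coef x l != 0) -> {ae lebR, forall t, orbit_dot t (t + x) != 0}.
Proof.
move=> /orbit_dot_trig_poly[s [us ms K]] [l l0].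
have := trig_poly_ae_neq0 us (c := corr_coef x) (ex_intro2 _ _ l ((ms l).2 l0) l0).
by move=> H; apply: (ae_mono2 K H) => t ->.
Qed.

Lemma orbit_dot_ae_eq0 x : (forall l, corr_coef x l = 0) ->
  {ae lebR, forall t, orbit_dot t (t + x) = 0}.
Proof.
move=> s0; have [|s [us ms K]] := @orbit_dot_trig_poly x.
  rewrite (_ : [set l | corr_coef x l != 0] = set0)//.
  by apply/seteqP; split => // l /=; rewrite s0 eqxx.
apply: (ae_mono K) => t ->; rewrite big1// => j _.
by rewrite s0 mul0r.
Qed.

End correlations.

(** * Choosing extremal and generic points *)

Lemma finite_int_max (A : set int) (m0 : int) : finite_set A -> A m0 ->
  exists2 m, A m & forall j, A j -> j <= m.
Proof.
move=> /finite_fsetP[S SE] Am0.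
have : forall s : seq int, s != [::] -> exists2 m, m \in s & forall j, j \in s -> j <= m.
  elim=> // a s ih _; have [->|s0] := eqVneq s [::].
    by exists a; rewrite ?mem_head// => j; rewrite inE => /eqP ->.
  have [m ms mmax] := ih s0; have [am|am] := leP a m.
    by exists m; rewrite ?inE ?ms ?orbT// => j; rewrite inE => /orP[/eqP ->//|/mmax].
  exists a; rewrite ?mem_head// => j; rewrite inE => /orP[/eqP ->//|/mmax jm].
  exact: le_trans jm (ltW am).
have Sm0 : m0 \in finmap.enum_fset S by move: Am0; rewrite SE.
move=> /(_ (finmap.enum_fset S)) [|m mS mmax].
  by case: (finmap.enum_fset S) Sm0.
exists m; first by rewrite SE.
by move=> j; rewrite SE => /mmax.
Qed.

Lemma measure_le_ae {d : measure_display} {T : measurableType d} {R : realType}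
    (mu : {measure set T -> \bar R}) (A B : set T) :
  measurable A -> measurable B -> {ae mu, forall x, A x -> B x} ->
  (mu A <= mu B)%E.
Proof.
move=> mA mB [N [mN N0 sub]].
apply: (@le_trans _ _ (mu (B `|` N))).
  apply: le_measure; rewrite ?inE//; first exact: measurableU.
  move=> x Ax; have [Nx|Nx] := pselect (N x); first by right.
  by left; apply: contrapT => nB; apply: Nx; apply: sub => /= AB; exact: nB (AB Ax).
by rewrite (le_trans (measureU2 _ _ _))// [X in (_ + X)%E]N0 adde0.
Qed.

Section selection.
Context {R : realType}.
Local Notation lebR := (@lebesgue_measure R).

(** Greedy choice: the points already chosen exclude together less than the measure of [0, 1[, so a
    point of [D] remains. Both directions of [rel] are kept because every ordered pair of points
    enters the matrix of correlations. *)
Lemma select_points (D : set R) (rel : R -> R -> Prop) (c : R) (N : nat) :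
  {ae lebR, forall t, D t} -> 0 <= c ->
  (forall t, D t -> exists V, [/\ measurable V, (lebR V <= c%:E)%E &
     forall t', unit_itv t' -> ~ V t' -> [/\ t' <> t, rel t t' & rel t' t]]) ->
  N%:R * c < 1 ->
  exists s : seq R, [/\ size s = N, uniq s,
    (forall t, t \in s -> unit_itv t /\ D t) &
    (forall t t', t \in s -> t' \in s -> t <> t' -> rel t t')].
Proof.
move=> aeD c0 H; elim: N => [|N ih] Nc; first by exists [::].
have Nc' : N%:R * c < 1.
  by apply: le_lt_trans Nc; apply: ler_wpM2r => //; rewrite ler_nat.
have [s [ss us sD srel]] := ih Nc'.
have [W [mW Wc WP]] : exists W, [/\ measurable W, (lebR W <= ((size s)%:R * c)%:E)%E &
    forall t, t \in s -> forall t', unit_itv t' -> ~ W t' ->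
      [/\ t' <> t, rel t t' & rel t' t]].
  elim: (s) sD => [_|t s' ihs sD'].
    by exists set0; split => //; rewrite measure0 mul0r.
  have [|W [mW Wc WP]] := ihs; first by move=> u us'; apply: sD'; rewrite inE us' orbT.
  have [V [mV Vc VP]] := H t (sD' t (mem_head _ _)).2.
  exists (V `|` W); split; first exact: measurableU.
    rewrite (le_trans (measureU2 _ mV mW))//= -natr1 mulrDl mul1r EFinD addeC.
    exact: leeD.
  move=> u; rewrite inE => /orP[/eqP ->|us'] t' It' /not_orP[nV nW].
    exact: VP.
  exact: WP.
have [t' [It' Dt' nW]] : exists t', [/\ unit_itv t', D t' & ~ W t'].
  apply: contrapT => nex.
  have : (lebR (@unit_itv R) <= lebR W)%E.
    apply: measure_le_ae => //; first exact: measurable_unit_itv.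
    apply: (ae_mono aeD) => t Dt It; apply: contrapT => nWt.
    by apply: nex; exists t.
  rewrite [X in (X <= _)%E]measure_unit_itv => /le_trans /(_ Wc).
  by rewrite lee_fin ss leNgt Nc'.
exists (t' :: s); split => /=.
- by rewrite ss.
- rewrite us andbT; apply/negP => ts.
  by have [] := WP _ ts _ It' nW.
- by move=> t; rewrite inE => /orP[/eqP ->//|/sD].
- move=> t u; rewrite !inE => /orP[/eqP ->|ts] /orP[/eqP ->|us'] tu //.
  + by have [] := WP _ us' _ It' nW.
  + by have [] := WP _ ts _ It' nW.
  + exact: srel.
Qed.

(** Tails have measure tending to 0, so if every tail of measure below [eps] were null, some tail
    would be null. Moving its endpoint left by [eps / 2] adds at most [eps / 2], so the larger tail
    is again null; repeating this reaches all of [A]. *)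
Lemma small_tail (A : set R) (eps : R) : measurable A -> (lebR A < +oo)%E ->
  lebR A <> 0%E -> 0 < eps ->
  exists T, (0 < lebR (A `&` `]T, +oo[%classic))%E /\
            (lebR (A `&` `]T, +oo[%classic) < eps%:E)%E.
Proof.
move=> mA fA A0 e0; apply: contrapT => nex.
have mt T : measurable (A `&` `]T, +oo[%classic : set R).
  by apply: measurableI => //; exact: measurable_itv.
have H T : (lebR (A `&` `]T, +oo[%classic) < eps%:E)%E ->
    lebR (A `&` `]T, +oo[%classic) = 0%E.
  move=> lt; apply/eqP; rewrite eq_le measure_ge0 andbT leNgt.
  by apply/negP => gt; apply: nex; exists T.
have [M HM] : exists M : nat, (lebR (A `&` `]M%:R, +oo[%classic) < eps%:E)%E.
  have := @nonincreasing_cvg_mu _ _ _ lebR (fun k : nat => A `&` `]k%:R, +oo[%classic).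
  have -> : \bigcap_k (A `&` `]k%:R, +oo[%classic) = set0.
    apply/seteqP; split => // x /= Hx.
    have [_ /=] := Hx (Num.bound `|x|) I; rewrite in_itv /= andbT.
    by rewrite ltNge ltW// (le_lt_trans (ler_norm x))// archi_boundP.
  rewrite measure0 => K.
  have cv : lebR (A `&` `]k%:R, +oo[%classic) @[k --> \oo] --> 0%E.
    apply: K.
    - apply: le_lt_trans fA; by apply: (le_measure lebR (mem_set (mt 0)) (mem_set mA)); exact: subIsetl.
    - by move=> i; exact: mt.
    - exact: measurable0.
    - move=> i j ij; apply/subsetPset => x [Ax] /=; rewrite in_itv /= andbT => jx.
      by split => //=; rewrite in_itv /= andbT (le_lt_trans _ jx)// ler_nat.
  have [M _ HM] : \forall k \near \oo, (lebR (A `&` `]k%:R, +oo[%classic) < eps%:E)%E.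
    apply: (cv [set y | (y < eps%:E)%E]); apply: open_nbhs_nbhs; split.
      exact: open_ereal_lt_ereal.
    by rewrite /= lte_fin.
  by exists M; exact: (HM M (leqnn M)).
have Z (k : nat) : lebR (A `&` `]M%:R - k%:R * (eps / 2), +oo[%classic) = 0%E.
  elim: k => [|k ih]; first by rewrite mul0r subr0; exact: H.
  apply: H; set T := M%:R - k%:R * (eps / 2) in ih *.
  have -> : M%:R - k.+1%:R * (eps / 2) = T - eps / 2.
    by rewrite /T -natr1; field.
  apply: (@le_lt_trans _ _ (lebR (`]T - eps / 2, T]%classic `|` (A `&` `]T, +oo[%classic)))).
    apply: (le_measure lebR (mem_set (mt _)) (mem_set (measurableU _ _ (measurable_itv _) (mt T)))).
    move=> x [Ax] /=; rewrite in_itv /= andbT => lt.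
    by have [xT|Tx] := leP x T; [left; rewrite in_itv /= lt xT|right; split => //=; rewrite in_itv /= Tx].
  apply: (le_lt_trans (measureU2 lebR (measurable_itv _) (mt T))).
  rewrite [X in (_ + X)%E]ih adde0 [X in (X < _)%E](_ : _ = (eps / 2)%:E).
    by rewrite lte_fin; lra.
  have := @lebesgue_measure_itv R `]T - eps / 2, T] => /= ->.
  rewrite lte_fin ltrBlDr ltrDl divr_gt0// -EFinB; congr (_%:E); ring.
apply: A0; apply/(ae_notP lebR mA).
have : {ae lebR, forall x, forall k : nat, ~ (A `&` `]M%:R - k%:R * (eps / 2), +oo[%classic) x}.
  by apply: ae_foralln => k; apply/(ae_notP lebR (mt _)); exact: Z.
move=> K; apply: (ae_mono K) => x Hx Ax.
pose k := Num.bound `|(M%:R - x) / (eps / 2)|.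
apply: (Hx k); split => //=; rewrite in_itv /= andbT ltrBlDr -ltrBlDl.
have e2 : 0 < eps / 2 by rewrite divr_gt0.
rewrite -ltr_pdivrMr//; apply: le_lt_trans (ler_norm _) _.
exact: archi_boundP.
Qed.

(** The points whose class enters [B1] after translation, or [B2] after reflection, have measure at
    most [e] each within [0, 1[, by [measure_orbit_le]; the point [t] itself adds nothing. *)
Lemma avoid_orbits (t a b e : R) (B1 B2 : set R) : measurable B1 -> measurable B2 ->
  (lebR B1 <= e%:E)%E -> (lebR B2 <= e%:E)%E ->
  exists V, [/\ measurable V, (lebR V <= (2 * e)%:E)%E &
    forall t', unit_itv t' -> ~ V t' -> [/\ t' <> t,
      forall j : int, ~ B1 (t' + j%:~R + a) &
      forall j : int, ~ B2 (b - (t' + j%:~R))]].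
Proof.
move=> mB1 mB2 l1 l2.
have push phi B : preserves lebR phi -> measurable B -> (lebR B <= e%:E)%E ->
    exists W, [/\ measurable W, (lebR W <= e%:E)%E &
      forall t', unit_itv t' -> ~ W t' -> forall j : int, ~ B (phi (t' + j%:~R))].
  move=> [mphi Ephi] mB lB.
  have mC : measurable (phi @^-1` B).
    by rewrite -[X in measurable X]setTI; exact: (mphi measurableT _ mB).
  have [mW Wle] := measure_orbit_le mC.
  exists [set t | unit_itv t /\ exists m : int, (phi @^-1` B) (t + m%:~R)]; split.
  - exact: mW.
  - by apply: (le_trans Wle); rewrite Ephi.
  - by move=> t' It' nW j Bj; apply: nW; split; [exact: It'|exists j].
have [W1 [mW1 lW1 W1P]] := push _ _ (preserves_shift a) mB1 l1.
have [W2 [mW2 lW2 W2P]] := push _ _ (preserves_reflect b) mB2 l2.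
have mW12 : measurable (W1 `|` W2) by exact: measurableU.
exists (W1 `|` W2 `|` [set t]); split.
- by apply: measurableU; [exact: mW12|exact: measurable_set1].
- apply: (le_trans (measureU2 lebR mW12 (measurable_set1 t))).
  rewrite [X in (_ + X)%E]lebesgue_measure_set1 adde0.
  apply: (le_trans (measureU2 lebR mW1 mW2)).
  by rewrite mulr_natl mulr2n EFinD; exact: leeD.
- move=> t' It' /not_orP[/not_orP[n1 n2] nt]; split.
  + by move=> tt; exact: nt tt.
  + exact: W1P.
  + exact: W2P.
Qed.

End selection.

(** * Vanishing of the coefficients under a summability condition *)

Section core.
Context {R : realType}.
Local Notation lebR := (@lebesgue_measure R).
Local Notation cnt := (cntZ R).
Variables (n : nat) (f g : 'I_n -> R -> R[i]).
Hypothesis Lf : forall k, sqint lebR (f k).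
Hypothesis Lg : forall k, sqint lebR (g k).
Local Notation corr_coef := (corr_coef f g).
Local Notation orbit_dot := (orbit_dot f g).

Definition active : set R := [set x | exists l, corr_coef x l != 0%R].

Let measurable_slice l : measurable [set x | corr_coef x l != 0%R].
Proof.
have mk : cmeas (fun x => corr_coef x l).
  exact: (cmeas_comp (cmeas_corr_coef Lf Lg) (pair2_measurable l)).
exact: (cmeas_neq0 mk).
Qed.

Let measurable_active : measurable active.
Proof.
have -> : active = (\bigcup_k [set x | corr_coef x (Posz k) != 0]) `|`
    (\bigcup_k [set x | corr_coef x (Negz k) != 0]).
  apply/seteqP; split => x.
    by move=> [[] k Hk]; [left|right]; exists k.
  by move=> [[k _ Hk]|[k _ Hk]]; [exists (Posz k)|exists (Negz k)].
by apply: measurableU; apply: bigcup_measurable => k _; exact: measurable_slice.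
Qed.

(** Obtained by slicing the set of finite measure at the frequencies [y + l], for almost every [y],
    once [f] is modulated by [y]. *)
Hypothesis fin : (\int[cnt]_l lebR [set x | corr_coef x l != 0%R] < +oo)%E.

Let cnt_fin : (\int[lebR]_x cnt [set l | corr_coef x l != 0%R] < +oo)%E /\
  measurable_fun setT (fun x => cnt [set l | corr_coef x l != 0%R]).
Proof.
pose h (z : R * int) : \bar R := (\1_[set z : R * int | corr_coef z.1 z.2 != 0] z)%:E.
have mh : measurable_fun setT h.
  by apply/measurable_EFinP/measurable_indic; exact: (cmeas_neq0 (cmeas_corr_coef Lf Lg)).
have h0 z : (0 <= h z)%E by rewrite lee_fin.
have E1 x : (\int[cnt]_l h (x, l) = cnt [set l | corr_coef x l != 0%R])%E.
  transitivity (\int[cnt]_l (\1_[set l | corr_coef x l != 0%R] l)%:E)%E.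
    exact: eq_integral.
  by rewrite integral_indic// setIT.
have E2 l : (\int[lebR]_x h (x, l) = lebR [set x | corr_coef x l != 0%R])%E.
  transitivity (\int[lebR]_x (\1_[set x | corr_coef x l != 0%R] x)%:E)%E.
    exact: eq_integral.
  by rewrite integral_indic ?setIT//; exact: measurable_slice.
split.
  under eq_integral do rewrite -E1.
  rewrite (fubini_tonelli (m1 := lebR) (m2 := cnt) h mh h0).
  by under eq_integral do rewrite E2.
have -> : (fun x => cnt [set l | corr_coef x l != 0%R]) = (fun x => \int[cnt]_l h (x, l))%E.
  by apply/funext => x; rewrite E1.
exact: (measurable_fun_fubini_tonelli_F (m2 := cnt) h mh h0).
Qed.

Let ae_finite_corr_coef : {ae lebR, forall x, finite_set [set l | corr_coef x l != 0%R]}.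
Proof.
have [c1 c2] := cnt_fin.
have := ge0_integral_lty_ae (mu := lebR) c2 _ c1.
move=> /(_ (fun x => measure_ge0 _ _)) H; apply: (ae_mono H) => x.
exact: cntZ_lty_finite.
Qed.

Let active_lty : (lebR active < +oo)%E.
Proof.
have [c1 c2] := cnt_fin; apply: le_lt_trans c1.
have -> : lebR active = (\int[lebR]_x (\1_active x)%:E)%E.
  by rewrite integral_indic// setIT.
apply: ge0_le_integral => //.
- exact/measurable_EFinP/measurable_indic.
- move=> x _; rewrite indicE; case: (boolP (x \in active)) => [/set_mem [l Hl]|_] /=.
    apply: (@le_trans _ _ (cnt [set l])); first by rewrite (cntZ_set1 R l).
    by apply: le_measure; rewrite ?inE// => j /= ->.
  exact: measure_ge0.
Qed.

(** The dichotomy imposed by finitely many coefficients, packaged so that it can be required at all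
    integer translates of a point at once. *)
Definition generic (x : R) : Prop :=
  (active x -> {ae lebR, forall t, orbit_dot t (t + x) != 0}) /\
  (~ active x -> {ae lebR, forall t, orbit_dot t (t + x) = 0}).

Let ae_generic : {ae lebR, forall x, generic x}.
Proof.
apply: (ae_mono ae_finite_corr_coef) => x fx; split.
  by move=> ax; exact: (orbit_dot_ae_neq0 Lf Lg fx ax).
move=> nax; apply: (orbit_dot_ae_eq0 Lf Lg) => l; apply/eqP; apply: contrapT => /negP ln.
by apply: nax; exists l.
Qed.

Let cmeas_orbit_dot_l : cmeas (fun z : R * R => orbit_dot z.2 (z.2 + z.1)).
Proof.
apply: (cmeas_comp (cmeas_orbit_dot Lf Lg) (phi := fun z : R * R => (z.2, z.2 + z.1))).
apply: measurable_fun_pair; first exact: measurable_snd.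
by apply: measurable_funD; [exact: measurable_snd|exact: measurable_fst].
Qed.

Let cmeas_orbit_dot_r : cmeas (fun z : R * R => orbit_dot (z.2 - z.1) z.2).
Proof.
apply: (cmeas_comp (cmeas_orbit_dot Lf Lg) (phi := fun z : R * R => (z.2 - z.1, z.2))).
apply: measurable_fun_pair; last exact: measurable_snd.
by apply: measurable_funB; [exact: measurable_snd|exact: measurable_fst].
Qed.

(* With [A] and [B] the orbits of [f] and [g] sampled at [t_0 < ... < t_n] and at
   [t_i + x0], where [x0] is a rightmost active point of its class modulo 1, the
   correlations would be block triangular of size [n + 1]. The points [t_i] can be
   chosen generically because the active points beyond [T] have measure below
   [eps], so that each [t_i] excludes only a set of measure [2 * eps]. *)
Lemma ae_corr_coef_eq0 : {ae lebR, forall x, forall l, corr_coef x l = 0}.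
Proof.
suff /(ae_notP lebR measurable_active) H : lebR active = 0%E.
  apply: (ae_mono H) => x nax l; apply/eqP; apply: contrapT => /negP ln.
  by apply: nax; exists l.
apply: contrapT => a0.
(* The exclusions of [n + 1] points total [(n + 1) * (2 * eps) = (n + 1) / (n + 2) < 1]. *)
pose eps : R := (2 * n.+2%:R)^-1.
have e0 : 0 < eps by rewrite invr_gt0 mulr_gt0// ltr0Sn.
have [T [Tpos Tsmall]] := small_tail measurable_active active_lty a0 e0.
set E := active `&` _ in Tpos Tsmall.
have mE : measurable E by apply: measurableI => //; exact: measurable_itv.
have EP x : E x <-> active x /\ T < x.
  by rewrite /E /setI /= in_itv /= andbT.
(* Almost every class modulo 1 is generic throughout and meets [E] in a finite set. As [E] is not
   null, some such class meets it, and [x0] is the largest element of that intersection. *)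
have [x0 [Ex0 x0top gx0]] : exists x0, [/\ E x0, forall j : int, 0 < j -> ~ E (x0 + j%:~R) &
    forall j : int, generic (x0 + j%:~R)].
  have gall : {ae lebR, forall x, forall j : int, generic (x + j%:~R)}.
    by apply: ae_forall_int => j; exact: (ae_preserves (preserves_shift (j%:~R : R)) ae_generic).
  have fall := ae_finite_orbit mE (lt_trans Tsmall (ltry _)).
  have [x [Ex gx fx]] : exists x, [/\ E x, forall j : int, generic (x + j%:~R) &
      finite_set [set m : int | E (x + m%:~R)]].
    apply: contrapT => nex; move: Tpos.
    suff -> : lebR E = 0%E by rewrite ltxx.
    apply/(ae_notP lebR mE).
    apply: (ae_mono2 gall fall) => x gx fx Ex; apply: nex; exists x; split => //.
  have [|m Em mmax] := @finite_int_max _ 0 fx; first by rewrite /= addr0.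
  exists (x + m%:~R); split => //.
    move=> j j0; rewrite -addrA -intrD => /mmax; lia.
  by move=> j; rewrite -addrA -intrD; exact: gx.
have Tx0 : T < x0 by move/EP: Ex0 => [].
(* Displacements beyond [T] that spoil a pairing with [f] at [t]; [B2 s] collects those for [g] at
   [s]. A new sample point enters pairings from both sides. *)
pose B1 t := [set x | T < x /\ orbit_dot t (t + x) != 0].
pose B2 s := [set x | T < x /\ orbit_dot (s - x) s != 0].
have mTx : measurable [set x : R | T < x].
  have -> : [set x : R | T < x] = `]T, +oo[%classic.
    by apply/seteqP; split => x /=; rewrite in_itv /= andbT.
  exact: measurable_itv.
have mB1 t : measurable (B1 t).
  have -> : B1 t = [set x | T < x] `&` [set x | orbit_dot t (t + x) != 0] by [].
  apply: measurableI => //.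
  exact: (cmeas_neq0 (cmeas_comp cmeas_orbit_dot_l (pair2_measurable t))).
have mB2 s : measurable (B2 s).
  have -> : B2 s = [set x | T < x] `&` [set x | orbit_dot (s - x) s != 0] by [].
  apply: measurableI => //.
  exact: (cmeas_neq0 (cmeas_comp cmeas_orbit_dot_r (pair2_measurable s))).
(* Genericity concerns almost all [t] for fixed [x]; [ae_swap] turns it into almost all [x] for
   fixed [t], so that [B1 t] lies in [E] up to a null set. *)
have aeB1 : {ae lebR, forall t, (lebR (B1 t) <= lebR E)%E}.
  have mN : measurable ([set z : R * R | T < z.2 /\ ~ E z.2] `&`
      [set z : R * R | orbit_dot z.1 (z.1 + z.2) != 0]).
    apply: measurableI.
      have -> : [set z : R * R | T < z.2 /\ ~ E z.2] = snd @^-1` ([set x | T < x] `&` ~` E) by [].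
      rewrite -[X in measurable X]setTI; apply: measurable_snd => //.
      by apply: measurableI => //; exact: measurableC.
    exact: (cmeas_neq0 (cmeas_comp cmeas_orbit_dot_l (measurable_swap (T1 := R) (T2 := R)))).
  have K : {ae lebR, forall t, {ae lebR, forall x, ~ ([set z : R * R | T < z.2 /\ ~ E z.2] `&`
      [set z : R * R | orbit_dot z.1 (z.1 + z.2) != 0]) (t, x)}}.
    apply: (ae_swap (m1 := lebR) (m2 := lebR) mN).
    apply: (ae_mono ae_generic) => x [_ gx].
    have [[Tx nEx]|nn] := pselect (T < x /\ ~ E x).
      have nax : ~ active x by move=> ax; apply: nEx; apply/EP.
      by apply: (ae_mono (gx nax)) => t k0 [_] /=; rewrite k0 eqxx.
    by apply: aeW => t [].
  apply: (ae_mono K) => t Kt; apply: (measure_le_ae (mu := lebR) (mB1 t) mE).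
  have K2 : {ae lebR, forall x, B1 t x -> E x}.
    apply: (ae_mono Kt) => x nx [Tx kx]; apply: contrapT => nEx.
    by apply: nx; split.
  exact: K2.
have aeB2 : {ae lebR, forall s, (lebR (B2 s) <= lebR E)%E}.
  have mN : measurable ([set z : R * R | T < z.2 /\ ~ E z.2] `&`
      [set z : R * R | orbit_dot (z.1 - z.2) z.1 != 0]).
    apply: measurableI.
      have -> : [set z : R * R | T < z.2 /\ ~ E z.2] = snd @^-1` ([set x | T < x] `&` ~` E) by [].
      rewrite -[X in measurable X]setTI; apply: measurable_snd => //.
      by apply: measurableI => //; exact: measurableC.
    exact: (cmeas_neq0 (cmeas_comp cmeas_orbit_dot_r (measurable_swap (T1 := R) (T2 := R)))).
  have K : {ae lebR, forall s, {ae lebR, forall x, ~ ([set z : R * R | T < z.2 /\ ~ E z.2] `&`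
      [set z : R * R | orbit_dot (z.1 - z.2) z.1 != 0]) (s, x)}}.
    apply: (ae_swap (m1 := lebR) (m2 := lebR) mN).
    apply: (ae_mono ae_generic) => x [_ gx].
    have [[Tx nEx]|nn] := pselect (T < x /\ ~ E x).
      have nax : ~ active x by move=> ax; apply: nEx; apply/EP.
      have := ae_preserves (preserves_shift (- x)) (gx nax).
      by move=> K; apply: (ae_mono K) => s; rewrite subrK => k0 [_] /=; rewrite k0 eqxx.
    by apply: aeW => s [].
  apply: (ae_mono K) => s Ks; apply: (measure_le_ae (mu := lebR) (mB2 s) mE).
  have K2 : {ae lebR, forall x, B2 s x -> E x}.
    apply: (ae_mono Ks) => x nx [Tx kx]; apply: contrapT => nEx.
    by apply: nx; split.
  exact: K2.
pose D t := [/\ in_l2 (orbit_vec f t) /\ in_l2 (orbit_vec g (t + x0)),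
  (lebR (B1 t) <= lebR E)%E, (lebR (B2 (t + x0)%R) <= lebR E)%E,
  orbit_dot t (t + x0) != 0 & forall j : int, 0 < j -> orbit_dot t (t + (x0 + j%:~R)) = 0].
have aeD : {ae lebR, forall t, D t}.
  have D1 := ae_mono2 (ae_orbit_in_l2 Lf)
    (ae_preserves (preserves_shift x0) (ae_orbit_in_l2 Lg)) (fun t a b => conj a b).
  have D2 := ae_mono2 aeB1 (ae_preserves (preserves_shift x0) aeB2) (fun t a b => conj a b).
  have D3 : {ae lebR, forall t, orbit_dot t (t + x0) != 0}.
    have [g0 _] := gx0 0; rewrite addr0 in g0; apply: g0.
    by move/EP: Ex0 => [].
  have D4 : {ae lebR, forall t, forall j : int, 0 < j -> orbit_dot t (t + (x0 + j%:~R)) = 0}.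
    apply: ae_forall_int => j; have [j0|j0] := ltP 0 j; last by apply: aeW.
    have [_ gj] := gx0 j; apply: (ae_mono (gj _)) => // ax.
    apply: (x0top j j0); apply/EP; split => //.
    by apply: (lt_trans Tx0); rewrite ltrDl ltr0z.
  have D34 := ae_mono2 D3 D4 (fun t a b => conj a b).
  have D12 := ae_mono2 D1 D2 (fun t a b => conj a b).
  by apply: (ae_mono2 D12 D34) => t [d1 [d2 d3]] [d4 d5]; split.
pose rel t t' := forall j : int, T < t' + x0 + j%:~R - t -> orbit_dot t (t' + x0 + j%:~R) = 0.
have [s [ss us sD srel]] : exists s : seq R, [/\ size s = n.+1, uniq s,
    (forall t, t \in s -> unit_itv t /\ D t) &
    (forall t t', t \in s -> t' \in s -> t <> t' -> rel t t')].
  apply: (@select_points R D rel (2 * eps)) => //; first by rewrite mulr_ge0// ltW.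
    move=> t [_ b1 b2 _ _].
    have le_eps V : (lebR V <= lebR E)%E -> (lebR V <= eps%:E)%E.
      by move=> VE; exact: le_trans VE (ltW Tsmall).
    have [V [mV Vle VP]] := avoid_orbits t (x0 - t) (t + x0) (mB1 t)
      (mB2 (t + x0)) (le_eps _ b1) (le_eps _ b2).
    exists V; split; [exact: mV|exact: Vle|move=> t' It' nV].
    have [tt nB1 nB2] := VP t' It' nV; split; first exact: tt.
    - move=> j Tj; apply/eqP; apply: contrapT => /negP k0.
      apply: (nB1 j); rewrite /B1 /=.
      have -> : t' + j%:~R + (x0 - t) = t' + x0 + j%:~R - t by ring.
      split; first exact: Tj.
      by have -> : t + (t' + x0 + j%:~R - t) = t' + x0 + j%:~R by ring.
    - move=> j Tj; apply/eqP; apply: contrapT => /negP k0.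
      (* A common integer shift leaves [orbit_dot] unchanged, so [j] can be moved from the orbit of
         [g] to that of [f]. *)
      apply: (nB2 (- j)); rewrite /B2 /=.
      have -> : t + x0 - (t' + (- j)%:~R) = t + x0 + j%:~R - t' by rewrite intrN; ring.
      split; first exact: Tj.
      have -> : t + x0 - (t + x0 + j%:~R - t') = t' - j%:~R by ring.
      rewrite -(orbit_dot_shift f g _ _ j) subrK; exact: k0.
  rewrite /eps; have -> : n.+1%:R * (2 * (2 * n.+2%:R)^-1) = n.+1%:R / n.+2%:R :> R.
    by rewrite invfM [2 * _]mulrA divff ?mul1r// pnatr_eq0.
  by rewrite ltr_pdivrMr ?ltr0Sn// mul1r ltr_nat.
pose s' := sort <=%R s.
have ss' : size s' = n.+1 by rewrite size_sort.
have ms' t : (t \in s') = (t \in s) by rewrite mem_sort.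
have us' : uniq s' by rewrite sort_uniq.
have lts' : sorted <%R s' by rewrite sort_lt_sorted.
pose p (i : 'I_n.+1) := nth 0 s' i.
have ps i : p i \in s by rewrite -ms'; apply: mem_nth; rewrite ss'.
have ppos (i c : 'I_n.+1) : (i < c)%N -> p i < p c.
  move=> ic; apply: (sorted_ltn_nth lt_trans 0 lts') => //; by rewrite inE ss'.
have pneq (i c : 'I_n.+1) : i != c -> p i <> p c.
  move=> ic /eqP; rewrite /p nth_uniq ?ss'// => /eqP/val_inj E2.
  by rewrite E2 eqxx in ic.
have : (n.+1 <= n)%N; last by rewrite ltnn.
apply: (@triangular_correlations R n n.+1 (fun i => orbit_vec f (p i))
  (fun i => orbit_vec g (p i + x0))).
- by move=> i; have [_ [[]]] := sD _ (ps i).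
- by move=> i; have [_ [[]]] := sD _ (ps i).
- move=> i c j jc; rewrite -orbit_vec_shift.
  have [Ii [_ _ _ _ di]] := sD _ (ps i); have [Ic _] := sD _ (ps c).
  (* For [i = c] the displacement is [x0 + j] with [j > 0], inactive because [x0] is rightmost; the
     other pairs are covered by [rel]. *)
  have [Eic|ic] := eqVneq i c.
    rewrite -Eic -addrA; apply: di; case: jc => // -[_].
    by rewrite Eic ltnn.
  apply: (srel _ _ (ps i) (ps c) (pneq _ _ ic)).
  suff : 0 < p c + j%:~R - p i by lra.
  case: jc => [j0|[-> ltic]]; last by rewrite addr0 subr_gt0 ppos.
  (* Points of [0, 1[ differ by less than 1, so [j >= 1] gives a positive displacement in either
     order of the points. *)
  have j1 : 1 <= j%:~R :> R by rewrite ler1z.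
  move: Ii Ic; rewrite /unit_itv /= !in_itv /= => /andP[_ a1] /andP[a2 _].
  lra.
- by move=> i; have [_ []] := sD _ (ps i).
Qed.

End core.

(** * From the transform to the integral kernel *)

Section fourier_wigner.
Context {R : realType}.
Local Notation lebR := (@lebesgue_measure R).
Local Notation cnt := (cntZ R).

Lemma ex_neq0 (s : R) : ex s != 0.
Proof.
apply/negP => /eqP e0; have := @ex0 R.
by rewrite -(subrr s) exD e0 mul0r => /eqP; rewrite eq_sym oner_eq0.
Qed.

Lemma ae_exists (P : R -> Prop) : {ae lebR, forall t, P t} -> exists t, P t.
Proof.
move=> aP; apply: contrapT => nP.
have : (lebR (@unit_itv R) <= lebR set0)%E.
  apply: (measure_le_ae (mu := lebR) measurable_unit_itv measurable0).
  have K : {ae lebR, forall t, @unit_itv R t -> set0 t}.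
    by apply: (ae_mono aP) => t Pt; exfalso; apply: nP; exists t.
  exact: K.
by rewrite measure0 [X in (X <= _)%E]measure_unit_itv lee_fin ler10.
Qed.

Variables (n : nat) (f g : 'I_n -> R -> R[i]).
Hypothesis Lf : forall k, sqint lebR (f k).
Hypothesis Lg : forall k, sqint lebR (g k).

Let measurable_freq (y : R) : measurable_fun setT (fun t : R => - (y * t)).
Proof. by apply: measurable_funN; exact: measurable_funM. Qed.

Lemma alphaE (w : R * R) : alpha f g w = ex (- (w.1 * w.2 / 2)) * corr_ft f g w.1 w.2.
Proof.
case: w => x y; rewrite /alpha /corr_ft /corr /=.
have ik k : cintegrable lebR (fun t => f k t * (g k (t + x))^* * ex (- (y * t))).
  apply: (cintegrableM_ex (measurable_freq y)); apply: sqint_mul_conj => //.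
  exact: (sqint_preserves (preserves_shift x) (Lg k)).
transitivity (\sum_k ex (- (x * y / 2)) *
    cI lebR (fun t => f k t * (g k (t + x))^* * ex (- (y * t)))).
  apply: eq_bigr => k _; rewrite -cIZ//; apply: cI_eq => t.
  rewrite /rho mul1r.
  have -> : expi (pi * (x * y + 2 * y * t)) = ex (x * y / 2 + y * t).
    by congr expi; field.
  by rewrite rmorphM /= -exN opprD exD; ring.
rewrite -mulr_sumr -cI_sum//; congr (_ * _); apply: cI_eq => t.
by rewrite mulr_suml.
Qed.

Let measurable_corr_ft_slice y : measurable [set x | corr_ft f g x y != 0].
Proof.
exact: (cmeas_neq0 (cmeas_comp (cmeas_corr_ft Lf Lg) (pair2_measurable y))).
Qed.

(** The measures of the slices at height [y] have a finite integral in [y], so their sum over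
    [y + Z] is finite for almost every [y]. Of the coefficients that then vanish, the one of index 0
    is the value at [y] itself. *)
Lemma ae_corr_ft_eq0 :
  ((lebR \x lebR)%E [set w | corr_ft f g w.1 w.2 != 0%R] < +oo)%E ->
  {ae lebR, forall x, {ae lebR, forall y, corr_ft f g x y = 0}}.
Proof.
pose A := [set w : R * R | corr_ft f g w.1 w.2 != 0]; move=> fA.
have mA : measurable A := cmeas_neq0 (cmeas_corr_ft Lf Lg).
pose h (w : R * R) : \bar R := (\1_A w)%:E.
have mh : measurable_fun setT h by apply/measurable_EFinP/measurable_indic.
have h0 w : (0 <= h w)%E by rewrite lee_fin.
have E y : (\int[lebR]_x h (x, y) = lebR [set x | corr_ft f g x y != 0%R])%E.
  transitivity (\int[lebR]_x (\1_[set x | corr_ft f g x y != 0%R] x)%:E)%E.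
    exact: eq_integral.
  by rewrite integral_indic ?setIT//; exact: measurable_corr_ft_slice.
have m1 : measurable_fun setT (fun y => lebR [set x | corr_ft f g x y != 0]).
  have -> : (fun y => lebR [set x | corr_ft f g x y != 0]) = (fun y => \int[lebR]_x h (x, y))%E.
    by apply/funext => y; rewrite E.
  exact: (measurable_fun_fubini_tonelli_G (m1 := lebR) h mh h0).
have f1 : (\int[lebR]_y lebR [set x | corr_ft f g x y != 0%R] < +oo)%E.
  under eq_integral do rewrite -E.
  rewrite -(fubini_tonelli2 (m1 := lebR) (m2 := lebR) h mh h0).
  by rewrite integral_indic// setIT.
have H2 := ae_periodize_lty m1 (fun y => measure_ge0 _ _) f1.
have H3 : {ae lebR, forall y, {ae lebR, forall x, ~ A (x, y)}}.
  apply: (ae_mono H2) => y fy.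
  (* The modulation moves the sampled frequencies from [Z] to [y + Z] and preserves square
     integrability. *)
  pose f' k t := ex (- (y * t)) * f k t.
  have Lf' k : sqint lebR (f' k).
    have [mf sf] := Lf k; split.
      by apply: cmeasM => //; exact: (cmeas_ex (measurable_freq y)).
    by under eq_integral do rewrite sqnM sqn_ex mul1r.
  have corr_coefE x l : corr_coef f' g x l = corr_ft f g x (y + l%:~R).
    apply: cI_eq => t; rewrite mulrDl opprD exD /corr !mulr_suml.
    by apply: eq_bigr => k _; rewrite /f'; ring.
  have fin' : (\int[cnt]_l lebR [set x | corr_coef f' g x l != 0%R] < +oo)%E.
    under eq_integral do under eq_set do rewrite corr_coefE.
    exact: fy.
  apply: (ae_mono (ae_corr_coef_eq0 Lf' Lg fin')) => x /(_ 0).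
  by rewrite corr_coefE addr0 /A /= => ->; rewrite eqxx.
have H4 := ae_swap (m1 := lebR) (m2 := lebR) mA H3.
apply: (ae_mono H4) => x Hx; apply: (ae_mono Hx) => y /negP.
by rewrite negbK => /eqP.
Qed.

(** Vanishing almost everywhere says nothing at prescribed frequencies, so a base frequency [y] is
    chosen for which all [y + l / (i + 1)] are good at once; modulated by [y], the correlation is
    annihilated for every period [i + 1]. *)
Lemma ae_corr_eq0 x : {ae lebR, forall y, corr_ft f g x y = 0} ->
  {ae lebR, forall t, corr f g x t = 0}.
Proof.
move=> H.
have : {ae lebR, forall y, forall i : nat, forall l : int,
    corr_ft f g x (y + l%:~R / i.+1%:R) = 0}.
  apply: ae_foralln => i; apply: ae_forall_int => l.
  exact: (ae_preserves (preserves_shift (l%:~R / i.+1%:R)) H).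
move=> /ae_exists[y Hy].
have aF : {ae lebR, forall t, corr f g x t * ex (- (y * t)) = 0}.
  apply: fourier_uniqueness_line => i; split.
    exact: (cintegrableM_ex (measurable_freq y) (cintegrable_corr Lf Lg x)).
  move=> l; rewrite -[RHS](Hy i (- l)); apply: cI_eq => t.
  rewrite -mulrA -exD; congr (_ * ex _).
  by rewrite intrN; ring.
apply: (ae_mono aF) => t /eqP; rewrite mulf_eq0 (negbTE (ex_neq0 _)) orbF.
by move/eqP.
Qed.

(** With [x = s - t], [corr x t] is the kernel at [(t, s)]; for fixed [t] this substitution
    preserves null sets. *)
Lemma ae_kernel_eq0 :
  {ae lebR, forall x, {ae lebR, forall t, corr f g x t = 0}} ->
  {ae lebR, forall t, {ae lebR, forall s, \sum_k f k t * (g k s)^* = 0}}.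
Proof.
move=> H.
have mN : measurable [set z : R * R | corr f g z.2 z.1 != 0].
  exact: (cmeas_neq0 (cmeas_comp (cmeas_corr Lf Lg) (measurable_swap (T1 := R) (T2 := R)))).
have K : {ae lebR, forall x, {ae lebR, forall t,
    ~ [set z : R * R | corr f g z.2 z.1 != 0] (t, x)}}.
  apply: (ae_mono H) => x Hx; apply: (ae_mono Hx) => t /= ->.
  by rewrite eqxx.
apply: (ae_mono (ae_swap (m1 := lebR) (m2 := lebR) mN K)) => t Ht.
apply: (ae_mono (ae_preserves (preserves_shift (- t)) Ht)) => s /negP /=.
by rewrite negbK /corr addrC subrK => /eqP.
Qed.

Lemma finop_eq0 t phi : sqint lebR phi ->
  {ae lebR, forall s, \sum_k f k t * (g k s)^* = 0} -> finop f g phi t = 0.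
Proof.
move=> Lphi H; rewrite /finop.
have ik k : cintegrable lebR (fun s => phi s * (g k s)^*) by exact: sqint_mul_conj.
transitivity (\sum_k cI lebR (fun s => f k t * (phi s * (g k s)^*))).
  by apply: eq_bigr => k _; rewrite cIZ// mulrC.
have ikf k : cintegrable lebR (fun s => f k t * (phi s * (g k s)^*)).
  exact: cintegrableZ.
rewrite -cI_sum// -[RHS](cI0 lebR); apply: cI_ae.
- by apply: (cintegrable_cmeas (mu := lebR)); exact: cintegrable_sum.
- exact: cmeas_cst.
- apply: (ae_mono H) => s Hs; transitivity (phi s * \sum_k f k t * (g k s)^*).
    by rewrite mulr_sumr; apply: eq_bigr => k _; ring.
  by rewrite Hs mulr0.
Qed.

End fourier_wigner.

Theorem theorem1p2 (R : realType) (n : nat) (f g : 'I_n -> R -> R[i]) :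
  (forall k, L2 (f k)) -> (forall k, L2 (g k)) ->
  (((leb R) \x (leb R))%E [set w | alpha f g w != 0%R] < +oo)%E ->
  forall phi : R -> R[i], L2 phi ->
    {ae leb R, forall t, finop f g phi t = 0}.
Proof.
have sq h : L2 h -> sqint (leb R) h by move=> [a [b c]].
move=> L2f L2g; have Lf k := sq _ (L2f k); have Lg k := sq _ (L2g k).
have -> : [set w | alpha f g w != 0] = [set w | corr_ft f g w.1 w.2 != 0].
  apply/seteqP; split => w /=; rewrite (alphaE Lf Lg) mulf_eq0 (negbTE (ex_neq0 _)) //.
move=> /(ae_corr_ft_eq0 Lf Lg) H phi /sq Lphi.
have H2 : {ae leb R, forall x, {ae leb R, forall t, corr f g x t = 0}}.
  by apply: (ae_mono H) => x; exact: ae_corr_eq0.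
by apply: (ae_mono (ae_kernel_eq0 Lf Lg H2)) => t; exact: finop_eq0.
Qed.
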